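(* Let $n\ge1$ and $0<s<\min\{1,n/2\}$. Let $f\in C^{0,\alpha}(\mathbb{R}^n)$ with compact support, for some $0<\alpha\le1$, and define $$u(x)=(-\Delta)^{-s}f(x)=\frac{1}{\Gamma(s)}\int_0^\infty e^{t\Delta}f(x)\,\frac{dt}{t^{1-s}},\qquad x\in\mathbb{R}^n.$$ (i) If $\alpha+2s<1$ then $u\in C^{0,\alpha+2s}(\mathbb{R}^n)$ and $$\|u\|_{C^{0,\alpha+2s}(\mathbb{R}^n)}\le C\big(\|u\|_{L^\infty(\mathbb{R}^n)}+\|f\|_{C^{0,\alpha}(\mathbb{R}^n)}\big).$$ (ii) If $1<\alpha+2s<2$ then $u\in C^{1,\alpha+2s-1}(\mathbb{R}^n)$ and $$\|u\|_{C^{1,\alpha+2s-1}(\mathbb{R}^n)}\le C\big(\|u\|_{L^\infty(\mathbb{R}^n)}+\|f\|_{C^{0,\alpha}(\mathbb{R}^n)}\big).$$ (iii) If $2<\alpha+2s<3$ then $u\in C^{2,\alpha+2s-2}(\mathbb{R}^n)$ and $$\|u\|_{C^{2,\alpha+2s-2}(\mathbb{R}^n)}\le C\big(\|u\|_{L^\infty(\mathbb{R}^n)}+\|f\|_{C^{0,\alpha}(\mathbb{R}^n)}\big).$$ (iv) If $\alpha+2s=k$, $k=1,2$, then $u\in\Lambda_\ast^k$ and $$\|u\|_{\Lambda_\ast^k}\le C\big(\|u\|_{L^\infty(\mathbb{R}^n)}+\|f\|_{C^{0,\alpha}(\mathbb{R}^n)}\big).$$ The constants $C>0$ above depend only on $n$,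 $s$ and $\alpha$. Moreover, $u$ is the unique bounded classical solution to $(-\Delta)^su=f$ in $\mathbb{R}^n$ that vanishes at infinity.
   Context: $e^{t\Delta}$ is the heat semigroup: $e^{t\Delta}f(x)=\int_{\mathbb{R}^n}G_t(x-z)f(z)\,dz$, $G_t(x)=(4\pi t)^{-n/2}e^{-|x|^2/(4t)}$, $t>0$. For an integer $k\ge0$ and $0<\beta\le1$, $C^{k,\beta}(\mathbb{R}^n)$ is the space of functions with bounded continuous derivatives up to order $k$ whose derivatives of order $k$ are globally $\beta$-Hölder continuous, with its usual full norm; $C^k(\mathbb{R}^n)$ carries the norm given by sup norms of all derivatives up to order $k$. Zygmund spaces: $\Lambda_\ast=\Lambda_\ast^1$ is the set of $u\in L^\infty(\mathbb{R}^n)$ with $$[u]_{\Lambda_\ast}=\sup_{x,h\in\mathbb{R}^n,\ h\neq0}\frac{|u(x+h)+u(x-h)-2u(x)|}{|h|}<\infty,\qquad \|u\|_{\Lambda_\ast}=\|u\|_{L^\infty(\mathbb{R}^n)}+[u]_{\Lambda_\ast}.$$ For an integer $k\ge2$, $\Lambda_\ast^k=\{u\in C^{k-1}(\mathbb{R}^n):D^\gamma u\in\Lambda_\ast\text{ for all }|\gamma|=k-1\}$ with norm $\|u\|_{\Lambda_\ast^k}=\|u\|_{C^{k-1}(\mathbb{R}^n)}+\max_{|\gamma|=k-1}[D^\gamma u]_{\Lambda_\ast}$. Classical solution means that $u$ is regular enough ($C^{0,2s+\varepsilon}$ if $s<1/2$, $C^{1,2s+\varepsilon-1}$ if $s\ge1/2$,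 for some $\varepsilon>0$) that $(-\Delta)^su(x)$ is given at every point by $$(-\Delta)^su(x)=c_{n,s}\lim_{\varepsilon\to0^+}\int_{|x-z|>\varepsilon}\frac{u(x)-u(z)}{|x-z|^{n+2s}}\,dz,\qquad c_{n,s}=\frac{4^s\Gamma(n/2+s)}{|\Gamma(-s)|\pi^{n/2}},$$ and the equation holds at every $x\in\mathbb{R}^n$. Vanishing at infinity means $|u(x)|\to0$ as $|x|\to\infty$. *)

(* Defs.v *)
From HB Require Import structures.
From mathcomp Require Import all_boot all_order all_algebra.
From mathcomp Require Import all_classical all_reals all_analysis.

Set Implicit Arguments.
Unset Strict Implicit.
Unset Printing Implicit Defensive.

Import Order.TTheory GRing.Theory Num.Theory.
Import numFieldNormedType.Exports.

Local Open Scope classical_set_scope.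
Local Open Scope ring_scope.

(* Canonical inference does not find the library's sigma-finiteness instance of
   a product measure when the factors are not finite. *)
Lemma sigma_finite_prod d1 d2 (T1 : measurableType d1) (T2 : measurableType d2)
    (R : realType) (m1 : {sigma_finite_measure set T1 -> \bar R})
    (m2 : {sigma_finite_measure set T2 -> \bar R}) :
  sigma_finite setT (m1 \x m2)%E.
Proof.
have /sigma_finiteP[F [TF ndF Foo]] := sigma_finiteT m1.
have /sigma_finiteP[G [TG ndG Goo]] := sigma_finiteT m2.
exists (fun k => F k `*` G k).
  rewrite -setXTT TF TG predeqE => -[x y]; split.
    move=> [/= [k _ Fkx] [l _ Gly]]; exists (maxn k l) => //; split.
    - by move: x Fkx; exact/subsetPset/ndF/leq_maxl.
    - by move: y Gly; exact/subsetPset/ndG/leq_maxr.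
  by move=> [k _ []/= ? ?]; split; exists k.
move=> k; have [? ?] := Foo k; have [? ?] := Goo k.
split; first exact: measurableX.
by rewrite product_measure1E// lte_mul_pinfty// ge0_fin_numE.
Qed.

Section LebesgueRn.
Context {R : realType}.
Local Notation RR := (measurableTypeR R).

Definition tcons n (p : RR * n.-tuple RR) : n.+1.-tuple RR :=
  [tuple of p.1 :: p.2].

Lemma measurable_tcons n : measurable_fun setT (@tcons n).
Proof.
apply: (@measurable_cons _ _ (RR * n.-tuple RR)%type RR fst n snd).
  exact: measurable_fst.
exact: measurable_snd.
Qed.

Section step.
Variables (n : nat) (mu : {sigma_finite_measure set (n.-tuple RR) -> \bar R}).

Definition leb_step : set (n.+1.-tuple RR) -> \bar R :=
  pushforward (@lebesgue_measure R \x mu)%E (@tcons n).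

Let leb_step0 : leb_step set0 = 0%E.
Proof. by rewrite /leb_step /pushforward preimage_set0 measure0. Qed.

Let leb_step_ge0 A : (0 <= leb_step A)%E.
Proof. by rewrite /leb_step /pushforward measure_ge0. Qed.

Let leb_step_sigma_additive : semi_sigma_additive leb_step.
Proof.
have mtcons (A : set (n.+1.-tuple RR)) :
    measurable A -> measurable (@tcons n @^-1` A).
  by move=> mA; rewrite -[X in measurable X]setTI; exact: measurable_tcons.
move=> F mF tF mUF; rewrite /leb_step /pushforward preimage_bigcup.
apply: measure_semi_sigma_additive.
- by move=> k; exact: mtcons.
- apply/trivIsetP => /= i j _ _ ij; rewrite -preimage_setI.
  by move/trivIsetP : tF => /(_ _ _ _ _ ij) ->//; rewrite preimage_set0.
- by rewrite -preimage_bigcup; exact: mtcons.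
Qed.

HB.instance Definition _ := isMeasure.Build _ _ _ leb_step
  leb_step0 leb_step_ge0 leb_step_sigma_additive.

Lemma leb_step_sigma_finite : sigma_finite setT leb_step.
Proof.
have [F FT Foo] := sigma_finite_prod (@lebesgue_measure R) mu.
pose g (x : n.+1.-tuple RR) : RR * n.-tuple RR := (thead x, [tuple of behead x]).
have gK p : g (tcons p) = p.
  by case: p => a t; rewrite /g /tcons theadE; congr pair; exact/val_inj.
have mg : measurable_fun setT g.
  apply/measurable_fun_pairP; split.
    exact: (measurable_tnth ord0).
  exact: measurable_behead.
exists (fun k => g @^-1` F k).
  apply/seteqP; split => x // _.
  have : setT (g x) by [].
  by rewrite FT => -[k _ Fk]; exists k.
move=> k; have [mF Fk] := Foo k; split.
  by rewrite -[X in measurable X]setTI; exact: mg.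
rewrite /leb_step /pushforward (_ : _ @^-1` _ = F k)//.
by apply/seteqP; split => p /=; rewrite gK.
Qed.

HB.instance Definition _ :=
  Measure_isSigmaFinite.Build _ _ _ leb_step leb_step_sigma_finite.

End step.

(* Lebesgue measure on R^n (coordinates listed as an n-tuple): the n-fold
   product of the Lebesgue measure on R. *)
Fixpoint lebRn (n : nat) : {sigma_finite_measure set (n.-tuple RR) -> \bar R} :=
  if n is m.+1 then leb_step (lebRn m) else \d_([tuple] : 0.-tuple RR).

Lemma lebRn_box n (A : 'I_n -> set RR) : (forall i, measurable (A i)) ->
  lebRn n [set t | forall i, A i (tnth t i)] =
  (\prod_(i < n) lebesgue_measure (A i))%E.
Proof.
elim: n A => [|n IH] A mA /=.
  rewrite big_ord0 diracE mem_set//=; by case.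
rewrite /leb_step /pushforward big_ord_recl -IH; last by move=> i; exact: mA.
rewrite -product_measure1E//.
  congr (_ _); apply/seteqP; split => -[a t] /=.
    move=> H; split; first exact: (H ord0).
    by move=> i; move: (H (lift ord0 i)); rewrite /= tnthS.
  by move=> [Ha Ht] i; case: (unliftP ord0 i) => [j ->|->]; rewrite ?tnthS.
rewrite [X in measurable X](_ : _ =
    \bigcap_(i in [set: 'I_n]) ((@tnth n RR)^~ i @^-1` (A (lift ord0 i)))); last first.
  by apply/seteqP; split => t /= H i; [move=> _; exact: (H i)|exact: (H i I)].
apply: fin_bigcap_measurable => // i _.
by rewrite -[X in measurable X]setTI; apply: measurable_tnth.
Qed.

Definition rvec n (t : n.-tuple RR) : 'rV[R]_n := \row_i tnth t i.

Definition intRn n (D : set 'rV[R]_n) (F : 'rV[R]_n -> R) : R :=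
  \int[lebRn n]_(t in @rvec n @^-1` D) F (rvec t).

Definition Linfty_norm n (u : 'rV[R]_n -> R) : \bar R :=
  'N[lebRn n]_(+oo)[EFin \o (u \o @rvec n)]%E.

Definition in_Linfty n (u : 'rV[R]_n -> R) : Prop :=
  measurable_fun setT (fun t : n.-tuple RR => u (rvec t)) /\
  (Linfty_norm u < +oo)%E.

End LebesgueRn.

Section FunctionSpaces.
Context {R : realType} {n : nat}.
Implicit Types (u v f : 'rV[R]_n -> R) (x : 'rV[R]_n).

(* The library norm on 'rV[R]_n is the max norm; |x| is the Euclidean one. *)
Definition enorm x : R := Num.sqrt (\sum_(i < n) x ord0 i ^+ 2).

Definition sup_norm u : \bar R := ereal_sup [set `|u x|%:E | x in setT].

Definition partial (i : 'I_n) u : 'rV[R]_n -> R :=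
  fun x => 'D_(delta_mx ord0 i) u x.

(* A derivative D^gamma of order k is given by the word of length k of the
   directions of differentiation; for C^k functions the order of the letters
   is immaterial, so words of length k range over the multi-indices
   |gamma| = k (with repetitions, which do not affect the maxima below). *)
Definition iterD (I : seq 'I_n) u : 'rV[R]_n -> R := foldr partial u I.

Definition in_C (k : nat) u : Prop :=
  forall I : seq 'I_n, (size I <= k)%N ->
    [/\ continuous (iterD I u), bounded_fun (iterD I u) &
        (size I < k)%N ->
        forall i x, derivable (iterD I u) x (delta_mx ord0 i)].

Definition C_norm (k : nat) u : \bar R :=
  (\sum_(j < k.+1) \big[maxe/0]_(I : j.-tuple 'I_n) sup_norm (iterD I u))%E.

Definition holder_seminorm (b : R) u : \bar R :=
  ereal_sup [set (`|u p.1 - u p.2| / enorm (p.1 - p.2) `^ b)%:E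
            | p in [set p : 'rV[R]_n * 'rV[R]_n | p.1 != p.2]].

Definition in_Ch (k : nat) (b : R) u : Prop :=
  in_C k u /\
  forall I : k.-tuple 'I_n, (holder_seminorm b (iterD I u) < +oo)%E.

Definition Ch_norm (k : nat) (b : R) u : \bar R :=
  (C_norm k u +
   \big[maxe/0]_(I : k.-tuple 'I_n) holder_seminorm b (iterD I u))%E.

Definition zygmund_seminorm u : \bar R :=
  ereal_sup [set (`|u (p.1 + p.2) + u (p.1 - p.2) - 2 * u p.1|
                  / enorm p.2)%:E
            | p in [set p : 'rV[R]_n * 'rV[R]_n | p.2 != 0]].

Definition in_zygmund1 u : Prop :=
  in_Linfty u /\ (zygmund_seminorm u < +oo)%E.

(* Lambda_*^k; only meant for k >= 1 *)
Definition in_zygmund (k : nat) u : Prop :=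
  if (k <= 1)%N then in_zygmund1 u
  else in_C k.-1 u /\ forall I : k.-1.-tuple 'I_n, in_zygmund1 (iterD I u).

Definition zygmund_norm (k : nat) u : \bar R :=
  if (k <= 1)%N then (Linfty_norm u + zygmund_seminorm u)%E
  else (C_norm k.-1 u +
    \big[maxe/0]_(I : k.-1.-tuple 'I_n) zygmund_seminorm (iterD I u))%E.

Definition vanishes_at_infinity u : Prop :=
  forall e : R, 0 < e -> exists M : R, forall x, M < enorm x -> `|u x| < e.

Definition compactly_supported u : Prop :=
  compact (closure [set x | u x != 0]).

End FunctionSpaces.

Section FractionalLaplacian.
Context {R : realType}.

Definition euler_integral (x : R) : R :=
  \int[lebesgue_measure]_(t in `]0, +oo[) (t `^ (x - 1) * expR (- t)).

(* Euler's Gamma on the reals: for x <= 0, Gamma(x + m) / (x (x+1) ... (x+m-1))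
   with m the least integer such that x + m > 0 (junk value at the poles). *)
Definition Gamma (x : R) : R :=
  let m := if 0 < x then 0%N else (Num.truncn (- x)).+1 in
  euler_integral (x + m%:R) / \prod_(j < m) (x + j%:R).

Context {n : nat}.
Implicit Types (u f : 'rV[R]_n -> R) (x : 'rV[R]_n).

Definition heat_kernel (t : R) x : R :=
  (4 * pi * t) `^ (- (n%:R / 2)) * expR (- (enorm x ^+ 2 / (4 * t))).

Definition heat_semigroup (t : R) f x : R :=
  intRn setT (fun z => heat_kernel t (x - z) * f z).

Definition inv_frac_laplacian (s : R) f x : R :=
  (Gamma s)^-1 *
  \int[lebesgue_measure]_(t in `]0, +oo[)
     (heat_semigroup t f x / t `^ (1 - s)).

Definition c_ns (s : R) : R :=
  4 `^ s * Gamma (n%:R / 2 + s) / (`|Gamma (- s)| * pi `^ (n%:R / 2)).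

Definition truncated_integral (s : R) u x (e : R) : R :=
  intRn [set z | e < enorm (x - z)]
    (fun z => (u x - u z) / enorm (x - z) `^ (n%:R + 2 * s)).

Definition frac_laplacian (s : R) u x : R :=
  c_ns s * lim (truncated_integral s u x e @[e --> 0^'+]).

(* The side conditions on e keep the Hoelder exponent in ]0, 1]. *)
Definition classical_solution (s : R) u f : Prop :=
  (exists e : R, 0 < e /\
     if s < 1 / 2 then 2 * s + e <= 1 /\ in_Ch 0 (2 * s + e) u
     else 2 * s + e - 1 <= 1 /\ in_Ch 1 (2 * s + e - 1) u) /\
  forall x, cvg (truncated_integral s u x e @[e --> 0^'+]) /\
            frac_laplacian s u x = f x.

End FractionalLaplacian.

(* Main.v *)
(* With P_t the heat semigroup, u = Gamma(s)^-1 int_0^oo t^(s-1) P_t f dt.  A derivative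
   of order j >= 1 of P_t f is O(t^((alpha-j)/2)) by the Hoelder seminorm of f, with a
   constant depending only on n and alpha; estimating a first or second difference with
   step h of D^j u by the bound of order j for t < |h|^2 and by the one of order j + 1
   or j + 2 for t > |h|^2 gives the power |h|^(alpha+2s-j).  The lower order derivatives
   are then bounded by interpolation between sup |u| and the second differences.

   For the equation, |y|^(-n-2s) is up to a constant int_0^oo r^(-1-s) G_r(y) dr, so that
   after symmetrization the principal value becomes int_0^oo r^(-1-s) (u - P_r u)(x) dr.
   Since P_r u = Gamma(s)^-1 int_0^oo t^(s-1) P_(r+t) f dt, this is a one-dimensional
   inversion formula for the function t |-> P_t f(x), whose value at 0 is f(x).
   Uniqueness is the maximum principle at a maximum point of the difference. *)

(* The constants may depend only on n, s and alpha, but convergence of the integrals needs bounds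
   and decay of f. Hence f comes with three numbers: M bounds |f|, A is a Hoelder constant, and K
   satisfies |f| <= K G_1. M and K serve convergence only; the Schauder bounds contain A and a bound
   of u. Compact support enters through K alone: P_t G_1 = G_(t+1) gives the decay t^(-n/2),
   integrable against t^(s-1) at infinity because s < n/2.

   When alpha + 2s is an integer, the bound on first differences diverges logarithmically; second
   differences do not, and they also suffice for the interpolation and for the equation. Where only
   qualitative regularity is wanted, alpha is lowered to avoid integers.

   In the inversion formula the two integrals cannot be exchanged directly if the function is
   nonzero at t = 0. Subtracting f(x) e^(-t) removes that value. The remainder contributes zero,
   since the integral in r of r^(-1-s) (t^(s-1) - (t-r)_+^(s-1)) vanishes for each t > 0; the
   exponential contributes f(x) times Gamma(s) Gamma(1-s)/s, that is Gamma(s) |Gamma(-s)|. *)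
Require Import Defs.
From HB Require Import structures.
From mathcomp Require Import all_boot all_order all_algebra.
From mathcomp Require Import all_classical all_reals all_analysis.
From mathcomp Require Import measurable_realfun ess_sup_inf zify ring lra.

Set Implicit Arguments.
Unset Strict Implicit.
Unset Printing Implicit Defensive.

Import Order.TTheory GRing.Theory Num.Theory.
Import numFieldNormedType.Exports.

Local Open Scope classical_set_scope.
Local Open Scope ring_scope.

(** * Integrals with parameters *)

Section RintegralTheory.
Context {R : realType}.

Lemma integrable_le d (T : measurableType d) (m : {measure set T -> \bar R}) (D : set T)
    (f g : T -> R) : measurable D ->
  measurable_fun D f -> (forall x, D x -> `|f x| <= g x) ->
  m.-integrable D (EFin \o g) -> m.-integrable D (EFin \o f).
Proof.
move=> mD mf fg ig; apply: le_integrable ig => //; first exact/measurable_EFinP.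
by move=> x Dx; rewrite /= lee_fin (le_trans (fg x Dx))// ler_norm.
Qed.

Lemma integrable_ltyP d (T : measurableType d) (m : {measure set T -> \bar R})
    (f : T -> R) (c : R) : measurable_fun setT f ->
  (\int[m]_x `|f x|%:E <= c%:E)%E -> m.-integrable setT (EFin \o f).
Proof.
move=> mf h; apply/integrableP; split; first exact/measurable_EFinP.
by apply: le_lt_trans h _; rewrite ltry.
Qed.

Lemma EFin_Rintegral d (T : measurableType d) (m : {measure set T -> \bar R})
  (D : set T) (f : T -> R) : measurable D -> m.-integrable D (EFin \o f) ->
  (\int[m]_(x in D) f x)%:E = (\int[m]_(x in D) (f x)%:E)%E.
Proof. by move=> mD h; rewrite /Rintegral fineK//; exact: integrable_fin_num. Qed.

(** * Fubini for real-valued integrals, by domination of the inner integral *)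

Section fubini.
Context d1 d2 (T1 : measurableType d1) (T2 : measurableType d2).
Variables (m1 : {sigma_finite_measure set T1 -> \bar R})
          (m2 : {sigma_finite_measure set T2 -> \bar R}).
Variables (F : T1 * T2 -> R) (g : T1 -> R).
Hypothesis mF : measurable_fun setT F.
Hypothesis ig : m1.-integrable setT (EFin \o g).
Hypothesis Fg : forall x, (\int[m2]_y `|F (x, y)|%:E <= (g x)%:E)%E.

Let mF1 x : measurable_fun setT (fun y => F (x, y)).
Proof. exact: (measurableT_comp mF (pair1_measurable x)). Qed.

Let mF2 y : measurable_fun setT (fun x => F (x, y)).
Proof. exact: (measurableT_comp mF (pair2_measurable y)). Qed.

Lemma integrable_section1 x : m2.-integrable setT (fun y => (F (x, y))%:E).
Proof. exact: (@integrable_ltyP _ _ _ (fun y => F (x, y)) (g x)). Qed.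

Let iF : (m1 \x m2)%E.-integrable setT (EFin \o F).
Proof.
have mEF : measurable_fun setT (EFin \o F) by exact/measurable_EFinP.
apply/(integrable12ltyP _ _ mEF).
have mA : measurable_fun setT (fun z => (`|F z|)%:E).
  by apply/measurable_EFinP; exact: measurableT_comp.
have /integrableP[mg] := ig.
apply: le_lt_trans; apply: ge0_le_integral => //=.
- by move=> x _; exact: integral_ge0.
- by apply: (measurable_fun_fubini_tonelli_F (fun z => (`|F z|)%:E)) => // z; rewrite lee_fin.
- by apply/measurable_EFinP; apply: measurableT_comp => //; exact/measurable_EFinP.
- by move=> x _; apply: le_trans (Fg x) _; rewrite lee_fin ler_norm.
Qed.

Lemma integrable_Rfubini1 :
  m1.-integrable setT (fun x => (\int[m2]_y F (x, y))%:E).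
Proof.
have h := integrable_fubini_F iF.
apply: eq_integrable h => // x _.
by rewrite /fubini_F EFin_Rintegral//; exact: integrable_section1.
Qed.

(** Joint integrability gives integrable sections in the other variable only almost everywhere. They
    are assumed integrable at every y because only then is the real-valued inner integral known to
    agree with the extended one. *)
Lemma Rfubini : (forall y, m1.-integrable setT (fun x => (F (x, y))%:E)) ->
  \int[m1]_x \int[m2]_y F (x, y) = \int[m2]_y \int[m1]_x F (x, y).
Proof.
move=> h2; rewrite /Rintegral; congr fine.
transitivity (\int[m1]_x \int[m2]_y (EFin \o F) (x, y))%E.
  by apply: eq_integral => x _; rewrite -EFin_Rintegral//; exact: integrable_section1.
rewrite (Fubini iF); apply: eq_integral => y _; rewrite -EFin_Rintegral//; exact: h2.
Qed.

Lemma integrable_Rfubini2 : (forall y, m1.-integrable setT (fun x => (F (x, y))%:E)) ->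
  m2.-integrable setT (fun y => (\int[m1]_x F (x, y))%:E).
Proof.
move=> h2; have mE : measurable_fun setT (EFin \o F) by exact/measurable_EFinP.
have GE y : (\int[m1]_x F (x, y))%:E = fubini_G m1 (EFin \o F) y.
  by rewrite /fubini_G EFin_Rintegral//; exact: h2.
under eq_fun do rewrite GE.
have mG := measurable_fubini_G iF.
apply/integrableP; split => //.
apply: le_lt_trans ((integrable21ltyP _ _ mE).1 iF).
have mA : measurable_fun setT (fun z => (`|F z|)%:E).
  by apply/measurable_EFinP; exact: measurableT_comp.
apply: ge0_le_integral => //=.
- by apply: measurableT_comp => //; exact: measurable_fun_abse.
- by apply: (measurable_fun_fubini_tonelli_G (fun z => (`|F z|)%:E)) => // z; rewrite lee_fin.
- move=> y _; rewrite /fubini_G; apply: le_abse_integral => //.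
  by apply/measurable_EFinP; exact: mF2.
Qed.

End fubini.

(** * Directional derivatives under the integral sign *)

Section directional.
Variable V : normedModType R.
Implicit Types (u : V -> R) (x v : V).

Lemma line_quotientE u x v (h : R) :
  (fun k : R => k^-1 *: (u (k *: v + (h *: v + x)) - u (h *: v + x))) =
  (fun k : R => k^-1 *: (u ((k *: (1 : R) + h) *: v + x) - u (h *: v + x))).
Proof. by apply/funext => k; rewrite addrA -scalerDl scaler1. Qed.

Lemma derivable_lineP u x v (h : R) :
  derivable u (h *: v + x) v <-> derivable (fun k : R => u (k *: v + x)) h (1 : R).
Proof. by rewrite /derivable line_quotientE. Qed.

Lemma derive_line u x v (h : R) :
  'D_v u (h *: v + x) = 'D_(1 : R) (fun k : R => u (k *: v + x)) h.
Proof. by rewrite /derive line_quotientE. Qed.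

(** Restricting to the line [h *: v + x] reduces the claim to a real parameter near 0, so domination
    is only asked for |h| < 1. *)
Lemma derivable_under d (T : measurableType d) (m : {measure set T -> \bar R})
    (f : V -> T -> R) (G : T -> R) x v :
  (forall h : R, m.-integrable setT (EFin \o f (h *: v + x))) ->
  (forall (h : R) y, -1 < h < 1 -> derivable (f ^~ y) (h *: v + x) v) ->
  m.-integrable setT (EFin \o G) ->
  (forall (h : R) y, -1 < h < 1 -> `|'D_v (f ^~ y) (h *: v + x)| <= G y) ->
  derivable (fun z => \int[m]_y f z y) x v /\
  'D_v (fun z => \int[m]_y f z y) x = \int[m]_y 'D_v (f ^~ y) x.
Proof.
move=> intf df iG fG.
pose F (h : R) y := f (h *: v + x) y.
have G0 y : 0 <= G y by apply: le_trans (fG 0 y _); rewrite ?normr_ge0//; lra.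
have I0 : [set` `](-1 : R), 1[ ] (0 : R) by rewrite /= in_itv/=; lra.
have x0 : x = (0 : R) *: v + x by rewrite scale0r add0r.
have dF (h : R) y : [set` `](-1 : R), 1[ ] h -> [set: T] y -> derivable (F ^~ y) h 1.
  by rewrite /= in_itv/= => h1 _; exact: (proj1 (derivable_lineP (f ^~ y) x v h) (df _ _ h1)).
have FG (h : R) y : [set` `](-1 : R), 1[ ] h -> [set: T] y -> `|partial1of2 F h y| <= G y.
  rewrite /= in_itv/= => h1 _; rewrite partial1of2E -(derive_line (f ^~ y) x v h); exact: fG.
have iF (h : R) : [set` `](-1 : R), 1[ ] h -> m.-integrable setT (EFin \o F h).
  by move=> _; exact: intf.
have mT : measurable [set: T] by [].
split.
  rewrite x0; apply: (proj2 (derivable_lineP _ x v 0)).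
  exact: (derivable_under_integral mT I0 iF dF G0 iG FG).
rewrite [in LHS]x0 derive_line -derive1E.
rewrite (differentiation_under_integral mT I0 iF dF G0 iG FG).
apply: eq_Rintegral => y _; rewrite partial1of2E -(derive_line (f ^~ y) x v 0).
by rewrite -x0.
Qed.

End directional.

End RintegralTheory.

(** * Lebesgue measure on R^n *)

Section LebesgueRnTheory.
Context {R : realType}.
Local Notation RR := (measurableTypeR R).
Local Notation mu := (@lebesgue_measure R).

Definition raffine (v : R) (e : bool) (a : RR) : RR := v + (-1) ^+ e * a.

Lemma measurable_raffine v e : measurable_fun setT (raffine v e).
Proof. by apply: measurable_funD => //; exact: measurable_funM. Qed.

(** Both measures agree on half-open intervals: the reflection swaps the closed end, which does not
    change the length. Translations and reflections are the only changes of variables made in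
    R^n. *)
Lemma lebesgue_measure_affine (v : R) (e : bool) (A : set RR) : measurable A ->
  pushforward mu (raffine v e) A = mu A.
Proof.
move=> mA.
pose f := raffine v e; have mf : measurable_fun setT f := measurable_raffine v e.
pose g : {mfun RR >-> RR} := HB.pack f (isMeasurableFun.Build _ _ _ _ _ mf).
apply/esym.
apply: (@lebesgue_measure_unique R (pushforward mu g)) => //= _ [[a b]] _ <-.
rewrite /pushforward/= /f /raffine.
case: (e) => /=.
  rewrite expr1 (_ : _ @^-1` _ = [set` `[v - b, v - a[ ]); last first.
    by apply/seteqP; split => x /=; rewrite !in_itv/=; lra.
  rewrite /= !lebesgue_measure_itv/= !lte_fin.
  have -> : (v - b < v - a) = (a < b) by lra.
  by case: ifP => // _; rewrite -!EFinB; congr EFin; ring.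
rewrite expr0 (_ : _ @^-1` _ = [set` `]a - v, b - v] ]); last first.
  by apply/seteqP; split => x /=; rewrite !in_itv/=; lra.
rewrite /= !lebesgue_measure_itv/= !lte_fin.
have -> : (a - v < b - v) = (a < b) by lra.
by case: ifP => // _; rewrite -!EFinB; congr EFin; ring.
Qed.

Lemma ge0_integral_affine1 (v : R) (e : bool) (F : RR -> \bar R) :
  measurable_fun setT F -> (forall x, 0 <= F x)%E ->
  (\int[mu]_a F (raffine v e a) = \int[mu]_a F a)%E.
Proof.
move=> mF F0.
have mf := measurable_raffine v e.
transitivity (\int[pushforward mu (raffine v e)]_a F a)%E.
  by rewrite ge0_integral_pushforward.
by apply: eq_measure_integral => A mA _; exact: lebesgue_measure_affine.
Qed.

Lemma ge0_integral_lebRnS n (F : n.+1.-tuple RR -> \bar R) :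
  measurable_fun setT F -> (forall x, 0 <= F x)%E ->
  (\int[lebRn n.+1]_t F t = \int[mu]_a \int[lebRn n]_t F (tcons (a, t)))%E.
Proof.
move=> mF F0.
transitivity (\int[pushforward (mu \x lebRn n) (@tcons R n)]_t F t)%E; first by [].
rewrite ge0_integral_pushforward//; last exact: measurable_tcons.
rewrite preimage_setT fubini_tonelli1//; last by move=> x; exact: F0.
apply: measurableT_comp => //; exact: measurable_tcons.
Qed.

Definition taffine n (v : 'rV[R]_n) (e : bool) (t : n.-tuple RR) : n.-tuple RR :=
  [tuple raffine (v ord0 i) e (tnth t i) | i < n].

Lemma rvec_taffine n (v : 'rV[R]_n) e t : rvec (taffine v e t) = v + (-1) ^+ e *: rvec t.
Proof. by apply/rowP => i; rewrite !mxE tnth_mktuple. Qed.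

Lemma measurable_taffine n (v : 'rV[R]_n) e : measurable_fun setT (taffine v e).
Proof.
apply/measurable_fun_tnthP => i.
rewrite (_ : _ \o _ = fun t : n.-tuple RR => raffine (v ord0 i) e (tnth t i)); last first.
  by apply/funext => t/=; rewrite tnth_mktuple.
exact: (measurableT_comp (measurable_raffine _ _) (measurable_tnth i)).
Qed.

(** Induction on the dimension by Tonelli, since the map acts on each coordinate separately. *)
Lemma ge0_integral_affine n (v : 'rV[R]_n) e (F : n.-tuple RR -> \bar R) :
  measurable_fun setT F -> (forall x, 0 <= F x)%E ->
  (\int[lebRn n]_t F (taffine v e t) = \int[lebRn n]_t F t)%E.
Proof.
elim: n v F => [|n IH] v F mF F0.
  by apply: eq_integral => t _; congr F; apply/eq_from_tnth; case.
rewrite !ge0_integral_lebRnS//; last first.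
  by apply: measurableT_comp => //; exact: measurable_taffine.
pose v' : 'rV[R]_n := \row_i v ord0 (lift ord0 i).
have E a t : taffine v e (tcons (a, t)) = tcons (raffine (v ord0 ord0) e a, taffine v' e t).
  apply/eq_from_tnth => i; rewrite tnth_mktuple.
  case: (unliftP ord0 i) => [j ->|->]; last by rewrite !tnth0.
  by rewrite !tnthS tnth_mktuple mxE.
under eq_integral do under eq_integral do rewrite E.
have mFc : measurable_fun setT (F \o @tcons R n).
  by apply: measurableT_comp => //; exact: measurable_tcons.
have := @ge0_integral_affine1 (v ord0 ord0) e
  (fun a => \int[lebRn n]_t F (tcons (a, t)))%E.
move=> <-; last 2 first.
- by apply: (measurable_fun_fubini_tonelli_F (F \o @tcons R n)) => // x; exact: F0.
- by move=> x; exact: integral_ge0.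
apply: eq_integral => a _.
have mFa : measurable_fun setT (fun t => F (tcons (raffine (v ord0 ord0) e a, t))).
  exact: (measurableT_comp mFc (pair1_measurable (raffine (v ord0 ord0) e a))).
exact: (IH v' _ mFa).
Qed.

Lemma integral_affine n (v : 'rV[R]_n) e (F : n.-tuple RR -> \bar R) :
  measurable_fun setT F ->
  (\int[lebRn n]_t F (taffine v e t) = \int[lebRn n]_t F t)%E.
Proof.
move=> mF; rewrite [LHS]integralE [RHS]integralE.
have mFp : measurable_fun setT (F^\+)%E by exact: measurable_funepos.
have mFn : measurable_fun setT (F^\-)%E by exact: measurable_funeneg.
congr (_ - _)%E.
  rewrite -(ge0_integral_affine v e mFp (fun x => funepos_ge0 F x)).
  by apply: eq_integral => t _; rewrite !funeposE.
rewrite -(ge0_integral_affine v e mFn (fun x => funeneg_ge0 F x)).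
  by apply: eq_integral => t _; rewrite !funenegE.
Qed.

Definition vtup n (x : 'rV[R]_n) : n.-tuple RR := [tuple x ord0 i | i < n].

Lemma vtupK n : cancel (@vtup n) (@rvec R n).
Proof. by move=> x; apply/rowP => i; rewrite mxE tnth_mktuple. Qed.

Lemma row_norm_le n (x : 'rV[R]_n) (e : R) : 0 <= e ->
  (forall i, `|x ord0 i| <= e) -> `|x| <= e.
Proof.
move=> e0 xe; rewrite /Num.norm/= mx_normrE; apply: bigmax_le => //= -[i j] _ /=.
by rewrite (ord1 i).
Qed.

Lemma coord_le_norm n (x : 'rV[R]_n) i : `|x ord0 i| <= `|x|.
Proof.
rewrite [leRHS]/Num.norm/= mx_normrE.
exact: (@le_bigmax _ _ _ _ (fun ij : 'I_1 * 'I_n => `|x ij.1 ij.2|) (ord0, i)).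
Qed.

(* Measurability is expressed on tuples; a continuous function is the pointwise
   limit of its compositions with coordinatewise rounding to a grid. *)
Lemma measurable_rvec n (u : 'rV[R]_n -> R) : continuous u ->
  measurable_fun setT (fun t : n.-tuple RR => u (rvec t)).
Proof.
move=> cu.
pose rd (k : nat) (a : R) : int := Num.floor (a * k.+1%:R).
pose pt (k : nat) (m : n.-tuple int) : 'rV[R]_n := \row_i ((tnth m i)%:~R / k.+1%:R).
pose rt (k : nat) (t : n.-tuple RR) : n.-tuple int := [tuple rd k (tnth t i) | i < n].
have mrd k (z : int) : measurable [set a : RR | rd k a = z].
  rewrite (_ : [set a : RR | _] = [set` `[z%:~R / k.+1%:R, (z + 1)%:~R / k.+1%:R[ ]).
    exact: measurable_itv.
  apply/seteqP; split => a /=; rewrite in_itv/= /rd ler_pdivrMr// ltr_pdivlMr//.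
    by move=> <-; exact: Num.Theory.floor_itv.
  exact: Num.Theory.floor_def.
apply: (@measurable_fun_cvg _ _ _ _ (fun k t => u (pt k (rt k t)))) => //.
- move=> k _ B mB; rewrite setTI.
  rewrite (_ : _ @^-1` B = \bigcup_m ((rt k @^-1` [set m]) `&` [set t | B (u (pt k m))])).
    apply: countable_bigcupT_measurable => // m; apply: measurableI; last first.
      case: (pselect (B (u (pt k m)))) => h.
        by rewrite (_ : [set _ | _] = setT)//; apply/seteqP; split.
      by rewrite (_ : [set _ | _] = set0)//; apply/seteqP; split.
    rewrite (_ : _ @^-1` _ = \bigcap_(i in [set: 'I_n])
        ((@tnth n RR)^~ i @^-1` [set a : RR | rd k a = tnth m i])).
      apply: fin_bigcap_measurable => // i _.
      by rewrite -[X in measurable X]setTI; apply: measurable_tnth.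
    apply/seteqP; split => t /=.
      by move=> <- i _ /=; rewrite tnth_mktuple.
    by move=> h; apply/eq_from_tnth => i; rewrite tnth_mktuple; exact: h.
  apply/seteqP; split => t /=; first by move=> h; exists (rt k t).
  by move=> [m _ [<-]].
- move=> t _; apply: (@cvg_comp _ _ _ (fun k => pt k (rt k t)) u _ (nbhs (rvec t))); last exact: cu.
  apply/cvgrPdist_le => /= e e0.
  have [N _ HN] := (@cvgrPdist_le _ _ _ _ _ _ _).1 (@cvg_harmonic R) _ e0.
  exists N => // k /HN; rewrite /= sub0r normrN ger0_norm ?invr_ge0// => ke.
  apply: row_norm_le => [|i]; first exact: ltW.
  rewrite !mxE tnth_mktuple /rd; apply: le_trans ke.
  have k0 : 0 < k.+1%:R :> R by [].
  have /andP[h1 h2] := Num.Theory.floor_itv (tnth t i * k.+1%:R).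
  rewrite intrD in h2.
  set z := (Num.floor _)%:~R in h1 h2 *.
  rewrite -(ler_pM2r k0) mulVf ?gt_eqF// -[X in _ * X]gtr0_norm// -normrM mulrBl.
  rewrite divfK ?gt_eqF// ger0_norm; lra.
Qed.

Definition rbox n (x : 'rV[R]_n) (e : R) : set (n.-tuple RR) :=
  [set t | forall i, [set` `](x ord0 i - e), (x ord0 i + e)[ ] (tnth t i)].

Lemma measurable_rbox n (x : 'rV[R]_n) e : measurable (rbox x e).
Proof.
rewrite (_ : rbox x e = \bigcap_(i in [set: 'I_n])
   ((@tnth n RR)^~ i @^-1` [set` `](x ord0 i - e), (x ord0 i + e)[ ])).
  apply: fin_bigcap_measurable => // i _.
  by rewrite -[X in measurable X]setTI; apply: measurable_tnth => //; exact: measurable_itv.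
by apply/seteqP; split => t /= h i; [move=> _|]; exact: h.
Qed.

Lemma lebRn_rbox_gt0 n (x : 'rV[R]_n) e : 0 < e -> (0 < lebRn n (rbox x e))%E.
Proof.
move=> e0; rewrite /rbox (lebRn_box (A := fun i => [set` `](x ord0 i - e), (x ord0 i + e)[ ])); last by move=> i; exact: measurable_itv.
elim/big_ind : _ => // [a b|i _]; first exact: mule_gt0.
rewrite lebesgue_measure_itv/= lte_fin (_ : _ < _); last by lra.
by rewrite -EFinB lte_fin; lra.
Qed.

(** An excess of |u| at x over the essential supremum would persist on a box around x, which has
    positive measure. This turns the norm of the statement into a pointwise bound. *)
Lemma Linfty_norm_ge n (u : 'rV[R]_n -> R) x : continuous u ->
  (`|u x|%:E <= Linfty_norm u)%E.
Proof.
move=> cu; rewrite leNgt; apply/negP => h.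
(* The norm of order +oo unfolds to the essential supremum only when the whole space has positive
   measure. *)
have L0 : (0 < @lebRn R n setT)%E.
  have b0 := lebRn_rbox_gt0 x (@ltr01 R); apply: (lt_le_trans b0).
  apply: le_measure; rewrite ?inE//.
  exact: measurable_rbox.
move: h; rewrite /Linfty_norm unlock L0.
have := ess_sup_ge (@lebRn R n) (abse \o (EFin \o (u \o @rvec R n))).
set L := ess_sup _ _ => -[A [mA A0 AL]] Lu.
have [l Ll lu] : exists2 l : R, (L <= l%:E)%E & l < `|u x|.
  case: (L) Lu => [l|//|_]; first by rewrite lte_fin; exists l.
  by exists (`|u x| - 1); [rewrite leNye|lra].
have : \forall y \near x, l < `|u y|.
  have cnu : {for x, continuous (fun y => `|u y|)} by apply: continuous_comp; [exact: cu|exact: norm_continuous].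
  exact: (cvgr_gt _ cnu).
move=> /nbhs_ballP[e /= e0 he].
have : (lebRn n (rbox x e) <= lebRn n A)%E.
  apply: le_measure; rewrite ?inE//; first exact: measurable_rbox.
  move=> t ht; apply: AL => /=.
  apply/negP; rewrite -ltNge; apply: le_lt_trans Ll _.
  rewrite lte_fin; apply: he; split => // i j; rewrite (ord1 i) mxE.
  have := ht j; rewrite /= in_itv/= /ball/= /ball_ => ?.
  by rewrite ltr_norml; lra.
by rewrite A0 leNgt lebRn_rbox_gt0.
Qed.

Lemma Linfty_norm_le n (u : 'rV[R]_n -> R) (c : R) : 0 <= c ->
  (forall x, `|u x| <= c) -> (Linfty_norm u <= c%:E)%E.
Proof.
move=> c0 uc; rewrite /Linfty_norm unlock; case: ifPn => // _.
by apply/ess_supP; apply: nearW => t /=; rewrite lee_fin.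
Qed.

End LebesgueRnTheory.

(** * Mellin integrals and the Gamma function *)

Section OneDim.
Context {R : realType}.
Local Notation RR := (measurableTypeR R).
Local Notation mu := (@lebesgue_measure R).

(** The fundamental theorem on compact intervals, then monotone convergence as they exhaust I. It
    covers improper integrals at singular ends, where only the limits of F along the end points are
    known. *)
Lemma ge0_FTC_exhaustion (f F : R -> R) (I : set R) (a b : nat -> R) (A B : R) :
  (forall k, a k < b k) -> (forall k, a k.+1 <= a k) -> (forall k, b k <= b k.+1) ->
  (forall k x, a k <= x <= b k -> I x) ->
  (forall x, I x -> exists k, a k <= x <= b k) ->
  (forall x, I x -> 0 <= f x) ->
  (forall x, I x -> {for x, continuous f}) ->
  (forall x, I x -> derivable F x 1 /\ 'D_1 F x = f x) ->
  F (a k) @[k --> \oo] --> A -> F (b k) @[k --> \oo] --> B ->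
  (\int[mu]_(x in I) (f x)%:E = (B - A)%:E)%E.
Proof.
move=> ab da ib abI Iab f0 cf dF FA FB.
have IE : I = \bigcup_k [set` `[a k, b k] ].
  apply/seteqP; split => x /=.
    by move=> /Iab[k h]; exists k => //=; rewrite in_itv.
  by move=> [k _]; rewrite /= in_itv/=; exact: abI.
have nd : nondecreasing_seq (fun k => [set` `[a k, b k] ] : set R).
  apply/nondecreasing_seqP => k; rewrite subsetEset => x /=.
  rewrite !in_itv/= => /andP[h1 h2]; rewrite (le_trans _ h1)//=.
  exact: le_trans h2 _.
have cab k : {within `[a k, b k], continuous f}.
  apply: continuous_in_subspaceT => x; rewrite inE/= in_itv/= => h.
  by apply: cf; exact: abI h.
have mf k : measurable_fun [set` `[a k, b k] ] (EFin \o f).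
  by apply/measurable_EFinP; exact: subspace_continuous_measurable_fun.
have cF x : I x -> {for x, continuous F}.
  by move=> /dF[dx _]; apply: differentiable_continuous; apply/derivable1_diffP.
have E k : (\int[mu]_(x in `[a k, b k]) (f x)%:E = (F (b k) - F (a k))%:E)%E.
  rewrite (continuous_FTC2 (ab k) (cab k) (F := F))//.
  - split.
    + move=> x; rewrite in_itv/= => /andP[h1 h2].
      by case: (dF x) => //; apply: (abI k); rewrite !ltW.
    + by apply: cvg_at_right_filter; apply: cF; apply: (abI k); rewrite lexx ltW.
    + by apply: cvg_at_left_filter; apply: cF; apply: (abI k); rewrite lexx ltW.
  - move=> x; rewrite in_itv/= => /andP[h1 h2]; rewrite derive1E.
    by case: (dF x) => //; apply: (abI k); rewrite !ltW.
have h : (\int[mu]_(x in `[a k, b k]) (f x)%:E @[k --> \oo] -->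
    \int[mu]_(x in I) (f x)%:E)%E.
  rewrite IE; have f0' k x : [set` `[a k, b k] ] x -> (0 <= (EFin \o f) x)%E.
    by rewrite /= in_itv/= => hx; rewrite lee_fin; apply: f0; exact: abI hx.
  have mab k : measurable ([set` `[a k, b k] ] : set RR) by exact: measurable_itv.
  exact: (ge0_nondecreasing_set_cvg_integral (mu := mu) nd mab mf f0').
have h' : (\int[mu]_(x in `[a k, b k]) (f x)%:E @[k --> \oo] --> (B - A)%:E)%E.
  under eq_fun do rewrite E.
  by apply: cvg_EFin; [exact: nearW|exact: cvgB].
exact: cvg_unique h h'.
Qed.

Lemma gt0_powRD (x p q : R) : 0 < x -> x `^ (p + q) = x `^ p * x `^ q.
Proof. by move=> x0; rewrite powRD// (gt_eqF x0) implybT. Qed.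

(** Inversion is discontinuous at 0, where it takes the value 0, so it is pieced together from a
    power on each half-line. *)
Lemma measurable_inv : measurable_fun setT (fun x : R => x^-1).
Proof.
rewrite (_ : (fun x => _) = (fun x => if x == 0 then 0 else
    if 0 < x then x `^ (-1) else - ((- x) `^ (-1)))).
  apply: measurable_fun_ifT => //.
    by apply: (measurable_fun_eqr (g := cst 0)).
  apply: measurable_fun_ifT => //.
    by apply: (measurable_fun_ltr (f := cst 0)).
  apply: measurableT_comp => //.
  by apply: (measurableT_comp (@measurable_powR R _)).
apply/funext => x; case: ltgtP => [h|h|<-]; last by rewrite invr0.
- by rewrite powR_inv1 ?(ltW h).
- by rewrite powR_inv1 ?oppr_ge0 ?(ltW h)// invrN opprK.
Qed.

Lemma cvg_powR_y (p : R) : p < 0 -> (fun t : R => t `^ p) @ +oo%R --> (0 : R).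
Proof.
move=> p0; apply/cvgr0Pnorm_le => e e0; near=> t.
have t0 : 0 < t by near: t; exact: nbhs_pinfty_gt.
rewrite ger0_norm ?powR_ge0//.
have : (e `^ p^-1) <= t by near: t; exact: nbhs_pinfty_ge.
have : 0 < e `^ p^-1 by exact: powR_gt0.
set d := e `^ p^-1 => d0 dt.
have -> : e = d `^ p by rewrite /d -powRrM mulVf ?lt_eqF// powRr1// ltW.
rewrite -[p]opprK !(powRN _ (- p)) lef_pV2 ?posrE ?powR_gt0//.
by apply: ge0_ler_powR; rewrite ?nnegrE//; lra.
Unshelve. all: by end_near. Qed.

Lemma continuous_powR (p x : R) : 0 < x -> {for x, continuous (fun t : R => t `^ p)}.
Proof.
move=> x0; have [d _] := is_derive1_powR p x0.
by apply: differentiable_continuous; apply/derivable1_diffP.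
Qed.

Lemma cvg_divS (T : R) : (T / k.+2%:R @[k --> \oo] --> (0 : R)).
Proof.
rewrite (_ : (fun k => _) = (fun k => T * harmonic k.+1)); last by apply/funext.
rewrite -[X in _ --> X](mulr0 T); apply: cvgM; first exact: cvg_cst.
by rewrite (cvg_shiftS (@harmonic R) (nbhs (0 : R))); exact: cvg_harmonic.
Qed.

Lemma cvg_at_right0_divS (T l : R) (F : R -> R) : 0 < T ->
  F x @[x --> 0^'+] --> l -> F (T / k.+2%:R) @[k --> \oo] --> l.
Proof.
move=> T0 /cvg_at_rightP; apply; split; last exact: cvg_divS.
by move=> k; rewrite divr_gt0.
Qed.

Lemma ex_natr_ge (x : R) : exists k : nat, x <= k%:R.
Proof.
exists (Num.bound `|x|); apply: le_trans (ler_norm x) _.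
by rewrite ltW// Num.Theory.archi_boundP.
Qed.

Lemma cvg_pinfty_addS (T l : R) (F : R -> R) :
  F x @[x --> +oo%R] --> l -> F (T + k.+1%:R) @[k --> \oo] --> l.
Proof.
move=> /cvg_pinftyP; apply; apply/cvgryPge => A.
have [N AN] := ex_natr_ge (A - T); exists N => // k /= hk.
have : N%:R <= k.+1%:R :> R by rewrite ler_nat ltnW.
by lra.
Qed.

Lemma divS_exhaustion (T x : R) : 0 < T -> 0 < x ->  exists k : nat, T / k.+2%:R <= x.
Proof.
move=> T0 x0; have [N Nx] := ex_natr_ge (T / x); exists N.
rewrite ler_pdivrMr// mulrC -ler_pdivrMr//.
by apply: le_trans Nx _; rewrite ler_nat; lia.
Qed.

Lemma integral_powR_0 (p T : R) : 0 < p -> 0 < T ->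
  (\int[mu]_(x in `]0%R, T]) (x `^ (p - 1))%:E = (T `^ p / p)%:E)%E.
Proof.
move=> p0 T0.
rewrite (@ge0_FTC_exhaustion _ (fun x => x `^ p / p) _
  (fun k => T / k.+2%:R) (fun=> T) 0 (T `^ p / p)) ?subr0//.
- by move=> k; rewrite ltr_pdivrMr// ltr_pMr// ltr1n.
- by move=> k; rewrite ler_pM2l// lef_pV2 ?posrE// ler_nat.
- move=> k x /=; rewrite in_itv/= => /andP[h ->]; rewrite andbT.
  by apply: lt_le_trans h; rewrite divr_gt0.
- move=> x /=; rewrite in_itv/= => /andP[x0 ->]; have [k h] := divS_exhaustion T0 x0.
  by exists k; rewrite h.
- by move=> x _; rewrite powR_ge0.
- by move=> x /=; rewrite in_itv/= => /andP[x0 _]; exact: continuous_powR.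
- move=> x /=; rewrite in_itv/= => /andP[x0 _].
  have h := is_derive1_powR p x0.
  have h' : is_derive x 1 (fun y => y `^ p / p) (x `^ (p - 1)).
    apply: is_derive_eq; rewrite scaler0 add0r /= /GRing.scale/=.
    by field; rewrite gt_eqF.
  by case: h'.
- rewrite -(mul0r p^-1); apply: cvgM; last exact: cvg_cst.
  exact: (@cvg_at_right0_divS T 0 (fun x => x `^ p) T0 (powR_cvg0 p0)).
- exact: cvg_cst.
Qed.

Lemma integral_powR_y (p T : R) : p < 0 -> 0 < T ->
  (\int[mu]_(x in `[T, +oo[) (x `^ (p - 1))%:E = (T `^ p / - p)%:E)%E.
Proof.
move=> p0 T0.
rewrite (@ge0_FTC_exhaustion _ (fun x => x `^ p / p) _
  (fun k => T) (fun k => T + k.+1%:R) (T `^ p / p) 0).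
- by congr EFin; field; rewrite lt_eqF.
- by move=> k; rewrite ltrDl.
- by [].
- by move=> k; rewrite lerD2l ler_nat.
- by move=> k x /=; rewrite in_itv/= andbT => /andP[].
- move=> x /=; rewrite in_itv/= andbT => Tx.
  have [N Nx] := ex_natr_ge (x - T); exists N; rewrite Tx/= -lerBlDl.
  by apply: le_trans Nx _; rewrite ler_nat.
- by move=> x _; rewrite powR_ge0.
- move=> x /=; rewrite in_itv/= andbT => Tx; apply: continuous_powR; exact: lt_le_trans Tx.
- move=> x /=; rewrite in_itv/= andbT => Tx; have x0 : 0 < x by exact: lt_le_trans Tx.
  have h := is_derive1_powR p x0.
  have h' : is_derive x 1 (fun y => y `^ p / p) (x `^ (p - 1)).
    apply: is_derive_eq; rewrite scaler0 add0r /= /GRing.scale/=.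
    by field; rewrite lt_eqF.
  by case: h'.
- exact: cvg_cst.
- rewrite -(mul0r p^-1); apply: cvgM; last exact: cvg_cst.
  exact: (@cvg_pinfty_addS T 0 (fun x => x `^ p) (cvg_powR_y p0)).
Qed.

(** Extending t^p by zero turns integrals over the half-line into integrals over the line, where
    Fubini and translations apply without tracking domains. *)
Definition tpow (p t : R) : R := if 0 < t then t `^ p else 0.

Lemma tpow_ge0 p t : 0 <= tpow p t.
Proof. by rewrite /tpow; case: ifP => // _; exact: powR_ge0. Qed.

Lemma measurable_tpow p : measurable_fun setT (tpow p).
Proof.
apply: measurable_fun_ifT => //.
by apply: (@measurable_fun_ltr _ _ _ _ (cst 0) id).
Qed.

Lemma Rintegral_tpow (p : R) (F : R -> R) :
  \int[mu]_(t in `]0%R, +oo[) (t `^ p * F t) = \int[mu]_t (tpow p t * F t).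
Proof.
rewrite Rintegral_mkcond; apply: eq_Rintegral => t _; rewrite /tpow patchE.
rewrite (_ : (t \in _) = (0 < t)); first by case: ifP; rewrite ?mul0r.
by apply/idP/idP; rewrite inE/= in_itv/= andbT.
Qed.

(** Below T the power t^(p+s-1) is integrable since p + s > 0, above T the power t^(q+s-1) since q +
    s < 0. T stays explicit because its later choice produces the powers of |h|. *)
Lemma mellin_bound (w : R -> R) (s p q B C T : R) : measurable_fun setT w ->
  0 < T -> 0 <= B -> 0 <= C -> 0 < p + s -> q + s < 0 ->
  (forall t, 0 < t <= T -> `|w t| <= B * t `^ p) ->
  (forall t, T <= t -> `|w t| <= C * t `^ q) ->
  (\int[mu]_t `|tpow (s - 1) t * w t|%:E <=
   (B * (T `^ (p + s) / (p + s)) + C * (T `^ (q + s) / - (q + s)))%:E)%E.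
Proof.
move=> mw T0 B0 C0 ps qs hB hC.
pose f1 (x : R) := (x `^ (p + s - 1))%:E.
pose f2 (x : R) := (x `^ (q + s - 1))%:E.
have mp r : measurable_fun setT (fun x : R => (x `^ r)%:E).
  by apply/measurable_EFinP; exact: (@measurable_powR R r).
have m1 : measurable_fun setT (f1 \_ [set` `]0, T] ]).
  apply: (proj1 (measurable_restrictT f1 _)); first exact: measurable_itv.
  exact: measurable_funTS (mp _).
have m2 : measurable_fun setT (f2 \_ [set` `[T, +oo[ ]).
  apply: (proj1 (measurable_restrictT f2 _)); first exact: measurable_itv.
  exact: measurable_funTS (mp _).
have g1 x : (0 <= (f1 \_ [set` `]0%R, T] ]) x)%E.
  by apply: erestrict_ge0 => y _; rewrite lee_fin powR_ge0.
have g2 x : (0 <= (f2 \_ [set` `[T, +oo[ ]) x)%E.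
  by apply: erestrict_ge0 => y _; rewrite lee_fin powR_ge0.
rewrite [leRHS]EFinD (EFinM B) (EFinM C) -integral_powR_0// -integral_powR_y//.
rewrite [X in (B%:E * X)%E]integral_mkcond [X in (C%:E * X)%E]integral_mkcond.
rewrite -!ge0_integralZl ?lee_fin// -ge0_integralD//; first last.
- exact: measurable_funeM.
- by move=> x _; rewrite mule_ge0.
- exact: measurable_funeM.
- by move=> x _; rewrite mule_ge0.
apply: ge0_le_integral => //.
- apply/measurable_EFinP; apply: measurableT_comp => //; apply: measurable_funM => //.
  exact: measurable_tpow.
- by apply: emeasurable_funD; exact: measurable_funeM.
move=> t _; rewrite normrM (ger0_norm (tpow_ge0 _ _)) /tpow.
case: ltP => t0; last by rewrite mul0r adde_ge0// mule_ge0.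
have [tT|Tt] := leP t T.
  apply: lee_paddr; first by rewrite mule_ge0// g2.
  rewrite patchE mem_set/= ?in_itv/= ?t0// -EFinM lee_fin.
  rewrite (_ : p + s - 1 = (s - 1) + p); last by ring.
  rewrite (gt0_powRD (s - 1) p t0).
  by rewrite mulrCA ler_wpM2l ?powR_ge0// hB// t0.
apply: lee_paddl; first by rewrite mule_ge0// g1.
have ti : t \in [set` `[T, +oo[ ] by rewrite inE/= in_itv/= andbT ltW.
rewrite patchE ti -EFinM lee_fin.
rewrite (_ : q + s - 1 = (s - 1) + q); last by ring.
rewrite (gt0_powRD (s - 1) q t0).
by rewrite mulrCA ler_wpM2l ?powR_ge0// hC// ltW.
Qed.

(** The q-th power of exp(-t/q) <= q/t, which is the inverse of t/q <= 1 + t/q <= exp(t/q). *)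
Lemma expR_le_powR (q t : R) : 0 < q -> 0 < t -> expR (- t) <= q `^ q * t `^ (- q).
Proof.
move=> q0 t0.
have -> : expR (- t) = (expR (- (t / q))) `^ q.
  by rewrite /powR gt_eqF ?expR_gt0// expRK; congr expR; field; rewrite gt_eqF.
have -> : q `^ q * t `^ (- q) = (q / t) `^ q.
  by rewrite powRM ?invr_ge0 ?ltW// -powR_inv1 ?ltW// -powRrM mulN1r.
apply: ge0_ler_powR; rewrite ?nnegrE ?expR_ge0 ?divr_ge0 ?(ltW q0) ?(ltW t0)//.
rewrite expRN -[leRHS]invf_div lef_pV2 ?posrE ?expR_gt0 ?divr_gt0//.
by apply: le_trans (expR_ge1Dx _); lra.
Qed.

Section mellin_transform.
Variables (w : R -> R) (s p q B C : R).
Hypotheses (mw : measurable_fun setT w) (B0 : 0 <= B) (C0 : 0 <= C).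
Hypotheses (ps : 0 < p + s) (qs : q + s < 0).
Hypothesis hB : forall t, 0 < t -> `|w t| <= B * t `^ p.
Hypothesis hC : forall t, 0 < t -> `|w t| <= C * t `^ q.

Let mtw : measurable_fun setT (fun t => tpow (s - 1) t * w t).
Proof. by apply: measurable_funM => //; exact: measurable_tpow. Qed.

Lemma integrable_mellin :
  mu.-integrable setT (fun t => (tpow (s - 1) t * w t)%:E).
Proof.
have h1 t : 0 < t <= 1 -> `|w t| <= B * t `^ p by move=> /andP[t0 _]; exact: hB.
have h2 t : 1 <= t -> `|w t| <= C * t `^ q.
  by move=> t1; apply: hC; exact: lt_le_trans t1.
exact: (@integrable_ltyP R _ _ mu _ _ mtw (mellin_bound mw ltr01 B0 C0 ps qs h1 h2)).
Qed.

Lemma mellin_le T : 0 < T -> `|\int[mu]_t (tpow (s - 1) t * w t)| <=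
  B * (T `^ (p + s) / (p + s)) + C * (T `^ (q + s) / - (q + s)).
Proof.
move=> T0; apply: le_trans (le_normr_Rintegral _ integrable_mellin) _ => //.
rewrite -lee_fin EFin_Rintegral//; last first.
  have := integrable_abse integrable_mellin.
  by apply: eq_integrable => // t _.
apply: mellin_bound => // t.
  by move=> /andP[t0 _]; exact: hB.
by move=> t1; apply: hC; exact: lt_le_trans t1.
Qed.

End mellin_transform.

Lemma measurable_expRN : measurable_fun setT (fun t : R => expR (- t)).
Proof. by apply: measurableT_comp => //; exact: measurable_expR. Qed.

Lemma euler_integralE (x : R) :
  euler_integral x = \int[mu]_t (tpow (x - 1) t * expR (- t)).
Proof. exact: Rintegral_tpow. Qed.

Lemma integrable_euler (x : R) : 0 < x ->
  mu.-integrable setT (fun t => (tpow (x - 1) t * expR (- t))%:E).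
Proof.
move=> x0; have x1 : 0 < x + 1 by lra.
apply: (@integrable_mellin _ x 0 (- (x + 1)) 1 ((x + 1) `^ (x + 1))) => //.
- exact: measurable_expRN.
- exact: powR_ge0.
- by lra.
- by lra.
- move=> t t0; rewrite powRr0 mulr1 ger0_norm ?expR_ge0// expR_le1; lra.
- by move=> t t0; rewrite ger0_norm ?expR_ge0//; exact: expR_le_powR.
Qed.

Lemma euler_integral_gt0 (x : R) : 0 < x -> 0 < euler_integral x.
Proof.
move=> x0; rewrite euler_integralE -lte_fin EFin_Rintegral//; last exact: integrable_euler.
(* A lower bound of the integrand on [1, 2]. The power is monotone in a direction that depends on
   the sign of x - 1, hence the minimum of its end values. *)
pose c := Num.min (1 `^ (x - 1)) (2 `^ (x - 1)) * expR (- 2) : R.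
have c0 : 0 < c.
  by rewrite mulr_gt0 ?expR_gt0// lt_min !powR_gt0.
apply: (@lt_le_trans _ _ (\int[mu]_(t in `[1%R, 2%R]) c%:E)%E).
  rewrite integral_cst//= lebesgue_measure_itv/= lte_fin ltr1n/= -EFinB -EFinM lte_fin.
  by rewrite mulr_gt0//; lra.
rewrite [leLHS]integral_mkcond; apply: ge0_le_integral => //.
- by move=> t _; apply: erestrict_ge0 => y _; rewrite lee_fin ltW.
- by apply: (proj1 (measurable_restrictT _ _)).
- apply/measurable_EFinP; apply: measurable_funM; last exact: measurable_expRN.
  exact: measurable_tpow.
- move=> t _; rewrite patchE; case: ifPn => [|_]; last first.
    by rewrite lee_fin mulr_ge0 ?tpow_ge0 ?expR_ge0.
  rewrite inE/= in_itv/= => /andP[t1 t2]; rewrite lee_fin /c.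
  have t0 : 0 < t by lra.
  apply: ler_pM; rewrite ?expR_ge0 ?ler_expR//; last by lra.
  rewrite /tpow t0 ge_min.
  have [x1|x1] := leP 0 (x - 1).
    by apply/orP; left; apply: ge0_ler_powR; rewrite ?nnegrE//; lra.
  apply/orP; right; rewrite -[x - 1]opprK !(powRN _ (- (x - 1))).
  rewrite lef_pV2 ?posrE ?powR_gt0//.
  by apply: ge0_ler_powR; rewrite ?nnegrE; lra.
Qed.

Lemma Gamma_gt0E (x : R) : 0 < x -> Gamma x = euler_integral x.
Proof. by move=> x0; rewrite /Gamma x0 addr0 big_ord0 divr1. Qed.

Lemma Gamma_gt0 (x : R) : 0 < x -> 0 < Gamma x.
Proof. by move=> x0; rewrite Gamma_gt0E//; exact: euler_integral_gt0. Qed.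

(** At -s the definition of [Gamma] makes exactly one shift, to 1 - s, and divides by -s. *)
Lemma Gamma_NE (s : R) : 0 < s < 1 -> `|Gamma (- s)| = Gamma (1 - s) / s.
Proof.
move=> /andP[s0 s1]; rewrite /Gamma.
have -> : (0 < - s) = false by apply/negP; lra.
have -> : (0 < 1 - s) by lra.
have -> : Num.truncn (- - s) = 0%N.
  by rewrite opprK; apply/eqP; rewrite truncn_eq ?ltW//; lra.
rewrite big_ord1 big_ord0 addr0 divr1 addr0 [- s + 1]addrC.
rewrite normrM normfV normrN (gtr0_norm s0) gtr0_norm//.
by apply: euler_integral_gt0; lra.
Qed.

End OneDim.

(** * The heat kernel *)

Section EuclideanNorm.
Context {R : realType} {n : nat}.
Implicit Types (x y : 'rV[R]_n).

Lemma enorm_ge0 x : 0 <= enorm x.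
Proof. exact: sqrtr_ge0. Qed.

Lemma enorm_sqr x : enorm x ^+ 2 = \sum_(i < n) x ord0 i ^+ 2.
Proof. by rewrite sqr_sqrtr// sumr_ge0// => i _; rewrite sqr_ge0. Qed.

Lemma coord_le_enorm x i : `|x ord0 i| <= enorm x.
Proof.
rewrite -(@ler_pXn2r _ 2) ?nnegrE ?enorm_ge0// enorm_sqr real_normK ?num_real// (bigD1 i)//=.
by rewrite lerDl sumr_ge0// => j _; rewrite sqr_ge0.
Qed.

Lemma norm_le_enorm x : `|x| <= enorm x.
Proof. by apply: row_norm_le => [|i]; [exact: enorm_ge0|exact: coord_le_enorm]. Qed.

Lemma enorm0 : enorm (0 : 'rV[R]_n) = 0.
Proof. by rewrite /enorm big1 ?sqrtr0// => i _; rewrite mxE expr0n. Qed.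

Lemma enorm_gt0 x : x != 0 -> 0 < enorm x.
Proof. by move=> x0; apply: lt_le_trans (norm_le_enorm x); rewrite normr_gt0. Qed.

Lemma enormN x : enorm (- x) = enorm x.
Proof. by congr Num.sqrt; apply: eq_bigr => i _; rewrite mxE sqrrN. Qed.

Lemma enormB x y : enorm (x - y) = enorm (y - x).
Proof. by rewrite -enormN opprB. Qed.

Lemma sum_coord_le x : \sum_(i < n) `|x ord0 i| <= n%:R * enorm x.
Proof.
apply: le_trans (ler_sum _ (fun i _ => coord_le_enorm x i)) _.
by rewrite sumr_const card_ord mulr_natl.
Qed.

(** Needed because the topology and the balls come from the max norm, while all estimates use the
    Euclidean one. *)
Lemma enorm_le_norm x : enorm x <= n%:R * `|x|.
Proof.
have [n0|n0] := posnP n.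
  have -> : x = 0 by apply/rowP => -[m mn]; exfalso; rewrite n0 in mn.
  by rewrite enorm0 normr0 mulr0.
have n1 : 1 <= n%:R :> R by rewrite ler1n.
rewrite -(@ler_pXn2r _ 2) ?nnegrE ?enorm_ge0 ?mulr_ge0// enorm_sqr.
apply: (@le_trans _ _ (\sum_(i < n) `|x| ^+ 2)).
  apply: ler_sum => i _; rewrite -(real_normK (num_real _)).
  by rewrite ler_pXn2r ?nnegrE// coord_le_norm.
rewrite sumr_const card_ord exprMn -[leLHS]mulr_natl ler_wpM2r ?sqr_ge0//; nra.
Qed.

Lemma enorm_delta (i : 'I_n) : enorm (delta_mx ord0 i : 'rV[R]_n) = 1.
Proof.
rewrite /enorm (bigD1 i)//= mxE !eqxx expr1n big1 ?addr0 ?sqrtr1// => j ji.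
by rewrite mxE (negbTE ji) andbF expr0n.
Qed.

Lemma enormZ (c : R) x : enorm (c *: x) = `|c| * enorm x.
Proof.
rewrite /enorm -sqrtr_sqr -sqrtrM ?sqr_ge0//; congr Num.sqrt.
by rewrite mulr_sumr; apply: eq_bigr => i _; rewrite mxE exprMn.
Qed.

Lemma enorm_sqr_line (c : R) (i : 'I_n) x :
  enorm (c *: delta_mx ord0 i + x) ^+ 2 = enorm x ^+ 2 + 2 * c * x ord0 i + c ^+ 2.
Proof.
rewrite !enorm_sqr (bigD1 i)//= [X in _ = X + _ + _](bigD1 i)//= !mxE !eqxx mulr1.
rewrite (eq_bigr (fun j => x ord0 j ^+ 2)) => [|j ji]; first by ring.
by rewrite !mxE (negbTE ji) andbF mulr0 add0r.
Qed.

(* Used in place of the triangle inequality for [enorm]. *)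
Lemma enorm_sqrD_ge x y : enorm x ^+ 2 / 2 - enorm y ^+ 2 <= enorm (x + y) ^+ 2.
Proof.
rewrite !enorm_sqr mulr_suml -sumrB; apply: ler_sum => i _; rewrite mxE.
have := sqr_ge0 (x ord0 i + 2 * y ord0 i); nra.
Qed.

End EuclideanNorm.

Section TensorIntegral.
Context {R : realType}.
Local Notation RR := (measurableTypeR R).
Local Notation mu := (@lebesgue_measure R).

Lemma measurable_prod_tnth n (phi : 'I_n -> R -> R) :
  (forall i, measurable_fun setT (phi i)) ->
  measurable_fun setT (fun t : n.-tuple RR => \prod_(i < n) phi i (tnth t i)).
Proof.
move=> mphi; apply: measurable_prod => i _.
exact: (measurableT_comp (mphi i) (measurable_tnth i)).
Qed.

(** Tonelli and induction. It yields the mass and the convolution of the heat kernel, both of which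
    factor over the coordinates. *)
Lemma ge0_integral_prod_tnth n (phi : 'I_n -> R -> R) (c : 'I_n -> R) :
  (forall i, measurable_fun setT (phi i)) -> (forall i y, 0 <= phi i y) ->
  (forall i, \int[mu]_y (phi i y)%:E = (c i)%:E)%E ->
  (\int[@lebRn R n]_t (\prod_(i < n) phi i (tnth t i))%:E = (\prod_(i < n) c i)%:E)%E.
Proof.
elim: n phi c => [|n IH] phi c mphi phi0 phic.
  by under eq_integral do rewrite big_ord0; rewrite big_ord0 /= integral_dirac// diracT mul1e.
rewrite ge0_integral_lebRnS; last 2 first.
- by apply/measurable_EFinP; exact: measurable_prod_tnth.
- by move=> t; rewrite lee_fin prodr_ge0.
have E a : (\int[@lebRn R n]_t (\prod_(i < n.+1) phi i (tnth (tcons (a, t)) i))%:E =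
    (phi ord0 a)%:E * (\prod_(i < n) c (lift ord0 i))%:E)%E.
  have mp : measurable_fun setT (fun t : n.-tuple RR => \prod_(i < n) phi (lift ord0 i) (tnth t i)).
    by apply: (measurable_prod_tnth (phi := fun i => phi (lift ord0 i))).
  rewrite -(IH (fun i => phi (lift ord0 i)))// -ge0_integralZl//; last 3 first.
  - exact/measurable_EFinP.
  - by move=> t _; rewrite lee_fin prodr_ge0.
  - by rewrite lee_fin.
  apply: eq_integral => t _; rewrite big_ord_recl tnth0 EFinM; congr (_ * _%:E)%E.
  by apply: eq_bigr => i _; rewrite tnthS.
under eq_integral do rewrite E.
rewrite big_ord_recl EFinM -phic ge0_integralZr//.
- by apply/measurable_EFinP; exact: mphi.
- by move=> t _; rewrite lee_fin.
- rewrite lee_fin prodr_ge0// => i _; rewrite -lee_fin -phic; apply: integral_ge0 => y _.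
  by rewrite lee_fin.
Qed.

End TensorIntegral.

(** * Mass and convolution of the heat kernel *)

Section HeatKernel.
Context {R : realType}.
Local Notation RR := (measurableTypeR R).
Local Notation mu := (@lebesgue_measure R).

(** The one-dimensional heat kernel is the centered normal density of variance 2t, so measurability
    and total mass come from [normal_pdf]. *)
Definition gauss1 (t y : R) : R := normal_pdf 0 (Num.sqrt (2 * t)) y.

Lemma gauss1E (t y : R) : 0 < t ->
  gauss1 t y = (4 * pi * t) `^ (- 2^-1) * expR (- (y ^+ 2 / (4 * t))).
Proof.
move=> t0; rewrite /gauss1 normal_pdfE; last by rewrite gt_eqF// sqrtr_gt0 mulr_gt0.
rewrite /normal_peak /normal_fun subr0 sqr_sqrtr; last by rewrite mulr_ge0// ltW.
have p0 := pi_gt0 R.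
rewrite powRN powR12_sqrt; last by rewrite !mulr_ge0// ltW.
congr (_^-1 * _).
  by congr Num.sqrt; rewrite -mulr_natl; ring.
by congr expR; rewrite mulNr -mulr_natl; congr (- (_ / _)); ring.
Qed.

Lemma gauss1_ge0 t y : 0 <= gauss1 t y.
Proof. exact: normal_pdf_ge0. Qed.

Lemma measurable_gauss1 t : measurable_fun setT (gauss1 t).
Proof. exact: measurable_normal_pdf. Qed.

Lemma integral_gauss1 t : (\int[mu]_y (gauss1 t y)%:E = 1%:E)%E.
Proof. exact: integral_normal_pdf. Qed.

(** Completing the square in y: the product is [gauss1 (r + t) x] times the normal density of mean t
    x / (r + t) and variance 2 r t / (r + t), which has mass one. *)
Lemma gauss1_conv (r t x : R) : 0 < r -> 0 < t ->
  (\int[mu]_y (gauss1 r (x - y) * gauss1 t y)%:E = (gauss1 (r + t) x)%:E)%E.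
Proof.
move=> r0 t0; have rt0 : 0 < r + t by lra.
have p0 := pi_gt0 R.
have v0 : 0 < r * t / (r + t) by rewrite divr_gt0// mulr_gt0.
pose m := t * x / (r + t).
have E y : gauss1 r (x - y) * gauss1 t y =
    gauss1 (r + t) x * normal_pdf m (Num.sqrt (2 * (r * t / (r + t)))) y.
  have -> : normal_pdf m (Num.sqrt (2 * (r * t / (r + t)))) y = gauss1 (r * t / (r + t)) (y - m).
    have s0 : Num.sqrt (2 * (r * t / (r + t))) != 0 by rewrite gt_eqF// sqrtr_gt0 pmulr_rgt0.
    by rewrite /gauss1 !normal_pdfE// /normal_fun subr0.
  have h (z : R) : 0 < z -> 0 <= 4 * pi * z by move=> z0; rewrite !mulr_ge0// ltW.
  rewrite !gauss1E// mulrACA [RHS]mulrACA -!expRD -!powRM; try exact: h.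
  congr (_ `^ _ * expR _).
    by field; rewrite gt_eqF.
  by rewrite /m; field; rewrite !gt_eqF.
under eq_integral do rewrite E EFinM.
rewrite ge0_integralZl//; last 3 first.
- by apply/measurable_EFinP; exact: measurable_normal_pdf.
- by move=> y _; rewrite lee_fin normal_pdf_ge0.
- by rewrite lee_fin gauss1_ge0.
by rewrite integral_normal_pdf mule1.
Qed.

Context {n : nat}.
Implicit Types (x y : 'rV[R]_n).
Local Notation G := (@heat_kernel R n).

Lemma heat_kernel_prod t x : 0 < t -> G t x = \prod_(i < n) gauss1 t (x ord0 i).
Proof.
move=> t0; under eq_bigr do rewrite gauss1E//.
rewrite big_split/= prodr_const card_ord /heat_kernel -expR_sum.
rewrite -(@powR_mulrn _ ((4 * pi * t) `^ (- 2^-1)))  ?powR_ge0// -powRrM mulNr [2^-1 * _]mulrC; congr (_ * expR _).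
by rewrite sumrN enorm_sqr mulr_suml.
Qed.

Lemma heat_kernel_ge0 t x : 0 <= G t x.
Proof. by rewrite /heat_kernel mulr_ge0 ?powR_ge0 ?expR_ge0. Qed.

Lemma measurable_enorm_sqr d (T : measurableType d) (xi : T -> n.-tuple RR) :
  measurable_fun setT xi -> measurable_fun setT (fun p => enorm (rvec (xi p)) ^+ 2).
Proof.
move=> mxi; under eq_fun do rewrite enorm_sqr.
apply: measurable_sum => i; apply: measurable_funX.
under eq_fun do rewrite mxE.
exact: (measurableT_comp (measurable_tnth i) mxi).
Qed.

Lemma measurable_enorm d (T : measurableType d) (xi : T -> n.-tuple RR) :
  measurable_fun setT xi -> measurable_fun setT (fun p => enorm (rvec (xi p))).
Proof.
move=> mxi.
rewrite (_ : (fun p => _) = (fun p => (enorm (rvec (xi p)) ^+ 2) `^ 2^-1)).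
  exact: (measurableT_comp (@measurable_powR R _) (measurable_enorm_sqr mxi)).
by apply/funext => p; rewrite powR12_sqrt ?sqr_ge0// sqrtr_sqr ger0_norm ?enorm_ge0.
Qed.

Lemma measurable_heat_kernel d (T : measurableType d) (tau : T -> R) (xi : T -> n.-tuple RR) :
  measurable_fun setT tau -> measurable_fun setT xi ->
  measurable_fun setT (fun p => G (tau p) (rvec (xi p))).
Proof.
move=> mtau mxi; apply: measurable_funM.
  apply: (measurableT_comp (@measurable_powR R _)).
  by apply: measurable_funM.
apply: (measurableT_comp (@measurable_expR R)).
apply: measurableT_comp => //; apply: measurable_funM; first exact: measurable_enorm_sqr.
by apply: (measurableT_comp measurable_inv); exact: measurable_funM.
Qed.

Lemma integral_heat_kernel t : 0 < t ->
  (\int[@lebRn R n]_z (G t (rvec z))%:E = 1%:E)%E.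
Proof.
move=> t0; under eq_integral do rewrite heat_kernel_prod//.
under eq_integral do under eq_bigr do rewrite mxE.
rewrite (@ge0_integral_prod_tnth R n (fun=> gauss1 t) (fun=> 1)).
- by rewrite big1.
- by move=> _; exact: measurable_gauss1.
- by move=> _ y; exact: gauss1_ge0.
- by move=> _; exact: integral_gauss1.
Qed.

Lemma rvec_sub x (z : n.-tuple RR) : x - rvec z = rvec (taffine x true z).
Proof. by rewrite rvec_taffine expr1 scaleN1r. Qed.

Lemma rvec_add x (z : n.-tuple RR) : x + rvec z = rvec (taffine x false z).
Proof. by rewrite rvec_taffine expr0 scale1r. Qed.

Lemma heat_kernel_conv (r t : R) x : 0 < r -> 0 < t ->
  (\int[@lebRn R n]_z (G r (x - rvec z) * G t (rvec z))%:E = (G (r + t) x)%:E)%E.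
Proof.
move=> r0 t0; have rt0 : 0 < r + t by lra.
have E z : G r (x - rvec z) * G t (rvec z) =
    \prod_(i < n) (gauss1 r (x ord0 i - tnth z i) * gauss1 t (tnth z i)).
  rewrite !heat_kernel_prod// -big_split; apply: eq_bigr => i _.
  by rewrite !mxE.
under eq_integral do rewrite E.
rewrite (@ge0_integral_prod_tnth R n
  (fun i (y : R) => gauss1 r (x ord0 i - y) * gauss1 t y) (fun i => gauss1 (r + t) (x ord0 i))).
- by rewrite heat_kernel_prod.
- move=> i; apply: measurable_funM; last exact: measurable_gauss1.
  apply: measurableT_comp; first exact: measurable_gauss1.
  exact: measurable_funB.
- by move=> i y; rewrite mulr_ge0 ?gauss1_ge0.
- by move=> i; exact: gauss1_conv.
Qed.

End HeatKernel.

(** * Mean value inequalities and interpolation along coordinate directions *)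

Section PartialDerivatives.
Context {R : realType} {n : nat}.
Implicit Types (x y h : 'rV[R]_n) (u : 'rV[R]_n -> R) (i : 'I_n).
Local Notation e_ i := (delta_mx ord0 i : 'rV[R]_n).

Lemma line_mvt u i x (c : R) : (forall y, derivable u y (e_ i)) ->
  exists2 r : R, 0 <= r <= 1 & u (c *: e_ i + x) - u x = c * partial i u ((r * c) *: e_ i + x).
Proof.
move=> du.
pose g (k : R) := u ((k * c) *: e_ i + x).
have dg (k : R) : is_derive k (1 : R) g (c * partial i u ((k * c) *: e_ i + x)).
  have /derivable_lineP d1 := du ((k * c) *: e_ i + x).
  have d2 : is_derive (k * c) (1 : R) (fun r : R => u (r *: e_ i + x)) (partial i u ((k * c) *: e_ i + x)).
    by split => //; rewrite -derive_line.
  have d3 : is_derive k (1 : R) (fun k : R => k * c) c.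
    apply: is_derive_eq; rewrite scaler0 add0r /GRing.scale/= mulr1//.
  have := @is_derive1_comp _ (fun r : R => u (r *: e_ i + x)) (fun k : R => k * c) k _ _ d2 d3.
  by rewrite mulrC.
have cg k : {for k, continuous g}.
  by case: (dg k) => d _; apply: differentiable_continuous; apply/derivable1_diffP.
have [|r /[!in_itv]/= /andP[r0 r1] E] := @MVT _ g _ 0 1 ltr01 (fun k _ => dg k).
  by apply: continuous_subspaceT => k; exact: cg.
exists r; first by rewrite !ltW.
by move: E; rewrite /g mul1r mul0r scale0r add0r subr0 mulr1.
Qed.

Lemma line_lipschitz u i x (c M : R) : (forall y, derivable u y (e_ i)) ->
  (forall y, `|partial i u y| <= M) -> `|u (c *: e_ i + x) - u x| <= M * `|c|.
Proof.
move=> du uM; have [r _ ->] := line_mvt x c du.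
by rewrite normrM mulrC ler_wpM2r.
Qed.

Lemma partial_lipschitz u (M : R) x y :
  (forall i z, derivable u z (e_ i)) -> (forall i z, `|partial i u z| <= M) ->
  `|u x - u y| <= M * (n%:R * enorm (x - y)).
Proof.
move=> du uM.
have [n0|n0] := posnP n.
  have -> : x = y by apply/rowP => -[m mn]; exfalso; rewrite n0 in mn.
  rewrite !subrr normr0 enorm0 !mulr0//.
have M0 : 0 <= M by exact: le_trans (normr_ge0 _) (uM (Ordinal n0) 0).
(* A path from y to x that changes one coordinate at a time; the increment of u telescopes along
   it. *)
pose w (k : nat) : 'rV[R]_n := \row_i (if (i < k)%N then x ord0 i else y ord0 i).
have w0 : w 0%N = y by apply/rowP => i; rewrite mxE.
have wn : w n = x by apply/rowP => i; rewrite mxE ltn_ord.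
rewrite -{1}wn -{1}w0 -(telescope_sumr (fun k => u (w k)))// big_mkord.
apply: le_trans (ler_norm_sum _ _ _) _.
apply: (@le_trans _ _ (\sum_(i < n) M * `|(x - y) ord0 i|)); last first.
  by rewrite -mulr_sumr ler_wpM2l// sum_coord_le.
apply: ler_sum => i _.
have -> : w i.+1 = (x - y) ord0 i *: e_ i + w i.
  apply/rowP => j; rewrite !mxE eqxx/= ltnS.
  have [->|ji] := eqVneq j i; first by rewrite leqnn ltnn mulr1; ring.
  by rewrite mulr0 add0r leq_eqVlt (_ : (_ == _) = false)//; apply/negbTE.
exact: line_lipschitz.
Qed.

Lemma lipschitz_continuous u (M : R) :
  (forall x y, `|u x - u y| <= M * enorm (x - y)) -> continuous u.
Proof.
move=> uM x; apply/(@cvgrPdist_le _ _ _ (nbhs x) (nbhs_filter x)) => e e0.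
pose K := (`|M| + 1) * (n%:R + 1).
have K0 : 0 < K by rewrite mulr_gt0// ?ltr_wpDl.
apply/nbhs_ballP; exists (e / K) => /= [|y]; first exact: divr_gt0.
rewrite mx_norm_ball /ball_/= => /ltW xy.
apply: le_trans (uM x y) _.
have h := enorm_le_norm (x - y).
have := ler_wpM2r (enorm_ge0 (x - y)) (ler_norm M).
have n0 : 0 <= n%:R :> R by [].
have : n%:R * `|x - y| <= n%:R * (e / K) by rewrite ler_wpM2l.
have M0 := normr_ge0 M.
have : e = e / K * K by rewrite divfK ?gt_eqF.
have : 0 <= e / K by rewrite divr_ge0 ?ltW.
set a := e / K; set b := `|x - y| in h *; set c := enorm _ in h *.
rewrite /K => a0 ea h1 h2.
have : `|M| * c <= `|M| * (n%:R * a) by rewrite ler_wpM2l//; lra.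
move=> h3; rewrite [leRHS]ea.
have h4 : 0 <= a * `|M| by exact: mulr_ge0.
have h5 : 0 <= a * n%:R by exact: mulr_ge0.
lra.
Qed.

(** The second difference is the increment from x - h to x of w(z) = u(z + h) - u(z), and the
    partial derivatives of w are increments of those of u. The Lipschitz bound is thus applied
    twice. *)
Lemma second_difference_le u (M : R) x h :
  (forall i z, derivable u z (e_ i)) ->
  (forall i j z, derivable (partial i u) z (e_ j)) ->
  (forall i j z, `|partial j (partial i u) z| <= M) ->
  `|u (x + h) + u (x - h) - 2 * u x| <= M * (n%:R * enorm h) ^+ 2.
Proof.
move=> du ddu uM.
pose w z := u (z + h) - u z.
have dshift i z : derivable (fun z => u (z + h)) z (e_ i) /\
    partial i (fun z => u (z + h)) z = partial i u (z + h).
  have E : (fun k : R => k^-1 *: (u (k *: e_ i + z + h) - u (z + h))) =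
           (fun k : R => k^-1 *: (u (k *: e_ i + (z + h)) - u (z + h))).
    by apply/funext => k; rewrite addrA.
  by rewrite /partial /derivable /derive/= E; split => //; exact: du.
have dw i z : derivable w z (e_ i).
  by apply: derivableB; [exact: (dshift i z).1|exact: du].
have wE i z : partial i w z = partial i u (z + h) - partial i u z.
  rewrite /partial /w deriveB; [|exact: (dshift i z).1|exact: du].
  by congr (_ - _); exact: (dshift i z).2.
have := partial_lipschitz (M := M * (n%:R * enorm h)) x (x - h) dw.
rewrite /w subrK subKr => H.
rewrite (_ : u (x + h) + u (x - h) - 2 * u x = u (x + h) - u x - (u x - u (x - h))); last by ring.
rewrite expr2 mulrA; apply: H => i z; rewrite wE.
have := partial_lipschitz (z + h) z (ddu i) (fun j z => uM i j z).
by rewrite [z + h]addrC addrK.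
Qed.

(* Only the symmetric second differences of the derivative enter, so the bound
   covers both the Hoelder and the Zygmund case. *)
Lemma partial_interpolation u i x (A K : R) : (forall y, derivable u y (e_ i)) ->
  (forall y, `|u y| <= A) ->
  (forall r : R, 0 <= r <= 1 -> `|partial i u (x + r *: e_ i) + partial i u (x - r *: e_ i)
      - 2 * partial i u x| <= K) ->
  `|partial i u x| <= A + K / 2.
Proof.
move=> du uA uK.
(* The derivative of g is d, the second difference of the partial derivative, and g 0 = 0. The mean
   value theorem on [0, 1] then expresses 2 D_i u(x) as u(x + e_i) - u(x - e_i) - d r for some r. *)
pose g (k : R) := u (k *: e_ i + x) - u ((- k) *: e_ i + x) - 2 * k * partial i u x.
pose d (k : R) := partial i u (k *: e_ i + x) + partial i u ((- k) *: e_ i + x) - 2 * partial i u x.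
have dl (k : R) : is_derive k (1 : R) (fun r : R => u (r *: e_ i + x)) (partial i u (k *: e_ i + x)).
  by have /derivable_lineP d1 := du (k *: e_ i + x); split => //; rewrite -derive_line.
have dg (k : R) : is_derive k (1 : R) g (d k).
  have dN : is_derive k (1 : R) (fun r : R => - r) (-1) by exact: is_derive_eq.
  have d1 := dl k.
  have d2 := @is_derive1_comp _ (fun r : R => u (r *: e_ i + x)) (fun k : R => - k) k _ _ (dl (- k)) dN.
  apply: is_derive_eq; rewrite /d /GRing.scale/=; ring.
have cg k : {for k, continuous g}.
  by case: (dg k) => dk _; apply: differentiable_continuous; apply/derivable1_diffP.
have [|r /[!in_itv]/= /andP[r0 r1] E] := @MVT _ g _ 0 1 ltr01 (fun k _ => dg k).
  by apply: continuous_subspaceT => k; exact: cg.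
have := uK r; rewrite (ltW r0) (ltW r1) => /(_ isT).
rewrite [x + _]addrC [x - _]addrC -scaleNr -/(d r).
move: E; rewrite subr0 mulr1 => <-.
rewrite /g oppr0 !scale0r add0r scale1r scaleN1r => h.
have := uA (e_ i + x); have := uA (- e_ i + x).
rewrite !ler_norml in h *; lra.
Qed.

End PartialDerivatives.

(** * Pointwise bounds of the heat kernel *)

Section HeatKernelBounds.
Context {R : realType} {n : nat}.
Implicit Types (x y h : 'rV[R]_n) (i : 'I_n) (t : R).
Local Notation e_ i := (delta_mx ord0 i : 'rV[R]_n).
Local Notation G := (@heat_kernel R n).

Let nr : R := n%:R / 2.

Let pit_ge0 t : 0 < t -> 0 <= 4 * pi * t.
Proof. by move=> t0; apply: mulr_ge0 (ltW t0); apply: mulr_ge0 (pi_ge0 R). Qed.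

Let quot_ge0 t x : 0 < t -> 0 <= enorm x ^+ 2 / (4 * t).
Proof. by move=> t0; apply: divr_ge0; [exact: sqr_ge0|apply: mulr_ge0 (ltW t0)]. Qed.

(** Passing to time 2t uses half of the Gaussian exponent; the other half, exp(-|x|^2/(8t)), is left
    to absorb powers of |x|. *)
Lemma heat_kernel_double t x : 0 < t ->
  G t x = 2 `^ nr * expR (- (enorm x ^+ 2 / (8 * t))) * G (2 * t) x.
Proof.
move=> t0; rewrite /heat_kernel -/nr; have p0 := pi_gt0 R.
have -> : (4 * pi * (2 * t)) `^ (- nr) = 2 `^ (- nr) * (4 * pi * t) `^ (- nr).
  by rewrite mulrCA [LHS]powRM// pit_ge0.
rewrite mulrACA [2 `^ nr * _]mulrA -gt0_powRD// addrN powRr0 mul1r -expRD.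
by congr (_ * expR _); field; rewrite gt_eqF.
Qed.

Lemma heat_kernel_le t x : 0 < t -> G t x <= (4 * pi * t) `^ (- nr).
Proof. by move=> t0; rewrite ler_piMr ?powR_ge0// expR_le1 oppr_le0 quot_ge0. Qed.

(** With v = |x|^2/(8t) the factor v^(a/2) e^(-v) is bounded. A kernel is kept on the right so that
    the bound integrates to a power of t by mass one, without computing moments. *)
Lemma heat_kernel_moment (a : R) : 0 < a -> exists2 C : R, 0 < C &
  forall t x, 0 < t -> enorm x `^ a * G t x <= C * t `^ (a / 2) * G (2 * t) x.
Proof.
move=> a0; have q0 : 0 < a / 2 by rewrite divr_gt0.
exists (2 `^ nr * ((a / 2) `^ (a / 2) * 8 `^ (a / 2))).
  by rewrite !mulr_gt0 ?powR_gt0.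
move=> t x t0; rewrite heat_kernel_double// mulrA ler_wpM2r ?heat_kernel_ge0//.
have [->|x0] := eqVneq x 0.
  by rewrite enorm0 powR0 ?gt_eqF// mul0r !mulr_ge0 ?powR_ge0.
have e0 := enorm_gt0 x0.
set v := enorm x ^+ 2 / (8 * t).
have v0 : 0 < v by rewrite divr_gt0 ?mulr_gt0// exprn_gt0.
have -> : enorm x `^ a = v `^ (a / 2) * (8 `^ (a / 2) * t `^ (a / 2)).
  rewrite -!powRM ?(ltW v0) ?mulr_ge0 ?(ltW t0)// /v divfK ?gt_eqF ?mulr_gt0//.
  by rewrite -powR_mulrn ?(ltW e0)// -powRrM; congr (_ `^ _); field.
have := expR_le_powR q0 v0; rewrite powRN ler_pdivlMr ?powR_gt0// => h.
have k0 : 0 <= 2 `^ nr * (8 `^ (a / 2) * t `^ (a / 2)) by rewrite !mulr_ge0 ?powR_ge0.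
have := ler_wpM2l k0 h.
by congr (_ <= _); ring.
Qed.

(** A factor t^(b/2) is given up in exchange for decay in x. This is what makes the solution vanish
    at infinity. *)
Lemma heat_kernel_decay (b : R) : 0 < b -> exists2 C : R, 0 < C &
  forall t x, 0 < t -> x != 0 -> G t x <= C * enorm x `^ (- b) * t `^ (b / 2 - nr).
Proof.
move=> b0; have q0 : 0 < b / 2 by rewrite divr_gt0.
have p0 := pi_gt0 R.
exists ((4 * pi) `^ (- nr) * (b / 2) `^ (b / 2) * 4 `^ (b / 2)).
  by rewrite !mulr_gt0 ?powR_gt0 ?mulr_gt0.
move=> t x t0 x0; have e0 := enorm_gt0 x0.
set v := enorm x ^+ 2 / (4 * t).
have v0 : 0 < v by rewrite divr_gt0 ?mulr_gt0// exprn_gt0.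
have h := expR_le_powR q0 v0.
rewrite /heat_kernel -/nr -/v powRM ?mulr_ge0 ?(ltW p0) ?(ltW t0)//.
have e2 : (enorm x ^+ 2) `^ (b / 2) = enorm x `^ b.
  by rewrite -powR_mulrn ?enorm_ge0// -powRrM; congr (_ `^ _); field.
have t4 : (4 * t) `^ (b / 2) = 4 `^ (b / 2) * t `^ (b / 2) by rewrite powRM// ltW.
have E : v `^ (- (b / 2)) = enorm x `^ (- b) * (4 `^ (b / 2) * t `^ (b / 2)).
  have vt : v * (4 * t) = enorm x ^+ 2 by rewrite /v divfK// gt_eqF// mulr_gt0.
  rewrite !powRN -t4 -e2 -vt [(v * _) `^ _]powRM ?(ltW v0) ?mulr_ge0 ?(ltW t0)//.
  have p1 := powR_gt0 (b / 2) v0.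
  have p2 : 0 < (4 * t) `^ (b / 2) by rewrite powR_gt0// mulr_gt0.
  by field; rewrite (gt_eqF p1) (gt_eqF p2).
rewrite gt0_powRD//.
have k0 : 0 <= (4 * pi) `^ (- nr) * t `^ (- nr) by rewrite !mulr_ge0 ?powR_ge0.
have := ler_wpM2l k0 h; rewrite E.
by congr (_ <= _); ring.
Qed.

(** From |x + y|^2 >= |x|^2/2 - |y|^2. The factor exp(1/(4t)) blows up as t tends to 0, but the
    bound only serves as domination at a fixed t. *)
Lemma heat_kernel_shift t x (c : R) i : 0 < t -> `|c| <= 1 ->
  G t (c *: e_ i + x) <= 2 `^ nr * expR (4 * t)^-1 * G (2 * t) x.
Proof.
move=> t0 c1; have p0 := pi_gt0 R; rewrite /heat_kernel -/nr.
have -> : (4 * pi * (2 * t)) `^ (- nr) = 2 `^ (- nr) * (4 * pi * t) `^ (- nr).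
  by rewrite mulrCA [LHS]powRM// pit_ge0.
rewrite mulrACA [2 `^ nr * _]mulrA -gt0_powRD// addrN powRr0 mul1r [expR _ * expR _]mulrC -expRD.
rewrite ler_wpM2l ?powR_ge0// ler_expR.
have h := enorm_sqrD_ge x (c *: e_ i); rewrite [x + _]addrC in h.
have h1 : enorm (c *: e_ i) ^+ 2 <= 1.
  by rewrite enormZ enorm_delta mulr1 real_normK ?num_real// -(real_normK (num_real c)) expr_le1.
rewrite -subr_ge0.
have -> : - (enorm x ^+ 2 / (4 * (2 * t))) + (4 * t)^-1 - - (enorm (c *: e_ i + x) ^+ 2 / (4 * t))
  = (enorm (c *: e_ i + x) ^+ 2 - enorm x ^+ 2 / 2 + 1) / (4 * t).
  by field; rewrite gt_eqF.
by rewrite divr_ge0 ?mulr_ge0 ?(ltW t0)//; lra.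
Qed.

Lemma is_derive_heat_kernel t x i : 0 < t ->
  derivable (G t) x (e_ i) /\ partial i (G t) x = - (x ord0 i / (2 * t)) * G t x.
Proof.
move=> t0; have x0 : x = (0 : R) *: e_ i + x by rewrite scale0r add0r.
pose K := (4 * pi * t) `^ (- (n%:R / 2)).
have E : (fun k : R => G t (k *: e_ i + x)) =
   (fun k => K * expR (- ((enorm x ^+ 2 + 2 * k * x ord0 i + k ^+ 2) / (4 * t)))).
  by apply/funext => k; rewrite /heat_kernel enorm_sqr_line.
have d : is_derive (0 : R) (1 : R) (fun k : R => G t (k *: e_ i + x)) (- (x ord0 i / (2 * t)) * G t x).
  rewrite E.
  have d1 : is_derive (0 : R) (1 : R) (fun k : R => - ((enorm x ^+ 2 + 2 * k * x ord0 i + k ^+ 2) / (4 * t)))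
    (- (x ord0 i / (2 * t))).
    apply: is_derive_eq; rewrite /GRing.scale/=; field; by rewrite gt_eqF.
  have d2 := is_derive1_comp (is_derive_expR _) d1.
  have d3 : is_derive (0 : R) (1 : R) (fun k : R => K *: expR (- ((enorm x ^+ 2 + 2 * k * x ord0 i + k ^+ 2) / (4 * t)))) _ := is_deriveZ K d2.
  apply: is_derive_eq; rewrite /heat_kernel -/K /GRing.scale/= !mulr0 mul0r expr0n/= !addr0; ring.
case: d => d1 d2; split; first by rewrite x0; apply/derivable_lineP.
by rewrite /partial [in LHS]x0 derive_line.
Qed.

Lemma heat_kernelN t x : G t (- x) = G t x.
Proof. by rewrite /heat_kernel enormN. Qed.

Lemma heat_kernel_ge_ball (rho : R) : exists2 c : R, 0 < c &
  forall x, enorm x <= rho -> c <= G 1 x.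
Proof.
exists ((4 * pi * 1) `^ (- (n%:R / 2)) * expR (- (rho ^+ 2 / (4 * 1)))).
  by rewrite mulr_gt0 ?expR_gt0// powR_gt0// !mulr_gt0// pi_gt0.
move=> x xr; rewrite /heat_kernel ler_wpM2l ?powR_ge0// ler_expR lerN2.
rewrite ler_wpM2r//; have := enorm_ge0 x; nra.
Qed.

End HeatKernelBounds.

(** * The heat semigroup *)

Section HeatSemigroup.
Context {R : realType} {n : nat}.
Local Notation RR := (measurableTypeR R).
Implicit Types (x : 'rV[R]_n) (i : 'I_n) (t r M : R) (g k : 'rV[R]_n -> R).
Local Notation e_ i := (delta_mx ord0 i : 'rV[R]_n).
Local Notation G := (@heat_kernel R n).
Local Notation leb := (@lebRn R n).

Local Opaque heat_kernel.

(** The bound holds everywhere, as semigroup values are estimated pointwise; measurability goes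
    through [rvec] because the measure lives on tuples. *)
Definition mbounded M g :=
  measurable_fun setT (fun z : n.-tuple RR => g (rvec z)) /\ forall x, `|g x| <= M.

Lemma mbounded_ge0 M g : mbounded M g -> 0 <= M.
Proof. by move=> [_ /(_ 0)]; exact: le_trans. Qed.

Lemma continuous_mbounded M g : continuous g -> (forall x, `|g x| <= M) -> mbounded M g.
Proof. by move=> cg gM; split => //; exact: measurable_rvec. Qed.

Lemma mbounded_cst (c : R) : mbounded `|c| (fun=> c).
Proof. by split. Qed.

Lemma mboundedB M N g k : mbounded M g -> mbounded N k -> mbounded (M + N) (fun x => g x - k x).
Proof.
move=> [mg gM] [mk kN]; split; first exact: measurable_funB.
by move=> x; apply: le_trans (ler_normB _ _) _; exact: lerD.
Qed.

Lemma mbounded_norm M g : mbounded M g -> mbounded M (fun x => `|g x|).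
Proof.
by move=> [mg gM]; split; [exact: measurableT_comp|move=> x; rewrite normr_id].
Qed.

Lemma Rintegral_sub x (F : 'rV[R]_n -> R) :
  measurable_fun setT (fun z : n.-tuple RR => F (rvec z)) ->
  \int[leb]_z F (x - rvec z) = \int[leb]_z F (rvec z).
Proof.
move=> mF; rewrite /Rintegral.
rewrite -(integral_affine x true (F := fun z => (F (rvec z))%:E)); last exact/measurable_EFinP.
by congr fine; apply: eq_integral => z _; rewrite rvec_sub.
Qed.

Lemma measurable_kernel_sub t x : measurable_fun setT (fun z : n.-tuple RR => G t (x - rvec z)).
Proof.
under eq_fun do rewrite rvec_sub.
by apply: measurable_heat_kernel => //; exact: measurable_taffine.
Qed.

Lemma measurable_kernel t : measurable_fun setT (fun z : n.-tuple RR => G t (rvec z)).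
Proof. exact: measurable_heat_kernel. Qed.

Lemma integral_kernel_sub t x : 0 < t ->
  (\int[leb]_z (G t (x - rvec z))%:E = 1%:E)%E.
Proof.
move=> t0; under eq_integral do rewrite rvec_sub.
rewrite (@ge0_integral_affine R n x true (fun z => (G t (rvec z))%:E)).
- exact: integral_heat_kernel.
- by apply/measurable_EFinP; exact: measurable_kernel.
- by move=> z; rewrite lee_fin heat_kernel_ge0.
Qed.

Lemma integrable_kernel_sub t x : 0 < t ->
  leb.-integrable setT (EFin \o (fun z => G t (x - rvec z))).
Proof.
move=> t0; apply: (@integrable_ltyP R _ _ leb _ 1); first exact: measurable_kernel_sub.
rewrite -(integral_kernel_sub x t0); under eq_integral do rewrite ger0_norm ?heat_kernel_ge0//.
by [].
Qed.

Lemma integrable_kernel t : 0 < t -> leb.-integrable setT (EFin \o (fun z => G t (rvec z))).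
Proof.
move=> t0; apply: (@integrable_ltyP R _ _ leb _ 1); first exact: measurable_kernel.
rewrite -(integral_heat_kernel (n := n) t0).
by under eq_integral do rewrite ger0_norm ?heat_kernel_ge0//.
Qed.

Lemma integrable_cstM d (T : measurableType d) (m : {measure set T -> \bar R}) (c : R) (f : T -> R) :
  m.-integrable setT (EFin \o f) -> m.-integrable setT (EFin \o (fun z => c * f z)).
Proof.
move=> h; have := integrableZl measurableT c h.
by apply: eq_integrable => // z _; rewrite /= EFinM.
Qed.

Lemma integrable_kernelM M t x g : 0 < t -> mbounded M g ->
  leb.-integrable setT (EFin \o (fun z => G t (x - rvec z) * g (rvec z))).
Proof.
move=> t0 [mg gM].
apply: (integrable_le (g := fun z => M * G t (x - rvec z))) => //.
- by apply: measurable_funM => //; exact: measurable_kernel_sub.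
- by move=> z _; rewrite normrM mulrC (ger0_norm (heat_kernel_ge0 _ _)) ler_wpM2r ?heat_kernel_ge0.
- by apply: integrable_cstM; exact: integrable_kernel_sub.
Qed.

Lemma heat_semigroupE t g x : heat_semigroup t g x = \int[leb]_z (G t (x - rvec z) * g (rvec z)).
Proof. by rewrite /heat_semigroup /intRn preimage_setT. Qed.

(** Moves the translation from the kernel to g, for derivatives and Hoelder differences that should
    fall on g. *)
Lemma heat_semigroupE' M t g x : mbounded M g ->
  heat_semigroup t g x = \int[leb]_z (G t (rvec z) * g (x - rvec z)).
Proof.
move=> [mg _]; rewrite heat_semigroupE.
rewrite -(@Rintegral_sub x (fun z => G t (x - z) * g z)).
  by apply: eq_Rintegral => z _; rewrite subKr.
by apply: measurable_funM => //; exact: measurable_kernel_sub.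
Qed.

Lemma heat_semigroup_le M N t g k x : 0 < t -> mbounded M g -> mbounded N k ->
  (forall z, `|g z| <= k z) -> `|heat_semigroup t g x| <= heat_semigroup t k x.
Proof.
move=> t0 bg bk gk; rewrite !heat_semigroupE.
have ig := integrable_kernelM x t0 bg.
apply: le_trans (le_normr_Rintegral _ ig) _ => //.
apply: le_Rintegral => //.
- by have := integrable_abse ig; apply: eq_integrable.
- exact: integrable_kernelM bk.
- move=> z _; rewrite normrM (ger0_norm (heat_kernel_ge0 _ _)).
  by rewrite ler_wpM2l ?heat_kernel_ge0.
Qed.

Lemma heat_semigroup_cst t (c : R) x : 0 < t -> heat_semigroup t (fun=> c) x = c.
Proof.
move=> t0; rewrite heat_semigroupE RintegralZr//; last exact: integrable_kernel_sub.
by rewrite /Rintegral integral_kernel_sub// mul1r.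
Qed.

Lemma heat_semigroup_bound M t g x : 0 < t -> mbounded M g -> `|heat_semigroup t g x| <= M.
Proof.
move=> t0 bg; rewrite -[leRHS](heat_semigroup_cst M x t0).
by apply: (heat_semigroup_le x t0 bg (mbounded_cst M)); exact: bg.2.
Qed.

Lemma heat_semigroupB M N t g k x : 0 < t -> mbounded M g -> mbounded N k ->
  heat_semigroup t (fun z => g z - k z) x = heat_semigroup t g x - heat_semigroup t k x.
Proof.
move=> t0 bg bk; rewrite !heat_semigroupE -RintegralB//.
- by apply: eq_Rintegral => z _; rewrite mulrBr.
- exact: integrable_kernelM bg.
- exact: integrable_kernelM bk.
Qed.

Lemma measurable_kernel_kernel r t x (z : n.-tuple RR) :
  measurable_fun setT (fun y : n.-tuple RR => G r (x - rvec y) * G t (rvec y - rvec z)).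
Proof.
apply: measurable_funM; first exact: measurable_kernel_sub.
have Ez (y : n.-tuple RR) : rvec y - rvec z = rvec (taffine (- rvec z) false y).
  by rewrite rvec_taffine expr0 scale1r addrC.
under eq_fun do rewrite Ez.
apply: measurable_heat_kernel; [exact: measurable_cst|exact: measurable_taffine].
Qed.

Lemma integral_kernel_kernel r t x (z : n.-tuple RR) : 0 < r -> 0 < t ->
  (\int[leb]_y (G r (x - rvec y) * G t (rvec y - rvec z))%:E)%E = (G (r + t) (x - rvec z))%:E.
Proof.
move=> r0 t0; rewrite -(heat_kernel_conv (x - rvec z) r0 t0).
rewrite -(@ge0_integral_affine R n (rvec z) false
  (fun y => (G r (x - rvec y) * G t (rvec y - rvec z))%:E)).
- apply: eq_integral => y _; rewrite -rvec_add.
  have -> : x - (rvec z + rvec y) = x - rvec z - rvec y by rewrite opprD addrA.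
  by have -> : rvec z + rvec y - rvec z = rvec y by rewrite addrC addKr.
- apply/measurable_EFinP; exact: measurable_kernel_kernel.
- by move=> y; rewrite lee_fin mulr_ge0 ?heat_kernel_ge0.
Qed.

Lemma integrable_kernel_kernel r t x (z : n.-tuple RR) : 0 < r -> 0 < t ->
  leb.-integrable setT (EFin \o (fun y => G r (x - rvec y) * G t (rvec y - rvec z))).
Proof.
move=> r0 t0; apply: (@integrable_ltyP R _ _ leb _ (G (r + t) (x - rvec z))).
  exact: measurable_kernel_kernel.
rewrite -integral_kernel_kernel// le_eqVlt; apply/orP; left; apply/eqP; apply: eq_integral => y _.
by rewrite ger0_norm// mulr_ge0 ?heat_kernel_ge0.
Qed.

(** Fubini reduces the semigroup law to the convolution identity of the kernels. *)
Lemma heat_semigroup_comp M r t g x : 0 < r -> 0 < t -> mbounded M g ->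
  heat_semigroup r (heat_semigroup t g) x = heat_semigroup (r + t) g x.
Proof.
move=> r0 t0 bg; have [mg gM] := bg; have M0 := mbounded_ge0 bg.
pose F (p : n.-tuple RR * n.-tuple RR) :=
  G r (x - rvec p.1) * (G t (rvec p.1 - rvec p.2) * g (rvec p.2)).
have mF : measurable_fun setT F.
  apply: measurable_funM.
    exact: (measurableT_comp (measurable_kernel_sub r x) measurable_fst).
  apply: measurable_funM; last exact: (measurableT_comp mg measurable_snd).
  pose xi (p : n.-tuple RR * n.-tuple RR) : n.-tuple RR :=
    [tuple (tnth p.1 i - tnth p.2 i : RR) | i < n].
  have E p : rvec p.1 - rvec p.2 = rvec (xi p).
    by apply/rowP => i; rewrite !mxE tnth_mktuple.
  under eq_fun do rewrite E.
  apply: measurable_heat_kernel => //; apply/measurable_fun_tnthP => i.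
  rewrite (_ : _ \o _ = fun p : n.-tuple RR * n.-tuple RR => (tnth p.1 i - tnth p.2 i : RR)).
    apply: measurable_funB.
      exact: (measurableT_comp (measurable_tnth i) measurable_fst).
    exact: (measurableT_comp (measurable_tnth i) measurable_snd).
  by apply/funext => p; rewrite /= tnth_mktuple.
have iG := integrable_kernel_sub x r0.
have ig : leb.-integrable setT (EFin \o (fun y => M * G r (x - rvec y))).
  exact: integrable_cstM.
have Fg y : (\int[leb]_z `|F (y, z)|%:E <= (M * G r (x - rvec y))%:E)%E.
  rewrite mulrC EFinM -[X in (_ * X)%E]mule1 -(integral_kernel_sub (rvec y) t0).
  rewrite -ge0_integralZl ?lee_fin//; last 2 first.
  - by apply/measurable_EFinP; exact: measurable_kernel_sub.
  - by move=> z _; rewrite lee_fin heat_kernel_ge0.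
  rewrite -ge0_integralZl ?lee_fin ?heat_kernel_ge0//; last 2 first.
  - by apply: measurable_funeM; apply/measurable_EFinP; exact: measurable_kernel_sub.
  - by move=> z _; rewrite mule_ge0 ?lee_fin ?heat_kernel_ge0.
  apply: ge0_le_integral => //.
  - apply/measurable_EFinP; apply: measurableT_comp => //.
    exact: (measurableT_comp mF (pair1_measurable y)).
  - apply: measurable_funeM; apply: measurable_funeM; apply/measurable_EFinP.
    exact: measurable_kernel_sub.
  - move=> z _; rewrite -!EFinM lee_fin /F/= normrM (ger0_norm (heat_kernel_ge0 _ _)) normrM (ger0_norm (heat_kernel_ge0 _ _)).
    by rewrite ler_wpM2l ?heat_kernel_ge0// mulrC ler_wpM2r ?heat_kernel_ge0.
(* For fixed z the inner kernel is bounded by its value at 0, which leaves an integrable multiple of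
   [G r]. *)
have h2 z : leb.-integrable setT (fun y => (F (y, z))%:E).
  apply: (integrable_le (f := fun y => F (y, z))
      (g := fun y => ((4 * pi * t) `^ (- (n%:R / 2)) * M) * G r (x - rvec y))) => //.
  - exact: (measurableT_comp mF (pair2_measurable z)).
  - move=> y _; rewrite /F/= normrM (ger0_norm (heat_kernel_ge0 _ _)) normrM (ger0_norm (heat_kernel_ge0 _ _)) mulrC.
    rewrite ler_wpM2r ?heat_kernel_ge0// ler_pM ?heat_kernel_ge0//.
    exact: heat_kernel_le.
  - exact: integrable_cstM.
have := Rfubini mF ig Fg h2.
rewrite heat_semigroupE => E; transitivity (\int[leb]_y \int[leb]_z F (y, z)).
  apply: eq_Rintegral => y _; rewrite heat_semigroupE -RintegralZl//.
  exact: integrable_kernelM bg.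
rewrite E heat_semigroupE; apply: eq_Rintegral => z _.
have -> : (fun y => F (y, z)) = (fun y => (G r (x - rvec y) * G t (rvec y - rvec z)) * g (rvec z)).
  by apply/funext => y; rewrite /F/= mulrA.
rewrite RintegralZr//; last exact: integrable_kernel_kernel.
by rewrite /Rintegral integral_kernel_kernel.
Qed.

End HeatSemigroup.

(** * First derivatives of the heat semigroup *)

Section HeatSemigroupDerivatives.
Context {R : realType} {n : nat}.
Local Notation RR := (measurableTypeR R).
Implicit Types (x : 'rV[R]_n) (i : 'I_n) (t r M : R) (g k : 'rV[R]_n -> R).
Local Notation e_ i := (delta_mx ord0 i : 'rV[R]_n).
Local Notation G := (@heat_kernel R n).
Local Notation leb := (@lebRn R n).
Local Notation P := (@heat_semigroup R n).

Local Opaque heat_kernel.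

Lemma derive_shift (u : 'rV[R]_n -> R) z x v :
  (derivable u (x - z) v -> derivable (fun x => u (x - z)) x v) /\
  'D_v (fun x => u (x - z)) x = 'D_v u (x - z).
Proof.
have E : (fun k : R => k^-1 *: (u (k *: v + x - z) - u (x - z))) =
         (fun k : R => k^-1 *: (u (k *: v + (x - z)) - u (x - z))).
  by apply/funext => k; rewrite addrA.
by rewrite /derivable /derive/= E.
Qed.

Lemma deriveMl (u : 'rV[R]_n -> R) (c : R) x v : derivable u x v ->
  derivable (fun x => u x * c) x v /\ 'D_v (fun x => u x * c) x = 'D_v u x * c.
Proof.
move=> du; have -> : (fun x => u x * c) = c \*: u.
  by apply/funext => y; rewrite /GRing.scale_fun/= mulrC.
by split; [exact: derivableZ|rewrite deriveZ// mulrC].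
Qed.

(** The derivative is -x_i/(2t) times the kernel, so the moment bound with a = 1 gives t^(1/2)/t. *)
Lemma partial_kernel_bound : exists2 C : R, 0 < C &
  forall t i x, 0 < t -> `|partial i (G t) x| <= C * t `^ (- 2^-1) * G (2 * t) x.
Proof.
have [C C0 HC] := @heat_kernel_moment R n 1 ltr01.
exists (C / 2); first by rewrite divr_gt0.
move=> t i x t0; have [_ ->] := is_derive_heat_kernel x i t0.
rewrite normrM (ger0_norm (heat_kernel_ge0 _ _)) normrN normrM normfV.
rewrite (ger0_norm (x := 2 * t)); last by rewrite mulr_ge0 ?(ltW t0).
have h1 : `|x ord0 i| * G t x <= C * t `^ (1 / 2) * G (2 * t) x.
  apply: le_trans (HC t x t0); rewrite powRr1 ?enorm_ge0//.
  by rewrite ler_wpM2r ?heat_kernel_ge0// coord_le_enorm.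
have -> : t `^ (- 2^-1) = t `^ (1 / 2) * t^-1.
  rewrite -[t^-1]powR_inv1 ?(ltW t0)// -gt0_powRD//; congr (_ `^ _); lra.
have k0 : 0 <= (2 * t)^-1 by rewrite invr_ge0 mulr_ge0 ?(ltW t0).
have := ler_wpM2r k0 h1; congr (_ <= _); first by ring.
by field; rewrite gt_eqF.
Qed.

(** Differentiation doubles the time once and the shift doubles it again, hence 4t. The bound is
    uniform over |c| < 1, as domination along a line requires. *)
Lemma kernel_shift_bound : exists C : R -> R, forall t (c : R) i x, 0 < t -> -1 < c < 1 ->
  `|partial i (G t) (c *: e_ i + x)| <= C t * G (4 * t) x.
Proof.
have [C C0 HC] := partial_kernel_bound.
exists (fun t => C * t `^ (- 2^-1) * (2 `^ (n%:R / 2) * expR (4 * (2 * t))^-1)).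
move=> t c i x t0 c1; apply: le_trans (HC t i _ t0) _.
have t20 : 0 < 2 * t by rewrite mulr_gt0.
rewrite -[leRHS]mulrA ler_wpM2l ?mulr_ge0 ?powR_ge0 ?(ltW C0)//.
have -> : 4 * t = 2 * (2 * t) by ring.
by apply: heat_kernel_shift => //; rewrite ler_norml; lra.
Qed.

Lemma partial_heat_semigroup M t g x i : 0 < t -> mbounded M g ->
  derivable (P t g) x (e_ i) /\
  partial i (P t g) x = \int[leb]_z (partial i (G t) (x - rvec z) * g (rvec z)).
Proof.
move=> t0 bg; have [C HC] := kernel_shift_bound; have M0 := mbounded_ge0 bg.
pose f (x : 'rV[R]_n) (z : n.-tuple RR) := G t (x - rvec z) * g (rvec z).
have -> : P t g = fun x => \int[leb]_z f x z by apply/funext => y; rewrite heat_semigroupE.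
have df z y : derivable (f ^~ z) y (e_ i) /\
    'D_(e_ i) (f ^~ z) y = partial i (G t) (y - rvec z) * g (rvec z).
  have [d1 d2] := is_derive_heat_kernel (y - rvec z) i t0.
  have [s1 s2] := derive_shift (G t) (rvec z) y (e_ i).
  have [m1 m2] := deriveMl (g (rvec z)) (s1 d1).
  by split; [exact: m1|rewrite /partial -s2; exact: m2].
have [|||| d1 d2] := @derivable_under R 'rV[R]_n _ _ leb f
    (fun z => C t * M * G (4 * t) (x - rvec z)) x (e_ i).
- by move=> h; exact: integrable_kernelM bg.
- by move=> h y _; exact: (df y _).1.
- by apply: integrable_cstM; apply: integrable_kernel_sub; rewrite mulr_gt0.
- move=> h y h1; rewrite (df y _).2 normrM -addrA mulrAC.
  by apply: ler_pM => //; [exact: HC|exact: bg.2].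
split => //; rewrite /partial d2; apply: eq_Rintegral => z _.
exact: (df z _).2.
Qed.

(** P_t preserves constants, so g may be replaced by g - c before differentiating. The choice c =
    g(x) is what lets a Hoelder bound gain a power of t. *)
Lemma partial_semigroup_le : exists2 C : R, 0 < C &
  forall M t g x i (c : R), 0 < t -> mbounded M g ->
  `|partial i (P t g) x| <= C * t `^ (- 2^-1) * P (2 * t) (fun z => `|g z - c|) x.
Proof.
have [C C0 HC] := partial_kernel_bound; exists C => // M t g x i c t0 bg.
have t20 : 0 < 2 * t by rewrite mulr_gt0.
have bgc := mboundedB bg (mbounded_cst c).
have -> : partial i (P t g) x = partial i (P t (fun z => g z - c)) x.
  have E : P t (fun z => g z - c) = fun y => P t g y - c.
    apply/funext => y; rewrite (heat_semigroupB y t0 bg (mbounded_cst c)).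
    by rewrite heat_semigroup_cst.
  rewrite E /partial deriveB//; last exact: (partial_heat_semigroup x i t0 bg).1.
  by rewrite derive_cst subr0.
rewrite (partial_heat_semigroup x i t0 bgc).2 heat_semigroupE.
have mK : measurable_fun setT (fun z : n.-tuple RR => partial i (G t) (x - rvec z)).
  have E (z : n.-tuple RR) : partial i (G t) (x - rvec z) =
      - ((x ord0 i - tnth z i) / (2 * t)) * G t (x - rvec z).
    by rewrite (is_derive_heat_kernel _ i t0).2 !mxE.
  under eq_fun do rewrite E.
  apply: measurable_funM; last exact: measurable_kernel_sub.
  apply: measurableT_comp => //; apply: measurable_funM => //.
  by apply: measurable_funB => //; exact: measurable_tnth.
have iK : leb.-integrable setT (EFin \o (fun z => partial i (G t) (x - rvec z) * (g (rvec z) - c))).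
  apply: (integrable_le (g := fun z => (M + `|c|) * (C * t `^ (- 2^-1)) * G (2 * t) (x - rvec z))) => //.
  - by apply: measurable_funM => //; exact: bgc.1.
  - move=> z _; rewrite normrM mulrC -mulrA; apply: ler_pM => //; first exact: bgc.2.
    exact: HC.
  - by apply: integrable_cstM; exact: integrable_kernel_sub.
apply: le_trans (le_normr_Rintegral _ iK) _ => //.
rewrite -RintegralZl//; last exact: (integrable_kernelM x t20 (mbounded_norm bgc)).
apply: le_Rintegral => //.
- by have := integrable_abse iK; apply: eq_integrable.
- by apply: integrable_cstM; exact: (integrable_kernelM x t20 (mbounded_norm bgc)).
- by move=> z _; rewrite normrM [leRHS]mulrA ler_wpM2r//; exact: HC.
Qed.

Lemma partial_semigroup_bound : exists2 C : R, 0 < C &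
  forall M t g x i, 0 < t -> mbounded M g -> `|partial i (P t g) x| <= C * t `^ (- 2^-1) * M.
Proof.
have [C C0 HC] := partial_semigroup_le; exists C => // M t g x i t0 bg.
apply: le_trans (HC M t g x i 0 t0 bg) _.
rewrite ler_wpM2l ?mulr_ge0 ?powR_ge0 ?(ltW C0)//.
have t20 : 0 < 2 * t by rewrite mulr_gt0.
have b0 : mbounded M (fun z => `|g z - 0|).
  by under eq_fun do rewrite subr0; exact: mbounded_norm.
by apply: le_trans (ler_norm _) _; exact: heat_semigroup_bound.
Qed.

Lemma continuous_heat_semigroup M t g : 0 < t -> mbounded M g -> continuous (P t g).
Proof.
move=> t0 bg; have [C C0 HC] := partial_semigroup_bound.
apply: (@lipschitz_continuous _ _ _ (C * t `^ (- 2^-1) * M * n%:R)) => x y.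
rewrite -mulrA; apply: partial_lipschitz => i z; first exact: (partial_heat_semigroup z i t0 bg).1.
exact: HC.
Qed.

(** A pointwise limit of difference quotients with steps 1/(m+1), each continuous in x; the partial
    derivative itself is not assumed continuous. *)
Lemma measurable_partial (u : 'rV[R]_n -> R) i : continuous u -> (forall x, derivable u x (e_ i)) ->
  measurable_fun setT (fun z : n.-tuple RR => partial i u (rvec z)).
Proof.
move=> cu du.
pose q (m : nat) x := (m.+1%:R^-1 : R)^-1 * (u (m.+1%:R^-1 *: e_ i + x) - u x).
apply: (@measurable_fun_cvg _ _ _ _ (fun m z => q m (rvec z))) => //.
  move=> m; apply: measurable_funM => //; apply: measurable_funB; last exact: measurable_rvec.
  apply: (measurable_rvec (u := fun x => u (m.+1%:R^-1 *: e_ i + x))) => x.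
  apply: (@continuous_comp _ _ _ (fun y => m.+1%:R^-1 *: e_ i + y) u); last exact: cu.
  by apply: (@continuousD R 'rV[R]_n _ (fun=> _) id); [exact: cst_continuous|by move=> ?; exact: cvg_id].
move=> z _; rewrite /q /partial.
have /cvg_ex[l hl] := du (rvec z).
have <- : l = 'D_(e_ i) u (rvec z) by apply/esym/cvg_lim.
apply: ((cvgr_dnbhsP (fun k : R => k^-1 *: (u (k *: e_ i + rvec z) - u (rvec z))) 0 l).1 hl).
by split; [move=> m; rewrite invr_eq0 pnatr_eq0|exact: cvg_harmonic].
Qed.

(** With the convolution written as an integral of G_t(z) g(x - z), the derivative falls on g and N
    G_t dominates. *)
Lemma partial_commute M N t g x i : 0 < t -> mbounded M g ->
  (forall z, derivable g z (e_ i)) -> mbounded N (partial i g) ->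
  partial i (P t g) x = P t (partial i g) x.
Proof.
move=> t0 bg dg bdg; have N0 := mbounded_ge0 bdg.
pose f (x : 'rV[R]_n) (z : n.-tuple RR) := g (x - rvec z) * G t (rvec z).
have -> : P t g = fun x => \int[leb]_z f x z.
  by apply/funext => y; rewrite (heat_semigroupE' _ _ bg); apply: eq_Rintegral => z _; rewrite mulrC.
have df z y : derivable (f ^~ z) y (e_ i) /\
    'D_(e_ i) (f ^~ z) y = partial i g (y - rvec z) * G t (rvec z).
  have [s1 s2] := derive_shift g (rvec z) y (e_ i).
  have [m1 m2] := deriveMl (G t (rvec z)) (s1 (dg _)).
  by split; [exact: m1|rewrite /partial -s2; exact: m2].
have [|||| d1 d2] := @derivable_under R 'rV[R]_n _ _ leb f (fun z => N * G t (rvec z)) x (e_ i).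
- move=> h; apply: (integrable_le (g := fun z => M * G t (rvec z))) => //.
  + apply: measurable_funM; last exact: measurable_kernel.
    under eq_fun do rewrite rvec_sub.
    exact: (measurableT_comp bg.1 (measurable_taffine _ _)).
  + by move=> z _; rewrite normrM (ger0_norm (heat_kernel_ge0 _ _)) ler_wpM2r ?heat_kernel_ge0//; exact: bg.2.
  + by apply: integrable_cstM; exact: integrable_kernel.
- by move=> h y _; exact: (df y _).1.
- by apply: integrable_cstM; exact: integrable_kernel.
- move=> h y h1; rewrite (df y _).2 normrM (ger0_norm (heat_kernel_ge0 _ _)).
  by rewrite ler_wpM2r ?heat_kernel_ge0//; exact: bdg.2.
rewrite {1}/partial d2 (heat_semigroupE' _ _ bdg); apply: eq_Rintegral => z _.
by rewrite (df z _).2 mulrC.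
Qed.

End HeatSemigroupDerivatives.

(** * Derivatives of all orders, Hoelder data and decay in time *)

Section HeatSemigroupEstimates.
Context {R : realType} {n : nat}.
Local Notation RR := (measurableTypeR R).
Implicit Types (x : 'rV[R]_n) (i : 'I_n) (I : seq 'I_n) (t r M : R) (g k f : 'rV[R]_n -> R).
Local Notation e_ i := (delta_mx ord0 i : 'rV[R]_n).
Local Notation G := (@heat_kernel R n).
Local Notation leb := (@lebRn R n).
Local Notation P := (@heat_semigroup R n).

Local Opaque heat_kernel.

Lemma mbounded_heat_semigroup M t g : 0 < t -> mbounded M g -> mbounded M (P t g).
Proof.
move=> t0 bg; apply: continuous_mbounded; first exact: continuous_heat_semigroup t0 bg.
by move=> x; exact: heat_semigroup_bound.
Qed.

Lemma heat_semigroup_half M t g : 0 < t -> mbounded M g -> P t g = P (t / 2) (P (t / 2) g).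
Proof.
move=> t0 bg; have t2 : 0 < t / 2 by rewrite divr_gt0.
by apply/funext => x; rewrite (heat_semigroup_comp x t2 t2 bg) -splitr.
Qed.

Lemma mbounded_partial_semigroup : exists2 C : R, 0 < C & forall M t g i,
  0 < t -> mbounded M g -> mbounded (C * t `^ (- 2^-1) * M) (partial i (P t g)).
Proof.
have [C C0 HC] := @partial_semigroup_bound R n; exists C => // M t g i t0 bg.
split; last by move=> x; exact: HC.
apply: measurable_partial; first exact: continuous_heat_semigroup t0 bg.
by move=> x; exact: (partial_heat_semigroup x i t0 bg).1.
Qed.

Lemma partial_semigroup_half M t g i : 0 < t -> mbounded M g ->
  partial i (P t g) = P (t / 2) (partial i (P (t / 2) g)).
Proof.
move=> t0 bg; have t2 : 0 < t / 2 by rewrite divr_gt0.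
have [C C0 HC] := mbounded_partial_semigroup.
have bg2 := mbounded_heat_semigroup t2 bg.
rewrite {1}(heat_semigroup_half t0 bg); apply/funext => x.
apply: (partial_commute x t2 bg2 _ (HC _ _ _ i t2 bg)).
by move=> z; exact: (partial_heat_semigroup z i t2 bg).1.
Qed.

Lemma iterD_rcons I i g : Defs.iterD (rcons I i) g = Defs.iterD I (partial i g).
Proof. by rewrite /Defs.iterD foldr_rcons. Qed.

(* The semigroup property turns a bound for one derivative into bounds of all orders:
   [D^I D_i e^(t Delta) = (D^I e^(t/2 Delta)) (D_i e^(t/2 Delta))]. *)
Lemma iterD_semigroup I : exists2 C : R, 0 < C & forall M t g, 0 < t -> mbounded M g ->
  [/\ continuous (Defs.iterD I (P t g)),
      forall i x, derivable (Defs.iterD I (P t g)) x (e_ i) &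
      forall x, `|Defs.iterD I (P t g) x| <= C * t `^ (- ((size I)%:R / 2)) * M].
Proof.
elim/last_ind: I => [|I i [C C0 HC]].
  exists 1 => // M t g t0 bg; split.
  - exact: continuous_heat_semigroup t0 bg.
  - by move=> i x; exact: (partial_heat_semigroup x i t0 bg).1.
  - by move=> x; rewrite mul0r oppr0 powRr0 !mul1r; exact: heat_semigroup_bound.
have [D D0 HD] := mbounded_partial_semigroup.
exists (C * D * 2 `^ ((size I).+1%:R / 2)); first by rewrite !mulr_gt0// powR_gt0.
move=> M t g t0 bg; have t2 : 0 < t / 2 by rewrite divr_gt0.
have [c1 c2 c3] := HC _ _ _ t2 (HD M (t / 2) g i t2 bg).
rewrite iterD_rcons (partial_semigroup_half i t0 bg); split => // x.
apply: le_trans (c3 x) _; rewrite size_rcons mulrA ler_wpM2r ?(mbounded_ge0 bg)//.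
rewrite mulrA [C * _ * D]mulrAC -!mulrA ler_wpM2l ?(ltW C0)// ler_wpM2l ?(ltW D0)//.
rewrite -gt0_powRD// le_eqVlt; apply/orP; left; apply/eqP.
have -> : - ((size I)%:R / 2) - 2^-1 = - ((size I).+1%:R / 2) :> R by rewrite -natr1; field.
rewrite powRM ?invr_ge0 ?(ltW t0)// -powR_inv1// -powRrM mulN1r opprK.
by rewrite mulrC.
Qed.

(** The splitting in halves again, but measured by a bound of P_(t/2) g instead of g: decay of the
    semigroup in t passes to its derivatives. *)
Lemma iterD_semigroup_decay I : exists2 C : R, 0 < C & forall M B t g x,
  0 < t -> mbounded M g -> mbounded B (P (t / 2) g) ->
  `|Defs.iterD I (P t g) x| <= C * t `^ (- ((size I)%:R / 2)) * B.
Proof.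
have [C C0 HC] := iterD_semigroup I.
exists (C * 2 `^ ((size I)%:R / 2)); first by rewrite mulr_gt0// powR_gt0.
move=> M B t g x t0 bg bB; have t2 : 0 < t / 2 by rewrite divr_gt0.
rewrite (heat_semigroup_half t0 bg); have [_ _ h] := HC B _ _ t2 bB.
apply: le_trans (h x) _; rewrite ler_wpM2r ?(mbounded_ge0 bB)// -mulrA ler_wpM2l ?(ltW C0)//.
rewrite powRM ?invr_ge0 ?(ltW t0)// -powR_inv1// -powRrM mulN1r opprK.
by rewrite mulrC.
Qed.

Definition holder_le (a A : R) f := forall x y, `|f x - f y| <= A * enorm (x - y) `^ a.

(** The moment bound turns |x - z|^a into t^(a/2), and the remaining kernel at time 2t has mass
    one. *)
Lemma heat_semigroup_moment (a : R) : 0 < a -> exists2 C : R, 0 < C &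
  forall M A t f x (c : R), 0 < t -> 0 <= A -> mbounded M f ->
    (forall z, `|f z - c| <= A * enorm (x - z) `^ a) ->
    P t (fun z => `|f z - c|) x <= C * t `^ (a / 2) * A.
Proof.
move=> a0; have [C C0 HC] := @heat_kernel_moment R n a a0; exists C => //.
move=> M A t f x c t0 A0 bf hf; have t20 : 0 < 2 * t by rewrite mulr_gt0.
have bfc := mbounded_norm (mboundedB bf (mbounded_cst c)).
have -> : C * t `^ (a / 2) * A = \int[leb]_z ((C * t `^ (a / 2) * A) * G (2 * t) (x - rvec z)).
  rewrite RintegralZl//; last exact: integrable_kernel_sub.
  by rewrite /Rintegral integral_kernel_sub// mulr1.
rewrite heat_semigroupE; apply: le_Rintegral => //.
- exact: integrable_kernelM bfc.
- by apply: integrable_cstM; exact: integrable_kernel_sub.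
- move=> z _; apply: (@le_trans _ _ (A * (enorm (x - rvec z) `^ a * G t (x - rvec z)))).
    by rewrite mulrC [leRHS]mulrA ler_wpM2r ?heat_kernel_ge0.
  by rewrite [C * _ * A]mulrC -[leRHS]mulrA ler_wpM2l// HC.
Qed.

(** Averaging translates of f against a kernel of mass one does not increase the Hoelder
    constant. *)
Lemma heat_semigroup_holder M a A t f x y : 0 < t -> mbounded M f ->
  holder_le a A f -> `|P t f x - P t f y| <= A * enorm (x - y) `^ a.
Proof.
move=> t0 bf hf; rewrite !(heat_semigroupE' _ _ bf).
have sh w : mbounded M (fun z => f (w - z)).
  split=> [|z]; last exact: bf.2.
  under eq_fun do rewrite rvec_sub.
  exact: (measurableT_comp bf.1 (measurable_taffine _ _)).
have ish w : leb.-integrable setT (EFin \o (fun z => G t (rvec z) * f (w - rvec z))).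
  have := integrable_kernelM 0 t0 (sh w).
  apply: eq_integrable => // z _ /=; congr (_ * _)%:E.
  by rewrite sub0r heat_kernelN.
have c0 := heat_semigroup_cst (n := n) (A * enorm (x - y) `^ a) 0 t0.
rewrite -RintegralB// -[leRHS]c0 (heat_semigroupE' _ _ (mbounded_cst _)).
have iB := integrableB measurableT (ish x) (ish y).
have iB' : leb.-integrable setT (EFin \o
    (fun z => G t (rvec z) * f (x - rvec z) - G t (rvec z) * f (y - rvec z))).
  by apply: eq_integrable iB.
apply: le_trans (le_normr_Rintegral _ iB') _ => //.
apply: le_Rintegral => //.
- by have := integrable_abse iB'; apply: eq_integrable.
- under eq_fun do rewrite mulrC; apply: integrable_cstM; exact: integrable_kernel.
- move=> z _; rewrite -mulrBr normrM (ger0_norm (heat_kernel_ge0 _ _)).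
  rewrite ler_wpM2l ?heat_kernel_ge0//; apply: le_trans (hf _ _) _.
  by rewrite opprB addrA subrK.
Qed.

(** Since P_t preserves constants, the difference is P_t (f - f(x)) at x. This is the modulus of
    continuity at t = 0 required by the inversion formula. *)
Lemma heat_semigroup_approx (a : R) : 0 < a -> exists2 C : R, 0 < C &
  forall M A t f x, 0 < t -> 0 <= A -> mbounded M f -> holder_le a A f ->
    `|P t f x - f x| <= C * t `^ (a / 2) * A.
Proof.
move=> a0; have [C C0 HC] := heat_semigroup_moment a0; exists C => //.
move=> M A t f x t0 A0 bf hf.
have h z : `|f z - f x| <= A * enorm (x - z) `^ a by rewrite enormB; exact: hf.
apply: le_trans (HC M A t f x (f x) t0 A0 bf h).
have bfc := mboundedB bf (mbounded_cst (f x)).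
have E : f x = P t (fun=> f x) x by rewrite heat_semigroup_cst.
rewrite [X in `|_ - X|]E -(heat_semigroupB x t0 bf (mbounded_cst _)).
exact: (heat_semigroup_le x t0 bfc (mbounded_norm bfc)).
Qed.

(** The derivative acting first sees the Hoelder bound and costs t^((a-1)/2); each other one uses
    only the smoothing of a bounded function and costs t^(-1/2). *)
Lemma iterD_semigroup_holder (a : R) I : 0 < a -> (0 < size I)%N -> exists2 C : R, 0 < C &
  forall M A t f x, 0 < t -> 0 <= A -> mbounded M f -> holder_le a A f ->
    `|Defs.iterD I (P t f) x| <= C * t `^ ((a - (size I)%:R) / 2) * A.
Proof.
move=> a0; case/lastP: I => // I i _.
have [C C0 HC] := heat_semigroup_moment a0.
have [D D0 HD] := @partial_semigroup_le R n.
have [E E0 HE] := iterD_semigroup I.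
pose K := D * (C * 2 `^ (a / 2)).
have K0 : 0 < K by rewrite !mulr_gt0// powR_gt0.
have step M A t f x : 0 < t -> 0 <= A -> mbounded M f -> holder_le a A f ->
    `|partial i (P t f) x| <= K * t `^ ((a - 1) / 2) * A.
  move=> t0 A0 bf hf; have t20 : 0 < 2 * t by rewrite mulr_gt0.
  apply: le_trans (HD M t f x i (f x) t0 bf) _.
  have h z : `|f z - f x| <= A * enorm (x - z) `^ a by rewrite enormB; exact: hf.
  have h2 := HC M A (2 * t) f x (f x) t20 A0 bf h.
  have k0 : 0 <= D * t `^ (- 2^-1) by rewrite mulr_ge0 ?powR_ge0// ltW.
  apply: le_trans (ler_wpM2l k0 h2) _.
  have -> : t `^ ((a - 1) / 2) = t `^ (- 2^-1) * t `^ (a / 2).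
    by rewrite -gt0_powRD//; congr (_ `^ _); field.
  rewrite (powRM _ _ (ltW t0))// le_eqVlt; apply/orP; left; apply/eqP; rewrite /K; ring.
clearbody K.
exists (E * K * 2 `^ ((size I).+1%:R / 2 - a / 2)); first by rewrite !mulr_gt0// powR_gt0.
move=> M A t f x t0 A0 bf hf; have t2 : 0 < t / 2 by rewrite divr_gt0.
rewrite iterD_rcons (partial_semigroup_half i t0 bf).
have b2 : mbounded (K * (t / 2) `^ ((a - 1) / 2) * A) (partial i (P (t / 2) f)).
  split; last by move=> z; exact: (step M A _ f z).
  apply: measurable_partial; first exact: continuous_heat_semigroup t2 bf.
  by move=> z; exact: (partial_heat_semigroup z i t2 bf).1.
have [_ _ h] := HE _ _ _ t2 b2.
apply: le_trans (h x) _; rewrite size_rcons mulrA ler_wpM2r//.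
rewrite mulrA [E * _ * K]mulrAC -!mulrA ler_wpM2l ?(ltW E0)// ler_wpM2l ?(ltW K0)//.
rewrite -gt0_powRD// le_eqVlt; apply/orP; left; apply/eqP.
have -> : - ((size I)%:R / 2) + (a - 1) / 2 = - ((size I).+1%:R / 2 - a / 2) :> R.
  by rewrite -natr1; field.
rewrite powRM ?invr_ge0 ?(ltW t0)// -powR_inv1// -powRrM mulN1r opprK mulrC.
by congr (_ * _ `^ _); field.
Qed.

(* Hence [e^(t Delta) f] is dominated by the kernel at time [t + 1], which gives both
   the decay in [t] and the decay at infinity. *)
Lemma compact_support_le_kernel M f : mbounded M f -> compactly_supported f ->
  exists2 K : R, 0 <= K & forall z, `|f z| <= K * G 1 z.
Proof.
move=> [_ fM] cf; have M0 : 0 <= M := le_trans (normr_ge0 _) (fM 0).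
have [N [_ HN]] := compact_bounded cf.
pose N1 := `|N| + 1.
have N1N : N < N1 by rewrite /N1; have := ler_norm N; lra.
have fN z : f z != 0 -> `|z| <= N1.
  by move=> fz; apply: HN => //; exact: subset_closure.
have fe z : f z != 0 -> enorm z <= n%:R * N1.
  by move=> /fN zN; apply: le_trans (enorm_le_norm z) _; rewrite ler_wpM2l.
have [c c0 Hc] := @heat_kernel_ge_ball R n (n%:R * N1).
exists (M / c); first by rewrite divr_ge0 ?(ltW c0).
move=> z; have [->|fz] := eqVneq (f z) 0.
  by rewrite normr0 mulr_ge0 ?heat_kernel_ge0 ?divr_ge0 ?(ltW c0).
apply: le_trans (fM z) _; rewrite mulrAC ler_pdivlMr//.
by rewrite ler_wpM2l// Hc// fe.
Qed.

(** Positivity of the kernel and the convolution of [G t] with [G 1]. *)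
Lemma heat_semigroup_le_kernel M K t f x : 0 < t -> mbounded M f -> 0 <= K ->
  (forall z, `|f z| <= K * G 1 z) -> `|P t f x| <= K * G (t + 1) x.
Proof.
move=> t0 bf K0 fK.
have bG : mbounded (K * (4 * pi * 1) `^ (- (n%:R / 2))) (fun z => K * G 1 z).
  split; first by apply: measurable_funM => //; exact: measurable_kernel.
  move=> z; rewrite ger0_norm; last by rewrite mulr_ge0 ?heat_kernel_ge0.
  by rewrite ler_wpM2l// heat_kernel_le.
apply: (le_trans (heat_semigroup_le x t0 bf bG fK)); rewrite heat_semigroupE.
under eq_Rintegral do rewrite mulrCA.
have mGG : measurable_fun setT (fun z : n.-tuple RR => G t (x - rvec z) * G 1 (rvec z)).
  by apply: measurable_funM; [exact: measurable_kernel_sub|exact: measurable_kernel].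
rewrite RintegralZl//; first by rewrite /Rintegral heat_kernel_conv.
apply: (@integrable_ltyP R _ _ leb _ (G (t + 1) x)) => //.
rewrite -heat_kernel_conv// le_eqVlt; apply/orP; left; apply/eqP; apply: eq_integral => z _.
by rewrite ger0_norm// mulr_ge0 ?heat_kernel_ge0.
Qed.

Section time_measurability.
Context d (T : measurableType d) (f : 'rV[R]_n -> R).
Hypothesis mf : measurable_fun setT (fun z : n.-tuple RR => f (rvec z)).

(** Tonelli applies to the positive and negative parts separately, so measurability extends to
    parameters where the integral diverges. *)
Lemma measurable_Rintegral_param d2 (T2 : measurableType d2)
    (m : {sigma_finite_measure set T2 -> \bar R}) (F : T * T2 -> R) :
  measurable_fun setT F -> measurable_fun setT (fun p => \int[m]_y F (p, y)).
Proof.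
move=> mF; apply: measurableT_comp => //.
have mE : measurable_fun setT (EFin \o F) by exact/measurable_EFinP.
under eq_fun do rewrite integralE.
apply: emeasurable_funB.
- have h : forall p, (0 <= (EFin \o F)^\+ p)%E by move=> ?; exact: funepos_ge0.
  have := measurable_fun_fubini_tonelli_F (m2 := m) _ (measurable_funepos mE) h.
  apply: eq_measurable_fun => p _; apply: eq_integral => y _.
  by rewrite !funeposE.
- have h : forall p, (0 <= (EFin \o F)^\- p)%E by move=> ?; exact: funeneg_ge0.
  have := measurable_fun_fubini_tonelli_F (m2 := m) _ (measurable_funeneg mE) h.
  apply: eq_measurable_fun => p _; apply: eq_integral => y _.
  by rewrite !funenegE.
Qed.

(** Two arbitrary measurable maps for time and space cover both joint measurability, for Fubini, and
    the sections in t alone. *)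
Lemma measurable_heat_semigroup (tau : T -> R) (xi : T -> n.-tuple RR) :
  measurable_fun setT tau -> measurable_fun setT xi ->
  measurable_fun setT (fun p => P (tau p) f (rvec (xi p))).
Proof.
move=> mtau mxi; under eq_fun do rewrite heat_semigroupE.
pose xi' (q : T * n.-tuple RR) : n.-tuple RR := [tuple (tnth (xi q.1) i - tnth q.2 i : RR) | i < n].
apply: (@measurable_Rintegral_param _ _ leb
  (fun q => G (tau q.1) (rvec (xi q.1) - rvec q.2) * f (rvec q.2))).
apply: measurable_funM; last exact: (measurableT_comp mf measurable_snd).
have E q : rvec (xi q.1) - rvec q.2 = rvec (xi' q).
  by apply/rowP => i; rewrite !mxE tnth_mktuple.
under eq_fun do rewrite E.
apply: measurable_heat_kernel; first exact: (measurableT_comp mtau measurable_fst).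
apply/measurable_fun_tnthP => i.
rewrite (_ : _ \o _ = fun q : T * n.-tuple RR => (tnth (xi q.1) i - tnth q.2 i : RR)).
  apply: measurable_funB; last exact: (measurableT_comp (measurable_tnth i) measurable_snd).
  apply: (measurableT_comp (measurable_tnth i)).
  exact: (measurableT_comp mxi measurable_fst).
by apply/funext => p; rewrite /= tnth_mktuple.
Qed.

End time_measurability.

End HeatSemigroupEstimates.

(** * Riesz potentials *)

Section MellinScale.
Context {R : realType}.
Local Notation mu := (@lebesgue_measure R).

(** Cutting at T = d^2, the parabolic scale, makes both pieces the same power of d exactly when the
    exponents balance. Here d is the length of a step. *)
Lemma mellin_scale (w : R -> R) (s p q e1 e2 B C d : R) : measurable_fun setT w ->
  0 < d -> 0 <= B -> 0 <= C -> 0 < p + s -> q + s < 0 ->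
  e1 + 2 * (p + s) = e2 + 2 * (q + s) ->
  (forall t, 0 < t -> `|w t| <= B * d `^ e1 * t `^ p) ->
  (forall t, 0 < t -> `|w t| <= C * d `^ e2 * t `^ q) ->
  `|\int[mu]_t (tpow (s - 1) t * w t)| <=
    (B / (p + s) + C / - (q + s)) * d `^ (e1 + 2 * (p + s)).
Proof.
move=> mw d0 B0 C0 ps qs e12 h1 h2.
have B1 : 0 <= B * d `^ e1 by rewrite mulr_ge0 ?powR_ge0.
have C1 : 0 <= C * d `^ e2 by rewrite mulr_ge0 ?powR_ge0.
have dd0 : 0 < d `^ 2 by exact: powR_gt0.
apply: le_trans (mellin_le mw B1 C1 ps qs h1 h2 dd0) _.
rewrite [leRHS]mulrDl; apply: lerD; [|rewrite e12]; rewrite -powRrM gt0_powRD//.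
  by rewrite le_eqVlt; apply/orP; left; apply/eqP; ring.
by rewrite le_eqVlt; apply/orP; left; apply/eqP; ring.
Qed.

End MellinScale.

Section RieszPotential.
Context {R : realType} {n : nat}.
Local Notation RR := (measurableTypeR R).
Local Notation mu := (@lebesgue_measure R).
Implicit Types (x y h : 'rV[R]_n) (i : 'I_n) (I : seq 'I_n) (t M : R) (f : 'rV[R]_n -> R).
Local Notation e_ i := (delta_mx ord0 i : 'rV[R]_n).
Local Notation G := (@heat_kernel R n).
Local Notation P := (@heat_semigroup R n).
Local Notation iterD := (@Defs.iterD R n).

Local Opaque heat_kernel.

(** Set to zero for t <= 0, where the kernel has no meaning, so that measurability in t can be
    stated on the whole line. *)
Definition heat_deriv I f t x : R := if 0 < t then iterD I (P t f) x else 0.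

(** The candidate for D^I u obtained by differentiating under the integral; [iterD_riesz] identifies
    it with the derivative when |I| < a + 2s. *)
Definition riesz_deriv (s : R) I f x : R :=
  (Gamma s)^-1 * \int[mu]_t (tpow (s - 1) t * heat_deriv I f t x).

Lemma inv_frac_laplacianE s f : inv_frac_laplacian s f = riesz_deriv s [::] f.
Proof.
apply/funext => x; rewrite /inv_frac_laplacian /riesz_deriv; congr (_ * _).
transitivity (\int[mu]_(t in `]0%R, +oo[) (t `^ (s - 1) * P t f x)).
  apply: eq_Rintegral => t _.
  by rewrite mulrC -powRN opprB.
rewrite Rintegral_tpow; apply: eq_Rintegral => t _.
by rewrite /heat_deriv /tpow; case: ifP => //; rewrite !mul0r.
Qed.

(** Induction on the word: a derivative is a limit of difference quotients in x, each measurable in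
    t. *)
Lemma measurable_heat_deriv M f I x : mbounded M f ->
  measurable_fun setT (fun t => heat_deriv I f t x).
Proof.
move=> bf; elim: I x => [|i I IH] x.
  apply: measurable_fun_ifT => //; first by apply: (@measurable_fun_ltr _ _ _ _ (cst 0) id).
  have := measurable_heat_semigroup bf.1 (@measurable_id _ RR setT) (@measurable_cst _ _ _ _ setT (vtup x)).
  by rewrite /cst vtupK.
pose q (m : nat) t := (m.+1%:R^-1 : R)^-1 * (heat_deriv I f t (m.+1%:R^-1 *: e_ i + x) - heat_deriv I f t x).
apply: (@measurable_fun_cvg _ _ _ _ q) => //.
  by move=> m; apply: measurable_funM => //; exact: measurable_funB.
move=> t _; rewrite /q /heat_deriv; case: ifP => t0; last first.
  by under eq_fun do rewrite subrr mulr0; exact: cvg_cst.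
have [C _ HC] := @iterD_semigroup R n I.
have [_ dI _] := HC _ _ _ t0 bf.
have /cvg_ex[l hl] := dI i x.
have -> : iterD (i :: I) (P t f) x = l by exact: cvg_lim hl.
apply: ((cvgr_dnbhsP (fun k : R => k^-1 *: (iterD I (P t f) (k *: e_ i + x) - iterD I (P t f) x)) 0 l).1 hl).
by split; [move=> m; rewrite invr_eq0 pnatr_eq0|exact: cvg_harmonic].
Qed.

Lemma ler_powRN (q u v : R) : 0 <= q -> 0 < u -> u <= v -> v `^ (- q) <= u `^ (- q).
Proof.
move=> q0 u0 uv; have v0 : 0 < v by exact: lt_le_trans uv.
rewrite !powRN lef_pV2 ?posrE ?powR_gt0//.
by apply: ge0_ler_powR; rewrite ?nnegrE ?(ltW u0) ?(ltW v0).
Qed.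

(* The exponent of [t] in the small-time bound of [D^I e^(t Delta) f]; the Hoelder
   seminorm only helps once there is a derivative. *)
Definition small_exp (a : R) I : R := if I is [::] then 0 else (a - (size I)%:R) / 2.

(** The constant for large t depends on K, hence on the support of f, so these bounds serve
    convergence and do not enter the Schauder constants. *)
Lemma heat_deriv_bounds (a M A K : R) f I : 0 < a -> mbounded M f -> 0 <= A -> holder_le a A f ->
  0 <= K -> (forall z, `|f z| <= K * G 1 z) ->
  exists B C : R, [/\ 0 <= B, 0 <= C & forall t x, 0 < t ->
    `|heat_deriv I f t x| <= B * t `^ small_exp a I /\
    `|heat_deriv I f t x| <= C * t `^ (- ((size I)%:R / 2) - n%:R / 2)].
Proof.
move=> a0 bf A0 hf K0 fK; have M0 := mbounded_ge0 bf.
have [C C0 HC] := @iterD_semigroup_decay R n I.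
have decay t x : 0 < t -> `|heat_deriv I f t x| <= (C * K) * t `^ (- ((size I)%:R / 2) - n%:R / 2).
  move=> t0; rewrite /heat_deriv t0; have t2 : 0 < t / 2 by rewrite divr_gt0.
  have b2 : mbounded (K * t `^ (- (n%:R / 2))) (P (t / 2) f).
    split; first exact: (mbounded_heat_semigroup t2 bf).1.
    move=> z; apply: (le_trans (heat_semigroup_le_kernel z t2 bf K0 fK)).
    have t1 : 0 < t / 2 + 1 by lra.
    rewrite ler_wpM2l//; apply: le_trans (heat_kernel_le _ t1) _.
    (* The shift of time is dropped here: 4 pi (t/2 + 1) >= t. *)
    apply: ler_powRN => //; have := pi_ge2 R; nra.
  apply: (le_trans (HC _ _ _ _ x t0 bf b2)).
  by rewrite gt0_powRD// le_eqVlt; apply/orP; left; apply/eqP; ring.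
have [B B0 HB] : exists2 B : R, 0 <= B & forall t x, 0 < t -> `|heat_deriv I f t x| <= B * t `^ small_exp a I.
  case: I {C C0 HC decay} => [|i I].
    exists M => // t x t0; rewrite /heat_deriv t0 powRr0 mulr1; exact: heat_semigroup_bound.
  have [D D0 HD] := @iterD_semigroup_holder R n a (i :: I) a0 isT.
  exists (D * A) => [|t x t0]; first by rewrite mulr_ge0// ltW.
  by rewrite /heat_deriv t0 mulrAC; exact: HD t0 A0 bf hf.
exists B, (C * K); split => // [|t x t0]; first by rewrite mulr_ge0// ltW.
by split; [exact: HB|exact: decay].
Qed.

Lemma small_exp_gt (a s : R) I : 0 < s -> (size I)%:R < a + 2 * s -> 0 < small_exp a I + s.
Proof.
have aux (m : R) : m < a + 2 * s -> 0 < (a - m) / 2 + s by lra.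
by case: I => [|i I] s0; rewrite /small_exp; [rewrite add0r|exact: aux].
Qed.

Section fixed_exponents.
Variables (a s : R).
Hypotheses (a0 : 0 < a) (s0 : 0 < s) (sn : s < n%:R / 2).

Let decay_exp I : - ((size I)%:R / 2) - n%:R / 2 + s < 0.
Proof. by have m0 := ler0n R (size I); move: sn; lra. Qed.

Let Gs_gt0 : 0 < (Gamma s)^-1.
Proof. by rewrite invr_gt0 Gamma_gt0. Qed.

Section fixed_function.
Variables (M A K : R) (f : 'rV[R]_n -> R).
Hypotheses (bf : mbounded M f) (A0 : 0 <= A) (hf : holder_le a A f) (K0 : 0 <= K).
Hypothesis fK : forall z, `|f z| <= K * G 1 z.

Lemma integrable_heat_deriv I x : (size I)%:R < a + 2 * s ->
  mu.-integrable setT (fun t => (tpow (s - 1) t * heat_deriv I f t x)%:E).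
Proof.
move=> Is; have [B [C [B0 C0 H]]] := heat_deriv_bounds I a0 bf A0 hf K0 fK.
apply: (integrable_mellin (measurable_heat_deriv I x bf) B0 C0 (small_exp_gt s0 Is) (decay_exp I)).
  by move=> t t0; exact: (H t x t0).1.
by move=> t t0; exact: (H t x t0).2.
Qed.

Lemma riesz_deriv_bounded I : (size I)%:R < a + 2 * s ->
  exists N, forall x, `|riesz_deriv s I f x| <= N.
Proof.
move=> Is; have [B [C [B0 C0 H]]] := heat_deriv_bounds I a0 bf A0 hf K0 fK.
pose e : R := - ((size I)%:R / 2) - n%:R / 2.
exists ((Gamma s)^-1 * (B * (1 `^ (small_exp a I + s) / (small_exp a I + s)) +
  C * (1 `^ (e + s) / - (e + s)))) => x.
rewrite /riesz_deriv normrM (gtr0_norm Gs_gt0) ler_wpM2l ?(ltW Gs_gt0)//.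
apply: (mellin_le (measurable_heat_deriv I x bf) B0 C0 (small_exp_gt s0 Is) (decay_exp I) _ _ ltr01).
  by move=> t t0; exact: (H t x t0).1.
by move=> t t0; exact: (H t x t0).2.
Qed.

Lemma partial_riesz_deriv I i x : (size I).+1%:R < a + 2 * s ->
  derivable (riesz_deriv s I f) x (e_ i) /\
  partial i (riesz_deriv s I f) x = riesz_deriv s (i :: I) f x.
Proof.
move=> iIs; have Is : (size I)%:R < a + 2 * s.
  by apply: lt_trans iIs; rewrite ltr_nat.
have [B [C [B0 C0 H]]] := heat_deriv_bounds (i :: I) a0 bf A0 hf K0 fK.
(* The minimum of the bounds for small and for large t dominates the derivative uniformly in x and
   is integrable at both ends. *)
pose b (t : R) := Num.min (B * t `^ small_exp a (i :: I)) (C * t `^ (- ((size (i :: I))%:R / 2) - n%:R / 2)).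
have b0 t : 0 <= b t by rewrite /b le_min !mulr_ge0 ?powR_ge0.
have ib : mu.-integrable setT (fun t => (tpow (s - 1) t * b t)%:E).
  have mb : measurable_fun setT b.
    by apply: measurable_minr; apply: measurable_funM => //; exact: measurable_powR.
  have h1 t : 0 < t -> `|b t| <= B * t `^ small_exp a (i :: I).
    by move=> t0; rewrite ger0_norm// /b ge_min lexx.
  have h2 t : 0 < t -> `|b t| <= C * t `^ (- ((size (i :: I))%:R / 2) - n%:R / 2).
    by move=> t0; rewrite ger0_norm// /b ge_min lexx orbT.
  have hs : 0 < small_exp a (i :: I) + s by exact: small_exp_gt.
  exact: (integrable_mellin mb B0 C0 hs (decay_exp (i :: I)) h1 h2).
pose F (y : 'rV[R]_n) (t : R) := heat_deriv I f t y * tpow (s - 1) t.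
have dF t y : derivable (F ^~ t) y (e_ i) /\ 'D_(e_ i) (F ^~ t) y = heat_deriv (i :: I) f t y * tpow (s - 1) t.
  rewrite /F /heat_deriv; case: ifP => t0.
    have [D _ HD] := @iterD_semigroup R n I.
    have [_ dI _] := HD _ _ _ t0 bf.
    exact: (deriveMl (tpow (s - 1) t) (dI i y)).
  by under eq_fun do rewrite mul0r; rewrite mul0r; split; [exact: derivable_cst|exact: derive_cst].
have [|||| d1 d2] := @derivable_under R 'rV[R]_n _ _ mu F (fun t => tpow (s - 1) t * b t) x (e_ i).
- move=> h; have := integrable_heat_deriv (h *: e_ i + x) Is.
  by apply: eq_integrable => // t _; rewrite /= mulrC.
- by move=> h t _; exact: (dF t _).1.
- exact: ib.
- move=> h t _; rewrite (dF t _).2 normrM mulrC (ger0_norm (tpow_ge0 _ _)).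
  have [t0|t0] := ltP 0 t; last by rewrite /tpow ltNge t0/= !mul0r.
  rewrite ler_wpM2l ?tpow_ge0// /b le_min.
  by apply/andP; split; [exact: (H t _ t0).1|exact: (H t _ t0).2].
have E : riesz_deriv s I f = (Gamma s)^-1 \*: (fun y => \int[mu]_t F y t).
  apply/funext => y; rewrite /riesz_deriv /GRing.scale_fun/=; congr (_ * _).
  by apply: eq_Rintegral => t _; rewrite mulrC.
rewrite E /partial; split; first exact: derivableZ.
rewrite deriveZ// d2 /riesz_deriv; congr (_ * _); apply: eq_Rintegral => t _.
by rewrite (dF t _).2 mulrC.
Qed.

Lemma iterD_riesz I : (size I)%:R < a + 2 * s ->
  iterD I (riesz_deriv s [::] f) = riesz_deriv s I f.
Proof.
elim: I => //= i I IH iIs; rewrite IH; last by apply: lt_trans iIs; rewrite ltr_nat.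
by apply/funext => x; exact: (partial_riesz_deriv i x iIs).2.
Qed.

End fixed_function.

End fixed_exponents.

End RieszPotential.

(** By monotonicity the sum of the individual constants serves all indices at once; the added 1
    keeps it positive on an empty type. It makes constants independent of the word of directions. *)
Lemma uniform_constant (R : realType) (T : finType) (Q : T -> R -> Prop) :
  (forall i C D, C <= D -> Q i C -> Q i D) ->
  (forall i, exists2 C : R, 0 < C & Q i C) ->
  exists2 C : R, 0 < C & forall i, Q i C.
Proof.
move=> mQ /(_ _)/cid2 H.
exists (1 + \sum_i projT1 (H i)).
  rewrite ltr_wpDr// sumr_ge0// => i _.
  by rewrite ltW//; case: (H i).
move=> i; apply: (mQ _ (projT1 (H i))); last by case: (H i).
rewrite (bigD1 i)//= addrCA lerDl addr_ge0// sumr_ge0// => j _.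
by rewrite ltW//; case: (H j).
Qed.

(** * First and second differences of the potential and its derivatives *)

Section RieszDifferences.
Context {R : realType} {n : nat}.
Local Notation mu := (@lebesgue_measure R).
Implicit Types (x y h : 'rV[R]_n) (i : 'I_n) (I : seq 'I_n) (t M : R) (f : 'rV[R]_n -> R).
Local Notation e_ i := (delta_mx ord0 i : 'rV[R]_n).
Local Notation G := (@heat_kernel R n).
Local Notation P := (@heat_semigroup R n).
Local Notation iterD := (@Defs.iterD R n).

Local Opaque heat_kernel heat_semigroup.

Variables (a s : R).
Hypotheses (a0 : 0 < a) (s0 : 0 < s) (sn : s < n%:R / 2).

Let Gs_gt0 : 0 < (Gamma s)^-1.
Proof. by rewrite invr_gt0 Gamma_gt0. Qed.

(** Domination by [G 1] is all that is kept of compact support. *)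
Definition dominated (M A K : R) f := [/\ mbounded M f, 0 <= A, holder_le a A f, 0 <= K &
  forall z, `|f z| <= K * G 1 z].

Let heat_holder (m : nat) I : (0 < size I)%N -> size I = m -> exists2 E : R, 0 < E & forall M A K f t x,
  0 < t -> dominated M A K f ->
  `|iterD I (P t f) x| <= E * t `^ ((a - m%:R) / 2) * A.
Proof.
move=> I0 <-; have [E E0 HE] := @iterD_semigroup_holder R n a I a0 I0.
by exists E => // M A K f t x t0 [bf A0 hf _ _]; exact: HE t0 A0 bf hf.
Qed.

Let uniform_holder (m : nat) (T : finType) (F : T -> seq 'I_n) : (forall k, size (F k) = m.+1) ->
  exists2 E : R, 0 < E & forall k M A K f t x,
  0 < t -> dominated M A K f ->
  `|iterD (F k) (P t f) x| <= E * t `^ ((a - m.+1%:R) / 2) * A.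
Proof.
move=> sF; apply: (@uniform_constant R T (fun k E => forall M A K f t x,
  0 < t -> dominated M A K f ->
  `|iterD (F k) (P t f) x| <= E * t `^ ((a - m.+1%:R) / 2) * A)) => [k C D CD H|k].
  move=> M A K f t x t0 df; apply: le_trans (H M A K f t x t0 df) _.
  by case: df => _ A0 _ _ _; rewrite !ler_wpM2r ?powR_ge0.
by apply: heat_holder => //; rewrite sF.
Qed.

Lemma derivable_heat M I f t x i : 0 < t -> mbounded M f ->
  derivable (iterD I (P t f)) x (e_ i).
Proof.
move=> t0 bf; have [D _ HD] := @iterD_semigroup R n I.
by have [_ dI _] := HD _ _ _ t0 bf; exact: dI.
Qed.

Lemma riesz_first_difference I : (size I)%:R < a + 2 * s < (size I).+1%:R ->
  exists2 C : R, 0 < C & forall M A K f, dominated M A K f -> forall x y, x != y ->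
    `|riesz_deriv s I f x - riesz_deriv s I f y| <=
      C * A * enorm (x - y) `^ (a + 2 * s - (size I)%:R).
Proof.
move=> /andP[Is sI].
have [E E0 HE] := @uniform_holder (size I) 'I_n (fun i => i :: I) (fun=> erefl).
pose q := (a - (size I).+1%:R) / 2.
have qs : q + s < 0 by move: sI; rewrite /q; move: ((size I).+1%:R : R) => m; lra.
(* Small times. Without derivatives the Hoelder bound of P_t f is used (p = 0, e1 = a); otherwise
   the triangle inequality and the bound of D^I P_t f (p = (a - |I|)/2, e1 = 0). Both have the
   homogeneity that [mellin_scale] asks for. *)
have [p [e1 [B [B0 ps e1E HB]]]] : exists p e1 B : R, [/\ 0 < B, 0 < p + s,
    e1 + 2 * (p + s) = a + 2 * s - (size I)%:R &
    forall M A K f, dominated M A K f -> forall t x y, 0 < t ->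
      `|heat_deriv I f t x - heat_deriv I f t y| <= B * A * enorm (x - y) `^ e1 * t `^ p].
  case: I {HE q qs} Is sI => [|i I] Is sI.
    exists 0, a, 1; split => //; [by rewrite add0r|by rewrite subr0; ring|].
    move=> M A K f [bf A0 hf _ _] t x y t0; rewrite powRr0 mulr1 mul1r /heat_deriv t0.
    exact: heat_semigroup_holder t0 bf hf.
  have [D D0 HD] := @heat_holder (size (i :: I)) (i :: I) isT erefl.
  exists ((a - (size (i :: I))%:R) / 2), 0, (2 * D); split.
  - by rewrite mulr_gt0.
  - by move: Is; move: ((size (i :: I))%:R : R) => m; lra.
  - by field.
  - move=> M A K f df t x y t0; rewrite powRr0 mulr1 /heat_deriv t0.
    apply: le_trans (ler_normB _ _) _.
    have := HD M A K f t x t0 df; have := HD M A K f t y t0 df; lra.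
(* The factor n comes from [partial_lipschitz]; n + 1 keeps the constant positive without a case on
   n. *)
exists ((Gamma s)^-1 * (B / (p + s) + E * (n%:R + 1) / - (q + s))).
  rewrite mulr_gt0// addr_gt0// divr_gt0// ?mulr_gt0 ?oppr_gt0// ltr_wpDl//.
move=> M A K f df x y xy; have [bf A0 hf K0 fK] := df.
have d0 : 0 < enorm (x - y) by rewrite enorm_gt0// subr_eq0.
rewrite /riesz_deriv -mulrBr -RintegralB//; last 2 first.
- exact: (integrable_heat_deriv a0 s0 sn bf A0 hf K0 fK).
- exact: (integrable_heat_deriv a0 s0 sn bf A0 hf K0 fK).
rewrite normrM (gtr0_norm Gs_gt0) -!mulrA ler_wpM2l ?(ltW Gs_gt0)//.
under eq_Rintegral do rewrite -mulrBr.
have mw : measurable_fun setT (fun t => heat_deriv I f t x - heat_deriv I f t y).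
  by apply: measurable_funB; exact: measurable_heat_deriv bf.
have BA : 0 <= B * A by rewrite mulr_ge0 ?(ltW B0).
have EA : 0 <= E * A * n%:R by rewrite !mulr_ge0 ?(ltW E0).
apply: (le_trans (mellin_scale (e1 := e1) (e2 := 1) mw d0 BA EA ps qs _ _ _)).
- by rewrite e1E /q -natr1; field.
- by move=> t t0; exact: HB df _ _ _ t0.
- move=> t t0; rewrite /heat_deriv t0 powRr1 ?enorm_ge0//.
  have H := partial_lipschitz x y (fun i z => @derivable_heat M I f t z i t0 bf) (fun i z => HE i M A K f t z t0 df).
  by apply: le_trans H _; rewrite -/q le_eqVlt; apply/orP; left; apply/eqP; ring.
- rewrite e1E mulrA ler_wpM2r ?powR_ge0// mulrDl; apply: lerD.
    by rewrite mulrAC.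
  have k0 : 0 <= E * A * (- (q + s))^-1.
    by rewrite !mulr_ge0 ?(ltW E0)// invr_ge0 oppr_ge0 ltW.
  move: k0; move: (- (q + s))^-1 (n%:R : R) => k m k0.
  have -> : E * ((m + 1) * k) * A = E * A * m * k + E * A * k by ring.
  by rewrite lerDl.
Qed.

(** Using two more derivatives for large times widens the range of a + 2s by one unit and includes
    the integer |I| + 1, where the time integral in the first-difference bound would diverge. *)
Lemma riesz_second_difference I : (size I)%:R < a + 2 * s < (size I).+2%:R ->
  exists2 C : R, 0 < C & forall M A K f, dominated M A K f -> forall x h, h != 0 ->
    `|riesz_deriv s I f (x + h) + riesz_deriv s I f (x - h) - 2 * riesz_deriv s I f x| <=
      C * A * enorm h `^ (a + 2 * s - (size I)%:R).
Proof.
move=> /andP[Is sI].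
have [E E0 HE] := @uniform_holder (size I).+1 ('I_n * 'I_n)%type (fun ij => [:: ij.1, ij.2 & I]) (fun=> erefl).
pose q := (a - (size I).+2%:R) / 2.
have qs : q + s < 0 by move: sI; rewrite /q; move: ((size I).+2%:R : R) => m; lra.
pose dd (g : 'rV[R]_n -> R) x h := g (x + h) + g (x - h) - 2 * g x.
have [p [e1 [B [B0 ps e1E HB]]]] : exists p e1 B : R, [/\ 0 < B, 0 < p + s,
    e1 + 2 * (p + s) = a + 2 * s - (size I)%:R &
    forall M A K f, dominated M A K f -> forall t x h, 0 < t ->
      `|dd (heat_deriv I f t) x h| <= B * A * enorm h `^ e1 * t `^ p].
  case: I {HE q qs} Is sI => [|i I] Is sI.
    exists 0, a, 2; split => //; [by rewrite add0r|by rewrite subr0; ring|].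
    move=> M A K f [bf A0 hf _ _] t x h t0; rewrite powRr0 mulr1 /dd /heat_deriv t0.
    have h1 := heat_semigroup_holder (x + h) x t0 bf hf.
    have h2 := heat_semigroup_holder (x - h) x t0 bf hf.
    have E1 : x + h - x = h by rewrite addrC addKr.
    have E2 : enorm (x - h - x) = enorm h by rewrite addrC addKr enormN.
    rewrite E1 in h1; rewrite E2 in h2.
    move: h1 h2; change (iterD [::] (P t f)) with (P t f).
    move: (P t f (x + h)) (P t f (x - h)) (P t f x) (enorm h `^ a) => u v w d h1 h2.
    by rewrite !ler_norml in h1 h2 *; lra.
  have [D D0 HD] := @heat_holder (size (i :: I)) (i :: I) isT erefl.
  exists ((a - (size (i :: I))%:R) / 2), 0, (4 * D); split.
  - by rewrite mulr_gt0.
  - by move: Is; move: ((size (i :: I))%:R : R) => m; lra.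
  - by field.
  - move=> M A K f df t x h t0; rewrite powRr0 mulr1 /dd /heat_deriv t0.
    have := HD M A K f t (x + h) t0 df; have := HD M A K f t (x - h) t0 df.
    have := HD M A K f t x t0 df; move: (t `^ _) => r.
    move: (iterD _ _ (x + h)) (iterD _ _ (x - h)) (iterD _ _ x) => u v w.
    by rewrite !ler_norml; lra.
exists ((Gamma s)^-1 * (B / (p + s) + E * (n%:R ^+ 2 + 1) / - (q + s))).
  by rewrite mulr_gt0// addr_gt0// divr_gt0// ?mulr_gt0 ?oppr_gt0// ltr_wpDl// sqr_ge0.
move=> M A K f df x h h0; have [bf A0 hf K0 fK] := df.
have d0 := enorm_gt0 h0.
have iI y := integrable_heat_deriv a0 s0 sn bf A0 hf K0 fK y Is.
have -> : riesz_deriv s I f (x + h) + riesz_deriv s I f (x - h) - 2 * riesz_deriv s I f x =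
    (Gamma s)^-1 * \int[mu]_t (tpow (s - 1) t * dd (heat_deriv I f t) x h).
  have i1 : mu.-integrable setT (EFin \o (fun t => tpow (s - 1) t * heat_deriv I f t (x + h)
      + tpow (s - 1) t * heat_deriv I f t (x - h))).
    by have := integrableD measurableT (iI (x + h)) (iI (x - h)); apply: eq_integrable.
  have i2 : mu.-integrable setT (EFin \o (fun t => 2 * (tpow (s - 1) t * heat_deriv I f t x))).
    by apply: integrable_cstM; exact: iI.
  transitivity ((Gamma s)^-1 * \int[mu]_t (tpow (s - 1) t * heat_deriv I f t (x + h)
      + tpow (s - 1) t * heat_deriv I f t (x - h) - 2 * (tpow (s - 1) t * heat_deriv I f t x))).
    rewrite (RintegralB measurableT i1 i2) (RintegralD measurableT (iI (x + h)) (iI (x - h))).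
    rewrite (RintegralZl 2 measurableT (iI x)).
    by rewrite /riesz_deriv; ring.
  by congr (_ * _); apply: eq_Rintegral => t _; rewrite /dd; ring.
rewrite normrM (gtr0_norm Gs_gt0) -!mulrA ler_wpM2l ?(ltW Gs_gt0)//.
have mw : measurable_fun setT (fun t => dd (heat_deriv I f t) x h).
  apply: measurable_funB; last by apply: measurable_funM => //; exact: measurable_heat_deriv bf.
  by apply: measurable_funD; exact: measurable_heat_deriv bf.
have BA : 0 <= B * A by rewrite mulr_ge0 ?(ltW B0).
have EA : 0 <= E * A * n%:R ^+ 2 by rewrite !mulr_ge0 ?(ltW E0) ?sqr_ge0.
apply: (le_trans (mellin_scale (e1 := e1) (e2 := 2) mw d0 BA EA ps qs _ _ _)).
- by rewrite e1E /q -!natr1; field.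
- by move=> t t0; exact: HB df _ _ _ t0.
- move=> t t0; rewrite /heat_deriv t0 powR_mulrn ?enorm_ge0//.
  have H := second_difference_le x h (fun i z => @derivable_heat M I f t z i t0 bf)
    (fun i j z => @derivable_heat M (i :: I) f t z j t0 bf) (fun i j z => HE (j, i) M A K f t z t0 df).
  by apply: le_trans H _; rewrite -/q le_eqVlt; apply/orP; left; apply/eqP; ring.
- rewrite e1E mulrA ler_wpM2r ?powR_ge0// mulrDl; apply: lerD.
    by rewrite mulrAC.
  have k0 : 0 <= E * A * (- (q + s))^-1.
    by rewrite !mulr_ge0 ?(ltW E0)// invr_ge0 oppr_ge0 ltW.
  move: k0; move: (- (q + s))^-1 (n%:R ^+ 2 : R) => k m k0.
  have -> : E * ((m + 1) * k) * A = E * A * m * k + E * A * k by ring.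
  by rewrite lerDl.
Qed.

End RieszDifferences.

(** * Schauder estimates *)

Section NormBounds.
Context {R : realType} {n : nat}.
Implicit Types (x y h : 'rV[R]_n) (i : 'I_n) (I : seq 'I_n) (u : 'rV[R]_n -> R).
Local Notation iterD := (@Defs.iterD R n).

Lemma sup_norm_le u (c : R) : (forall x, `|u x| <= c) -> (sup_norm u <= c%:E)%E.
Proof. by move=> uc; apply: ge_ereal_sup => _ [x _ <-]; rewrite lee_fin. Qed.

Lemma holder_seminorm_le (b : R) u (c : R) :
  (forall x y, x != y -> `|u x - u y| <= c * enorm (x - y) `^ b) ->
  (holder_seminorm b u <= c%:E)%E.
Proof.
move=> uc; apply: ge_ereal_sup => _ [[x y] /= xy <-]; rewrite lee_fin.
by rewrite ler_pdivrMr ?uc// powR_gt0// enorm_gt0// subr_eq0.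
Qed.

Lemma zygmund_seminorm_le u (c : R) :
  (forall x h, h != 0 -> `|u (x + h) + u (x - h) - 2 * u x| <= c * enorm h) ->
  (zygmund_seminorm u <= c%:E)%E.
Proof.
move=> uc; apply: ge_ereal_sup => _ [[x h] /= h0 <-]; rewrite lee_fin.
by rewrite ler_pdivrMr ?uc// enorm_gt0.
Qed.

Lemma C_norm_le k u (c : R) : 0 <= c ->
  (forall I, (size I <= k)%N -> forall x, `|iterD I u x| <= c) ->
  (C_norm k u <= (k.+1%:R * c)%:E)%E.
Proof.
move=> c0 uc; rewrite /C_norm.
apply: (@le_trans _ _ (\sum_(j < k.+1) c%:E)%E); last first.
  by rewrite sumEFin lee_fin sumr_const card_ord mulr_natl.
apply: lee_sum => j _; apply: bigmax_le; first by rewrite lee_fin.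
move=> I _; apply: sup_norm_le; apply: uc.
by rewrite size_tuple -ltnS.
Qed.

Lemma bigmax_tuple_le k (F : seq 'I_n -> \bar R) (c : R) : 0 <= c ->
  (forall I, size I = k -> (F I <= c%:E)%E) ->
  (\big[maxe/0]_(I : k.-tuple 'I_n) F I <= c%:E)%E.
Proof.
move=> c0 Fc; apply: bigmax_le => [|I _]; first by rewrite lee_fin.
by apply: Fc; rewrite size_tuple.
Qed.

Lemma holder_continuous u (b c : R) : 0 < b ->
  (forall x y, x != y -> `|u x - u y| <= c * enorm (x - y) `^ b) -> continuous u.
Proof.
move=> b0 uc x; apply/(@cvgrPdist_le _ _ _ (nbhs x) (nbhs_filter x)) => e e0.
pose c1 := `|c| + 1; have c10 : 0 < c1 by rewrite /c1; have := normr_ge0 c; lra.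
pose d := (e / c1) `^ b^-1 / (n%:R + 1).
have d0 : 0 < d by rewrite divr_gt0 ?powR_gt0 ?divr_gt0// ltr_wpDl.
apply/nbhs_ballP; exists d => //= y; rewrite mx_norm_ball /ball_/= => xy.
have [->|nxy] := eqVneq x y; first by rewrite subrr normr0 ltW.
have h : enorm (x - y) <= (e / c1) `^ b^-1.
  apply: le_trans (enorm_le_norm _) _.
  apply: (@le_trans _ _ ((n%:R + 1) * d)); last by rewrite /d mulrC divfK// gt_eqF// ltr_wpDl.
  by apply: ler_pM; rewrite ?lerDl// ltW.
have h2 : enorm (x - y) `^ b <= e / c1.
  have -> : e / c1 = ((e / c1) `^ b^-1) `^ b.
    by rewrite -powRrM mulVf ?gt_eqF// powRr1// divr_ge0 ?ltW.
  by apply: ge0_ler_powR; rewrite ?nnegrE ?enorm_ge0 ?powR_ge0// ltW.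
apply: le_trans (uc _ _ nxy) _.
apply: (@le_trans _ _ (c1 * (e / c1))); last by rewrite mulrC divfK// gt_eqF.
apply: (@le_trans _ _ (c1 * enorm (x - y) `^ b)); last by rewrite ler_wpM2l// ltW.
by rewrite ler_wpM2r ?powR_ge0// /c1; have := ler_norm c; lra.
Qed.

End NormBounds.

(** * Interpolation, continuity and Hoelder norms of the potential *)

Section RieszRegularity.
Context {R : realType} {n : nat}.
Implicit Types (x y h : 'rV[R]_n) (i : 'I_n) (I : seq 'I_n) (f : 'rV[R]_n -> R).
Local Notation e_ i := (delta_mx ord0 i : 'rV[R]_n).
Local Notation iterD := (@Defs.iterD R n).

Local Opaque heat_kernel heat_semigroup riesz_deriv.

(** Distances up to 1 use the old exponent, larger ones the sup bound, whence 2 M. As the new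
    constant contains M, lowering the exponent is reserved for qualitative statements. *)
Lemma dominated_lower (a b M A K : R) f : 0 < b <= a -> dominated a M A K f ->
  dominated b M (A + 2 * M) K f.
Proof.
move=> /andP[b0 ba] [bf A0 hf K0 fK]; have M0 := mbounded_ge0 bf.
split => //; first by lra.
move=> x y; have [d1|d1] := leP (enorm (x - y)) 1.
  apply: le_trans (hf x y) _.
  have [d0|d0] := eqVneq (enorm (x - y)) 0.
    by rewrite d0 !powR0 ?gt_eqF ?mulr0//; apply: lt_le_trans ba.
  have d00 : 0 < enorm (x - y) by rewrite lt_neqAle eq_sym d0 enorm_ge0.
  apply: ler_pM; rewrite ?powR_ge0//; first lra.
  by apply: ger_powR; rewrite ?d00.
have h1 : 1 <= enorm (x - y) `^ b.
  by rewrite -(powRr0 (enorm (x - y))); apply: ler_powR; rewrite ltW.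
have := bf.2 x; have := bf.2 y; move: (f x) (f y) (enorm _ `^ b) h1 => p q d h1 hq hp.
apply: (@le_trans _ _ (2 * M)); first by rewrite !ler_norml in hp hq *; lra.
nra.
Qed.

Variables (s : R).
Hypotheses (s0 : 0 < s) (sn : s < n%:R / 2).

(** Induction on the word: [partial_interpolation] bounds a derivative by the function it
    differentiates and its own second differences with steps at most 1. The condition a + 2s < 3
    puts every nonempty word in the range of [riesz_second_difference]. *)
Lemma riesz_deriv_interpolation (a : R) I : 0 < a -> (size I)%:R < a + 2 * s -> a + 2 * s < 3 ->
  exists2 C : R, 0 < C & forall M A K f L, dominated a M A K f ->
    (forall x, `|riesz_deriv s [::] f x| <= L) ->
    forall x, `|riesz_deriv s I f x| <= L + C * A.
Proof.
move=> a0 + a3; elim: I => [_|i I IH iIs].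
  exists 1 => // M A K f L [_ A0 _ _ _] fL x; rewrite mul1r.
  by apply: le_trans (fL x) _; rewrite lerDl.
have [|C C0 HC] := IH; first by apply: lt_trans iIs; rewrite ltr_nat.
have [|D D0 HD] := @riesz_second_difference R n a s a0 s0 sn (i :: I).
  rewrite iIs/=; apply: lt_le_trans a3 _.
  by rewrite ler_nat.
exists (C + D / 2); first by rewrite addr_gt0// divr_gt0.
move=> M A K f L df fL x; have [bf A0 hf K0 fK] := df.
have pd y := partial_riesz_deriv a0 s0 sn bf A0 hf K0 fK i y iIs.
rewrite -(pd x).2 mulrDl addrA (_ : D / 2 * A = (D * A) / 2); last by ring.
apply: partial_interpolation.
- by move=> y; exact: (pd y).1.
- by move=> y; exact: HC df fL y.
- move=> r /andP[r0 r1]; rewrite !(pd _).2.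
  have [->|rn0] := eqVneq r 0.
    rewrite scale0r addr0 subr0 (_ : _ - _ = 0); last by ring.
    by rewrite normr0; apply: mulr_ge0 => //; exact: ltW.
  have hn0 : r *: e_ i != 0.
    by rewrite scaler_eq0 negb_or rn0/= -normr_eq0 gt_eqF// (lt_le_trans ltr01)//; have := coord_le_norm (e_ i) i; rewrite mxE !eqxx normr1.
  apply: le_trans (HD M A K f df x _ hn0) _.
  rewrite ler_piMr ?mulr_ge0 ?(ltW D0)// enormZ enorm_delta mulr1 ger0_norm//.
  have e1 : (1 : R) `^ (a + 2 * s - (size (i :: I))%:R) = 1 by rewrite powR1.
  rewrite -[leRHS]e1.
  by apply: ge0_ler_powR; rewrite ?nnegrE// subr_ge0 ltW.
Qed.

(** Either the derivatives of one order more are bounded, which gives a Lipschitz bound, or the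
    Hoelder exponent is lowered to land strictly between |I| and |I| + 1; this also covers a + 2s =
    |I| + 1. *)
Lemma continuous_riesz_deriv (a M A K : R) f I : 0 < a -> dominated a M A K f ->
  (size I)%:R < a + 2 * s -> continuous (riesz_deriv s I f).
Proof.
move=> a0 df Is; have [bf A0 hf K0 fK] := df.
have [Is1|Is1] := ltP (size I).+1%:R (a + 2 * s).
  have h i := riesz_deriv_bounded a0 s0 sn bf A0 hf K0 fK (I := i :: I) Is1.
  have [N N0 HN] : exists2 N : R, 0 < N & forall i x, `|riesz_deriv s (i :: I) f x| <= N.
    apply: (@uniform_constant R _ (fun i N => forall x, `|riesz_deriv s (i :: I) f x| <= N)).
      by move=> i C D CD H x; exact: le_trans (H x) CD.
    move=> i; have [N HN] := h i; exists (`|N| + 1); first by have := normr_ge0 N; lra.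
    by move=> x; apply: le_trans (HN x) _; have := ler_norm N; lra.
  apply: (@lipschitz_continuous _ _ _ (N * n%:R)) => x y; rewrite -mulrA.
  have pd i z := partial_riesz_deriv a0 s0 sn bf A0 hf K0 fK i z Is1.
  apply: partial_lipschitz => i z; first exact: (pd i z).1.
  by rewrite (pd i z).2.
(* The infimum of the exponents b > 0 with b + 2s > |I|; the midpoint of m0 and a is then admissible
   and smaller than a. *)
pose m0 : R := Num.max 0 ((size I)%:R - 2 * s).
have m0a : m0 < a by rewrite /m0 gt_max a0/=; move: ((size I)%:R : R) Is => m; lra.
have m00 : 0 <= m0 by rewrite /m0 le_max lexx.
have m01 : (size I)%:R - 2 * s <= m0 by rewrite /m0 le_max lexx orbT.
pose b := (m0 + a) / 2.
have b0 : 0 < b by rewrite /b; lra.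
have ba : b < a by rewrite /b; lra.
have bI : (size I)%:R < b + 2 * s < (size I).+1%:R.
  apply/andP; split; last by apply: lt_le_trans Is1; lra.
  by move: m01 Is; rewrite /b; move: ((size I)%:R : R) => m; lra.
have [C C0 HC] := riesz_first_difference b0 s0 sn bI.
have bab : 0 < b <= a by rewrite b0 ltW.
apply: (holder_continuous (b := b + 2 * s - (size I)%:R)).
  by rewrite subr_gt0; case/andP: bI.
exact: HC _ _ _ _ (dominated_lower bab df).
Qed.

Lemma in_C_riesz (a M A K : R) f k : 0 < a -> dominated a M A K f ->
  k%:R < a + 2 * s -> in_C k (riesz_deriv s [::] f).
Proof.
move=> a0 df ks I Ik; have [bf A0 hf K0 fK] := df.
have Is : (size I)%:R < a + 2 * s by apply: le_lt_trans ks; rewrite ler_nat.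
rewrite (iterD_riesz a0 s0 sn bf A0 hf K0 fK Is); split.
- exact: continuous_riesz_deriv df Is.
- have [N HN] := riesz_deriv_bounded a0 s0 sn bf A0 hf K0 fK Is.
  exists N; split; first exact: num_real.
  by move=> r Nr x _ /=; apply: le_trans (HN x) (ltW Nr).
- move=> Ik' i x; apply: (partial_riesz_deriv a0 s0 sn bf A0 hf K0 fK i x _).1.
  by apply: le_lt_trans ks; rewrite ler_nat.
Qed.

Lemma in_Ch_riesz (a M A K : R) f k : 0 < a -> dominated a M A K f ->
  k%:R < a + 2 * s < k.+1%:R -> in_Ch k (a + 2 * s - k%:R) (riesz_deriv s [::] f).
Proof.
move=> a0 df ks; have [bf A0 hf K0 fK] := df.
have [ks1 ks2] := andP ks; split; first exact: in_C_riesz df ks1.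
move=> I; have sI := size_tuple I.
have Is : (size I)%:R < a + 2 * s < (size I).+1%:R by rewrite sI.
have [C C0 HC] := riesz_first_difference a0 s0 sn Is.
rewrite (iterD_riesz a0 s0 sn bf A0 hf K0 fK); last by case/andP: Is.
apply: (@le_lt_trans _ _ (C * A)%:E); last exact: ltry.
by apply: holder_seminorm_le => x y xy; have := HC M A K f df x y xy; rewrite sI.
Qed.

Lemma Ch_norm_riesz (a : R) k : 0 < a -> k%:R < a + 2 * s < k.+1%:R -> a + 2 * s < 3 ->
  exists2 C : R, 0 < C & forall M A K f L, dominated a M A K f -> 0 <= L ->
    (forall x, `|riesz_deriv s [::] f x| <= L) ->
    (Ch_norm k (a + 2 * s - k%:R) (riesz_deriv s [::] f) <= (C * (L + A))%:E)%E.
Proof.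
move=> a0 ks a3; have [ks1 ks2] := andP ks.
(* The words of length at most k form a finite type, so one constant serves them all. *)
have [E E0 HE] : exists2 E : R, 0 < E & forall I : {j : 'I_k.+1 & j.-tuple 'I_n},
   forall M A K f L, dominated a M A K f ->
    (forall x, `|riesz_deriv s [::] f x| <= L) ->
    forall x, `|riesz_deriv s (tagged I) f x| <= L + E * A.
  apply: (@uniform_constant R _ (fun (I : {j : 'I_k.+1 & j.-tuple 'I_n}) E => forall M A K f L, dominated a M A K f ->
    (forall x, `|riesz_deriv s [::] f x| <= L) ->
    forall x, `|riesz_deriv s (tagged I) f x| <= L + E * A)).
    move=> I C D CD H M A K f L df fL x; apply: le_trans (H M A K f L df fL x) _.
    by case: df => _ A0 _ _ _; rewrite lerD2l ler_wpM2r.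
  move=> [j I]; apply: riesz_deriv_interpolation => //=.
  by rewrite size_tuple; apply: le_lt_trans ks1; rewrite ler_nat -ltnS.
have [D D0 HD] : exists2 D : R, 0 < D & forall I : k.-tuple 'I_n,
   forall M A K f, dominated a M A K f -> forall x y, x != y ->
    `|riesz_deriv s I f x - riesz_deriv s I f y| <= D * A * enorm (x - y) `^ (a + 2 * s - k%:R).
  apply: (@uniform_constant R _ (fun (I : k.-tuple 'I_n) D => forall M A K f, dominated a M A K f -> forall x y, x != y ->
    `|riesz_deriv s I f x - riesz_deriv s I f y| <= D * A * enorm (x - y) `^ (a + 2 * s - k%:R))).
    move=> I C D CD H M A K f df x y xy; apply: le_trans (H M A K f df x y xy) _.
    by case: df => _ A0 _ _ _; rewrite ler_wpM2r ?powR_ge0// ler_wpM2r.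
  move=> I; have Is : (size I)%:R < a + 2 * s < (size I).+1%:R by rewrite size_tuple.
  have [C C0 HC] := riesz_first_difference a0 s0 sn Is; exists C => //.
  by move: HC; rewrite size_tuple.
(* [C_norm] is a sum of k + 1 maxima, each at most L + E A; D accounts for the Hoelder part. *)
exists (k.+1%:R * (1 + E) + D); first by rewrite addr_gt0// mulr_gt0// addr_gt0.
move=> M A K f L df L0 fL; have [bf A0 hf K0 fK] := df.
have LA : 0 <= L + E * A by rewrite addr_ge0// mulr_ge0// ltW.
have DA : 0 <= D * A by rewrite mulr_ge0// ltW.
have iD I : (size I <= k)%N -> iterD I (riesz_deriv s [::] f) = riesz_deriv s I f.
  move=> Ik; apply: (iterD_riesz a0 s0 sn bf A0 hf K0 fK).
  by apply: le_lt_trans ks1; rewrite ler_nat.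
apply: (@le_trans _ _ ((k.+1%:R * (L + E * A))%:E + (D * A)%:E)%E).
  apply: leeD.
    apply: C_norm_le => // I Ik x; rewrite iD//.
    have Ik' : (size I < k.+1)%N by [].
    exact: (HE (existT _ (Ordinal Ik') (in_tuple I)) M A K f L df fL x).
  apply: (bigmax_tuple_le (F := fun I => holder_seminorm _ (iterD I _))) => // I sI.
  rewrite iD ?sI//; apply: holder_seminorm_le => x y xy.
  have e : size I == k by rewrite sI.
  exact: (HD (Tuple e) M A K f df x y xy).
rewrite -EFinD lee_fin.
have k0 : 0 <= k.+1%:R :> R by [].
move: (k.+1%:R : R) k0 => m m0.
have h1 : 0 <= m * A by rewrite mulr_ge0.
have h2 : 0 <= m * E * L by rewrite !mulr_ge0// ltW.
have h3 : 0 <= D * L by rewrite mulr_ge0// ltW.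
rewrite (_ : (m * (1 + E) + D) * (L + A) = m * (L + E * A) + D * A + (m * A + m * E * L + D * L)); last by ring.
by rewrite lerDl !addr_ge0.
Qed.

End RieszRegularity.

(** * The integer case: Zygmund norms *)

Section RieszZygmund.
Context {R : realType} {n : nat}.
Implicit Types (x y h : 'rV[R]_n) (i : 'I_n) (I : seq 'I_n) (f : 'rV[R]_n -> R).
Local Notation iterD := (@Defs.iterD R n).

Local Opaque heat_kernel heat_semigroup riesz_deriv.

Variables (s : R).
Hypotheses (s0 : 0 < s) (sn : s < n%:R / 2).

Lemma Linfty_norm_riesz (a M A K : R) f I : 0 < a -> dominated a M A K f ->
  (size I)%:R < a + 2 * s -> in_Linfty (riesz_deriv s I f).
Proof.
move=> a0 df Is; have [bf A0 hf K0 fK] := df; split.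
  by apply: measurable_rvec; exact: continuous_riesz_deriv df Is.
have [N HN] := riesz_deriv_bounded a0 s0 sn bf A0 hf K0 fK Is.
apply: (@le_lt_trans _ _ `|N|%:E); last exact: ltry.
by apply: Linfty_norm_le => // x; apply: le_trans (HN x) _; exact: ler_norm.
Qed.

(** Here a + 2s - |I| = 1, so the second-difference estimate is linear in |h|. *)
Lemma zygmund_seminorm_riesz (a : R) I : 0 < a -> a + 2 * s = (size I).+1%:R ->
  exists2 C : R, 0 < C & forall M A K f, dominated a M A K f ->
    (zygmund_seminorm (riesz_deriv s I f) <= (C * A)%:E)%E.
Proof.
move=> a0 aI.
have Is : (size I)%:R < a + 2 * s < (size I).+2%:R by rewrite aI !ltr_nat !ltnSn.
have [C C0 HC] := riesz_second_difference a0 s0 sn Is.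
exists C => // M A K f df; apply: zygmund_seminorm_le => x h h0.
have := HC M A K f df x h h0.
have E : (size I).+1%:R - (size I)%:R = 1 :> R by rewrite -natr1; ring.
by rewrite aI E powRr1 ?enorm_ge0.
Qed.

Lemma in_zygmund_riesz (a M A K : R) f k : 0 < a -> dominated a M A K f ->
  (0 < k)%N -> a + 2 * s = k%:R -> in_zygmund k (riesz_deriv s [::] f).
Proof.
move=> a0 df; case: k => // k _ ak; have [bf A0 hf K0 fK] := df.
have zI I : size I = k -> in_zygmund1 (riesz_deriv s I f).
  move=> sI; rewrite -sI in ak.
  have Is : (size I)%:R < a + 2 * s by rewrite ak ltr_nat.
  split; first exact: Linfty_norm_riesz df Is.
  have [C C0 HC] := zygmund_seminorm_riesz a0 ak.
  by apply: le_lt_trans (HC M A K f df) _; exact: ltry.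
case: k ak zI => [|k] ak zI; first exact: zI.
split; first by apply: (in_C_riesz s0 sn a0 df); rewrite ak ltr_nat.
move=> I; rewrite (iterD_riesz a0 s0 sn bf A0 hf K0 fK).
  by apply: zI; rewrite size_tuple.
by rewrite size_tuple ak ltr_nat.
Qed.

Lemma zygmund_norm_riesz (a : R) k : 0 < a -> (0 < k < 3)%N -> a + 2 * s = k%:R ->
  exists2 C : R, 0 < C & forall M A K f L, dominated a M A K f -> 0 <= L ->
    (forall x, `|riesz_deriv s [::] f x| <= L) ->
    (zygmund_norm k (riesz_deriv s [::] f) <= (C * (L + A))%:E)%E.
Proof.
move=> a0; case: k => [|[|[|k]]]// _ ak.
  have [C C0 HC] := zygmund_seminorm_riesz a0 (I := [::]) ak.
  exists (C + 1); first by rewrite addr_gt0.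
  move=> M A K f L df L0 fL; have [_ A0 _ _ _] := df.
  apply: (@le_trans _ _ (L%:E + (C * A)%:E)%E).
    by apply: leeD; [exact: Linfty_norm_le|exact: HC df].
  rewrite -EFinD lee_fin; have : 0 <= C * L by rewrite mulr_ge0// ltW.
  by lra.
have a3 : a + 2 * s < 3 by rewrite ak ltr_nat.
have ss I : size I = 1%N -> (size I)%:R < a + 2 * s by move=> ->; rewrite ak ltr_nat.
have [E E0 HE] : exists2 E : R, 0 < E & forall i,
   forall M A K f L, dominated a M A K f ->
    (forall x, `|riesz_deriv s [::] f x| <= L) ->
    (forall x, `|riesz_deriv s [:: i] f x| <= L + E * A) /\
    (zygmund_seminorm (riesz_deriv s [:: i] f) <= (E * A)%:E)%E.
  apply: (@uniform_constant R _ (fun i E => forall M A K f L, dominated a M A K f ->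
    (forall x, `|riesz_deriv s [::] f x| <= L) ->
    (forall x, `|riesz_deriv s [:: i] f x| <= L + E * A) /\
    (zygmund_seminorm (riesz_deriv s [:: i] f) <= (E * A)%:E)%E)).
    move=> i C D CD H M A K f L df fL; have [_ A0 _ _ _] := df.
    have [h1 h2] := H M A K f L df fL; split.
      by move=> x; apply: le_trans (h1 x) _; rewrite lerD2l ler_wpM2r.
    by apply: le_trans h2 _; rewrite lee_fin ler_wpM2r.
  move=> i; have [C C0 HC] := riesz_deriv_interpolation s0 sn a0 (ss [:: i] erefl) a3.
  have [D D0 HD] := zygmund_seminorm_riesz a0 (I := [:: i]) ak.
  exists (C + D); first by rewrite addr_gt0.
  move=> M A K f L df fL; have [_ A0 _ _ _] := df; split.
    move=> x; apply: le_trans (HC M A K f L df fL x) _.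
    by rewrite lerD2l ler_wpM2r// lerDl ltW.
  by apply: le_trans (HD M A K f df) _; rewrite lee_fin ler_wpM2r// lerDr ltW.
exists (2 + 3 * E); first by rewrite addr_gt0// mulr_gt0.
move=> M A K f L df L0 fL; have [bf A0 hf K0 fK] := df.
have EA : 0 <= E * A by rewrite mulr_ge0// ltW.
have LA : 0 <= L + E * A by rewrite addr_ge0.
have iD i : iterD [:: i] (riesz_deriv s [::] f) = riesz_deriv s [:: i] f.
  by rewrite (iterD_riesz a0 s0 sn bf A0 hf K0 fK)// ss.
apply: (@le_trans _ _ ((2%:R * (L + E * A))%:E + (E * A)%:E)%E).
  apply: leeD.
    apply: C_norm_le => // -[|i [|//]] _ x.
      by apply: le_trans (fL x) _; rewrite lerDl.
    by rewrite iD; exact: (HE i M A K f L df fL).1.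
  apply: (bigmax_tuple_le (F := fun I => zygmund_seminorm (iterD I _))) => // -[|i [|//]]// _.
  by rewrite iD; exact: (HE i M A K f L df fL).2.
rewrite -EFinD lee_fin.
have : 0 <= E * L by rewrite mulr_ge0// ltW.
lra.
Qed.

End RieszZygmund.

Section HolderData.
Context {R : realType} {n : nat}.
Implicit Types (f : 'rV[R]_n -> R).

(** A is the real number behind the Hoelder seminorm, hence at most the full norm; M comes from
    boundedness and K from the support. *)
Lemma dominated_of_in_Ch (a : R) f : 0 < a -> in_Ch 0 a f -> compactly_supported f ->
  exists M A K : R, dominated a M A K f /\ (A%:E <= Ch_norm 0 a f)%E.
Proof.
move=> a0 [cf hf] sf; have [f1 [N [_ HN]] _] := cf [::] (leqnn 0).
(* [bounded_fun] provides every bound strictly above N, hence |N| + 1. *)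
have bf : mbounded (`|N| + 1) f.
  apply: continuous_mbounded f1 _ => x; apply: (HN (`|N| + 1)) => //.
  by have := ler_norm N; lra.
pose H := (\big[maxe/0%E]_(I : 0.-tuple 'I_n) holder_seminorm a (Defs.iterD I f))%E.
have H0 : (0 <= H)%E by exact: bigmax_ge_id.
have Hoo : (H < +oo)%E by apply: bigmax_lt => // I _; exact: hf.
have Hfin : H \is a fin_num by rewrite ge0_fin_numE.
have hH : (holder_seminorm a f <= H)%E.
  exact: (le_bigmax _ (fun I : 0.-tuple 'I_n => holder_seminorm a (Defs.iterD I f)) [tuple]).
have hol : holder_le a (fine H) f.
  move=> x y; have [->|xy] := eqVneq x y.
    by rewrite !subrr normr0 mulr_ge0 ?fine_ge0 ?powR_ge0.
  rewrite -ler_pdivrMr ?powR_gt0 ?enorm_gt0 ?subr_eq0// -lee_fin fineK//.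
  by apply: le_trans hH; apply: ereal_sup_ubound; exists (x, y).
have [K K0 fK] := compact_support_le_kernel bf sf.
exists (`|N| + 1), (fine H), K; split; first by split => //; exact: fine_ge0.
rewrite fineK// /Ch_norm -/H leeDr//.
by apply: sume_ge0 => j _; exact: bigmax_ge_id.
Qed.

End HolderData.

Section SchauderEstimates.
Context {R : realType} {n : nat}.

Local Opaque heat_kernel heat_semigroup riesz_deriv.

(** Shared ending of the Hoelder and Zygmund cases: by continuity of u its essential norm is a
    pointwise bound, and can be taken for L. *)
Lemma estimate_of_dominated (Q : ('rV[R]_n -> R) -> Prop) (F : ('rV[R]_n -> R) -> \bar R)
  (s a C : R) : 0 < a -> 0 < s -> s < n%:R / 2 -> 0 < C ->
  (forall M A K f, dominated a M A K f -> Q (riesz_deriv s [::] f)) ->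
  (forall M A K f L, dominated a M A K f -> 0 <= L ->
    (forall x, `|riesz_deriv s [::] f x| <= L) ->
    (F (riesz_deriv s [::] f) <= (C * (L + A))%:E)%E) ->
  forall f, in_Ch 0 a f -> compactly_supported f ->
    Q (inv_frac_laplacian s f) /\
    (F (inv_frac_laplacian s f) <= C%:E * (Linfty_norm (inv_frac_laplacian s f) + Ch_norm 0 a f))%E.
Proof.
move=> a0 s0 sn C0 HQ HF f cf sf; rewrite inv_frac_laplacianE.
have [M [A [K [df Af]]]] := dominated_of_in_Ch a0 cf sf.
split; first exact: HQ df.
have Is : (size ([::] : seq 'I_n))%:R < a + 2 * s by rewrite addr_gt0// mulr_gt0.
have cu := continuous_riesz_deriv s0 sn a0 df Is.
have [_ Loo] := Linfty_norm_riesz s0 sn a0 df Is.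
set u := riesz_deriv s [::] f in cu Loo *.
have L0 : (0 <= Linfty_norm u)%E by exact: Lnorm_ge0.
have Lfin : Linfty_norm u \is a fin_num by rewrite ge0_fin_numE.
apply: le_trans (HF M A K f (fine (Linfty_norm u)) df _ _) _.
- exact: fine_ge0.
- by move=> x; rewrite -lee_fin fineK//; exact: Linfty_norm_ge.
- by rewrite EFinM EFinD fineK// lee_pmul2l// leeD2l.
Qed.

(** The exponents are fixed before C, so a + 2s lies in a single regime: one constant is needed, and
    the items of the other regimes are vacuous. *)
Lemma schauder_estimates (s a : R) (a0 : 0 < a) (s0 : 0 < s) (s1 : s < 1) (a1 : a <= 1)
    (sn : s < n%:R / 2) :
  exists C : R, 0 < C /\
    forall f : 'rV[R]_n -> R, in_Ch 0 a f -> compactly_supported f ->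
    let u := inv_frac_laplacian s f in
    let bound := (C%:E * (Linfty_norm u + Ch_norm 0 a f))%E in
    [/\ a + 2 * s < 1 ->
          in_Ch 0 (a + 2 * s) u /\
          (Ch_norm 0 (a + 2 * s) u <= bound)%E,
        1 < a + 2 * s < 2 ->
          in_Ch 1 (a + 2 * s - 1) u /\
          (Ch_norm 1 (a + 2 * s - 1) u <= bound)%E,
        2 < a + 2 * s < 3 ->
          in_Ch 2 (a + 2 * s - 2) u /\
          (Ch_norm 2 (a + 2 * s - 2) u <= bound)%E &
        forall k : nat, k = 1%N \/ k = 2%N -> a + 2 * s = k%:R ->
          in_zygmund k u /\ (zygmund_norm k u <= bound)%E].
Proof.
have as0 : 0 < a + 2 * s by rewrite addr_gt0// mulr_gt0.
have [[k ks]|] := pselect (exists k : nat, a + 2 * s = k%:R).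
  have k0 : (0 < k)%N by rewrite -(ltr_nat R) -ks.
  have k3 : (k < 3)%N by rewrite -(ltr_nat R) -ks; lra.
  have [|C C0 HC] := zygmund_norm_riesz s0 sn a0 (k := k) _ ks; first by rewrite k0.
  have H := estimate_of_dominated a0 s0 sn C0 (fun M A K f df => in_zygmund_riesz s0 sn a0 df k0 ks) HC.
  have nk (m l : nat) : m%:R < a + 2 * s < l%:R -> (m < k < l)%N by rewrite ks !ltr_nat.
  exists C; split => // f cf sf u bound; split.
  - by move=> h; have := nk 0%N 1%N; rewrite as0 h => /(_ isT); lia.
  - by move=> /(nk 1%N 2%N); lia.
  - by move=> /(nk 2%N 3%N); lia.
  - move=> l _ lk; have -> : l = k by apply/eqP; rewrite -(eqr_nat R) -lk ks.
    exact: H.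
move=> nk.
have [k ks] : exists k : nat, k%:R < a + 2 * s < k.+1%:R.
  exists (Num.truncn (a + 2 * s)); have := truncn_itv (ltW as0) => /andP[h1 h2].
  rewrite h2 andbT lt_neqAle h1 andbT; apply/eqP => h; apply: nk.
  by exists (Num.truncn (a + 2 * s)).
have a3 : a + 2 * s < 3 by lra.
have [C C0 HC] := Ch_norm_riesz s0 sn a0 ks a3.
have H := estimate_of_dominated a0 s0 sn C0 (fun M A K f df => in_Ch_riesz s0 sn a0 df ks) HC.
have uk (m : nat) : m%:R < a + 2 * s < m.+1%:R -> k = m.
  move=> /andP[m1 m2]; move: ks => /andP[k1 k2].
  have km : (k < m.+1)%N by rewrite -(ltr_nat R); exact: lt_trans k1 m2.
  have mk : (m < k.+1)%N by rewrite -(ltr_nat R); exact: lt_trans m1 k2.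
  by apply/eqP; rewrite eqn_leq -ltnS km -ltnS mk.
exists C; split => // f cf sf u bound; split.
- move=> h; have k0 : k = 0%N by apply: uk; rewrite as0 h.
  by have := H f cf sf; rewrite k0 subr0.
- by move=> /(uk 1%N) k1; have := H f cf sf; rewrite k1.
- by move=> /(uk 2%N) k2; have := H f cf sf; rewrite k2.
- by move=> l _ lk; exfalso; apply: nk; exists l.
Qed.

End SchauderEstimates.

(** * The jump kernel *)

Section GammaSubstitution.
Context {R : realType}.
Local Notation RR := (measurableTypeR R).
Local Notation mu := (@lebesgue_measure R).

Lemma integral_tpowE (p : R) (F : R -> R) :
  (\int[mu]_t (tpow p t * F t)%:E = \int[mu]_(t in `]0%R, +oo[) (t `^ p * F t)%:E)%E.
Proof.
rewrite [RHS]integral_mkcond; apply: eq_integral => t _; rewrite /tpow patchE.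
rewrite (_ : (t \in _) = (0 < t)); first by case: ifP; rewrite ?mul0r.
by apply/idP/idP; rewrite inE/= in_itv/= andbT.
Qed.

Lemma ge0_integral_exhaustion (f : R -> R) (a b : nat -> R) (I : set R) (l : R) :
  measurable I -> measurable_fun setT f ->
  (forall k, a k.+1 <= a k) -> (forall k, b k <= b k.+1) ->
  (forall k x, a k <= x <= b k -> I x) ->
  (forall x, I x -> exists k, a k <= x <= b k) ->
  (forall x, I x -> 0 <= f x) ->
  (\int[mu]_(x in `[a k, b k]) (f x)%:E @[k --> \oo] --> \int[mu]_(x in I) (f x)%:E)%E.
Proof.
move=> mI mf da ib abI Iab f0.
have IE : I = \bigcup_k [set` `[a k, b k] ].
  apply/seteqP; split => x /=.
    by move=> /Iab[k h]; exists k => //=; rewrite in_itv.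
  by move=> [k _]; rewrite /= in_itv/=; exact: abI.
have nd : nondecreasing_seq (fun k => [set` `[a k, b k] ] : set R).
  apply/nondecreasing_seqP => k; rewrite subsetEset => x /=.
  rewrite !in_itv/= => /andP[h1 h2]; rewrite (le_trans _ h1)//=.
  exact: le_trans h2 _.
have f0' k x : [set` `[a k, b k] ] x -> (0 <= (EFin \o f) x)%E.
  by rewrite /= in_itv/= => hx; rewrite lee_fin; apply: f0; exact: abI hx.
have mab k : measurable ([set` `[a k, b k] ] : set RR) by exact: measurable_itv.
have mfab k : measurable_fun [set` `[a k, b k] ] (EFin \o f).
  by apply: measurable_funTS; exact/measurable_EFinP.
by rewrite IE; exact: (ge0_nondecreasing_set_cvg_integral (mu := mu) nd mab mfab f0').
Qed.

Lemma derive1_inv (rho r : R) : 0 < r ->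
  derivable (fun r : R => rho / r) r 1 /\ derive1 (fun r : R => rho / r) r = - (rho / r ^+ 2).
Proof.
move=> r0; have h : is_derive r (1 : R) (fun r : R => r) 1 by exact: is_derive_id.
have h' := is_deriveV (lt0r_neq0 r0) h.
have h2 : is_derive r (1 : R) (rho \*: (fun r : R => r^-1)) (- (rho / r ^+ 2)).
  by apply: is_derive_eq; rewrite /GRing.scale/= mulr1 mulrN.
by rewrite derive1E; case: h2.
Qed.

Lemma continuous_derive1_inv (rho x : R) : 0 < x ->
  {for x, continuous (derive1 (fun r : R => rho / r))}.
Proof.
move=> x0; set F := fun r : R => _.
have -> : {for x, continuous (derive1 F)} = (derive1 F z @[z --> x] --> derive1 F x) by [].
rewrite (derive1_inv rho x0).2.
apply: (@cvg_trans _ ((fun r : R => - (rho / r ^+ 2)) @ x)).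
  apply: near_eq_cvg; near=> z; rewrite (derive1_inv rho _).2//.
  by near: z; exact: lt_nbhsr.
have c : {for x, continuous (fun r : R => rho * (r ^+ 2)^-1)}.
  apply: (@continuousM _ _ (fun=> rho) (fun r : R => (r ^+ 2)^-1)); first exact: cst_continuous.
  by apply: continuousV; [rewrite expf_neq0// gt_eqF|exact: exprn_continuous].
exact: continuousN c.
Unshelve. all: by end_near. Qed.

(** The substitution t = rho/r turns it into Euler's integral. It is made on [1/(k+2), k+2], away
    from the singular ends, and both sides converge monotonically. *)
Lemma integral_inverse_gamma (q rho : R) : 0 < q -> 0 < rho ->
  (\int[mu]_r (tpow (- q - 1) r * expR (- (rho / r)))%:E = (rho `^ (- q) * Gamma q)%:E)%E.
Proof.
(* The factor rho^q is what the substitution produces from t^(q-1) dt. *)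
move=> q0 rho0; pose f r := rho `^ q * (r `^ (- q - 1) * expR (- (rho / r))).
pose G t : R := t `^ (q - 1) * expR (- t).
pose a (k : nat) : R := 1 / k.+2%:R; pose b (k : nat) : R := k.+2%:R.
have b0 k : 0 < b k by [].
have a0 k : 0 < a k by rewrite divr_gt0.
have ab k : a k <= b k.
  by rewrite ler_pdivrMr// -natrM ler1n.
have da k : a k.+1 <= a k by rewrite ler_pM2l// lef_pV2 ?posrE// ler_nat.
have ib k : b k <= b k.+1 by rewrite ler_nat.
have nb x : exists k, x <= b k.
  by have [N xN] := ex_natr_ge x; exists N; apply: le_trans xN _; rewrite ler_nat; lia.
have ex (c d : R) x : 0 < c -> 0 < d -> 0 < x -> exists k, c * a k <= x <= d * b k.
  move=> c0 d0 x0; have [k1 h1] := divS_exhaustion c0 x0; have [k2 h2] := nb (x / d).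
  exists (maxn k1 k2); apply/andP; split.
    apply: le_trans h1; rewrite /a mulrA mulr1 ler_pM2l// lef_pV2 ?posrE// ler_nat; lia.
  rewrite mulrC -ler_pdivrMr//; apply: le_trans h2 _; rewrite ler_nat; lia.
have mI : measurable ([set` `]0%R, +oo[ ] : set RR) by exact: measurable_itv.
have mf : measurable_fun setT f.
  apply: measurable_funM => //; apply: measurable_funM; first exact: measurable_powR.
  apply: measurableT_comp; first exact: measurable_expR.
  apply: measurableT_comp => //; apply: measurable_funM => //; exact: measurable_inv.
have mG : measurable_fun setT G.
  by apply: measurable_funM; [exact: measurable_powR|exact: measurable_expRN].
have sub k : (\int[mu]_(x in `[(rho / b k)%R, (rho / a k)%R]) (G x)%:E = \int[mu]_(x in `[a k, b k]) (f x)%:E)%E.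
  have xp x : a k <= x -> 0 < x by exact: lt_le_trans.
  rewrite (@integration_by_substitution_decreasing R (fun r => rho / r) G (a k) (b k))//.
  - apply: eq_integral => x; rewrite inE/= in_itv/= => /andP[/xp x0 _]; congr EFin.
    change (G (rho / x) * - derive1 (fun r : R => rho / r) x = f x).
    rewrite (derive1_inv rho x0).2 opprK /G /f.
    rewrite powRM ?invr_ge0 ?(ltW rho0) ?(ltW x0)// -[x^-1]powR_inv1 ?(ltW x0)// -powRrM.
    rewrite -exprVn -[x^-1]powR_inv1 ?(ltW x0)// -powR_mulrn ?powR_ge0// -powRrM.
    rewrite -(@mulr_powRB1 R rho q)// ?(ltW rho0)//.
    have -> : - q - 1 = -1 * (q - 1) + -1 * 2%:R :> R by ring.
    by rewrite (gt0_powRD _ _ x0); ring.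
  - move=> x y; rewrite !in_itv/= => /andP[/xp x0 _] /andP[/xp y0 _] xy.
    by rewrite ltr_pM2l// ltf_pV2.
  - by move=> x; rewrite in_itv/= => /andP[/ltW/xp x0 _]; exact: continuous_derive1_inv.
  - apply/cvg_ex; eexists; apply: cvg_at_right_filter; exact: continuous_derive1_inv.
  - apply/cvg_ex; eexists; apply: cvg_at_left_filter; exact: continuous_derive1_inv.
  - have dc x : 0 < x -> {for x, continuous (fun r : R => rho / r)}.
      by move=> x0; apply: differentiable_continuous; apply/derivable1_diffP; exact: (derive1_inv rho x0).1.
    split.
    + by move=> x; rewrite in_itv/= => /andP[/ltW/xp x0 _]; exact: (derive1_inv rho x0).1.
    + by apply: cvg_at_right_filter; exact: dc.
    + by apply: cvg_at_left_filter; exact: dc.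
  - apply: continuous_in_subspaceT => x; rewrite inE/= in_itv/= => /andP[h _].
    have x0 : 0 < x by apply: lt_le_trans h; rewrite divr_gt0.
    apply: (@continuousM _ _ (fun t : R => t `^ (q - 1)) (fun t : R => expR (- t))).
      exact: continuous_powR.
    apply: (@continuous_comp _ _ _ (fun t : R => - t) expR); last exact: continuous_expR.
    by apply: continuousN => //.
have lim1 : (\int[mu]_(x in `[a k, b k]) (f x)%:E @[k --> \oo] --> \int[mu]_(x in `]0%R, +oo[) (f x)%:E)%E.
  apply: ge0_integral_exhaustion => //.
  - by move=> k x; rewrite /= in_itv/= andbT => /andP[h _]; exact: lt_le_trans h.
  - move=> x /=; rewrite in_itv/= andbT => x0; have [k] := ex 1 1 x ltr01 ltr01 x0.
    by rewrite !mul1r; exists k.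
  - by move=> x _; rewrite !mulr_ge0 ?powR_ge0 ?expR_ge0.
have lim2 : (\int[mu]_(x in `[a k, b k]) (f x)%:E @[k --> \oo] --> \int[mu]_(x in `]0%R, +oo[) (G x)%:E)%E.
  under eq_fun do rewrite -sub.
  apply: ge0_integral_exhaustion => //.
  - by move=> k; rewrite ler_pM2l// lef_pV2 ?posrE.
  - by move=> k; rewrite ler_pM2l// lef_pV2 ?posrE.
  - move=> k x; rewrite /= in_itv/= andbT => /andP[h _]; apply: lt_le_trans h.
    by rewrite divr_gt0.
  - move=> x /=; rewrite in_itv/= andbT => x0; have [k /andP[h1 h2]] := ex rho rho x rho0 rho0 x0.
    by exists k; rewrite /a invf_div divr1 h2 andbT; move: h1; rewrite /a div1r.
  - by move=> x _; rewrite !mulr_ge0 ?powR_ge0 ?expR_ge0.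
have E := cvg_unique _ lim1 lim2.
have qG : (\int[mu]_(x in `]0%R, +oo[) (G x)%:E = (Gamma q)%:E)%E.
  rewrite -integral_tpowE Gamma_gt0E// euler_integralE EFin_Rintegral//.
  exact: integrable_euler.
rewrite integral_tpowE powRN EFinM -qG -E.
rewrite -ge0_integralZl//; last 3 first.
- by apply/measurable_EFinP; exact: measurable_funTS.
- by move=> x _; rewrite lee_fin !mulr_ge0 ?powR_ge0 ?expR_ge0.
- by rewrite lee_fin invr_ge0 powR_ge0.
apply: eq_integral => r _; rewrite -EFinM; congr EFin.
by rewrite /f mulKf// gt_eqF// powR_gt0.
Unshelve. exact: ereal_hausdorff.
Qed.

End GammaSubstitution.

(** * Subordination of the jump kernel to the heat kernels *)

Section JumpKernel.
Context {R : realType} {n : nat}.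
Local Notation RR := (measurableTypeR R).
Local Notation mu := (@lebesgue_measure R).
Implicit Types (y : 'rV[R]_n).
Local Notation G := (@heat_kernel R n).
Local Notation leb := (@lebRn R n).
Local Notation nr := (n%:R / 2 : R).

(** [c_ns s] is this constant divided by |Gamma(-s)|. *)
Definition jump_cst (s : R) : R := 4 `^ s * Gamma (nr + s) / pi `^ nr.

Lemma jump_cst_gt0 s : 0 < s -> 0 < jump_cst s.
Proof.
move=> s0; rewrite /jump_cst divr_gt0 ?powR_gt0 ?pi_gt0// mulr_gt0 ?powR_gt0//.
by apply: Gamma_gt0; rewrite ltr_wpDl// divr_ge0.
Qed.

(* Subordination: |y|^(-n-2s) is a superposition of the kernels G_r. *)
Lemma integral_tpow_heat_kernel (s : R) y : 0 < s -> y != 0 ->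
  (\int[mu]_r (tpow (- s - 1) r * G r y)%:E =
   (jump_cst s / enorm y `^ (n%:R + 2 * s))%:E)%E.
Proof.
move=> s0 y0; have e0 := enorm_gt0 y0.
have rho0 : 0 < enorm y ^+ 2 / 4 by rewrite divr_gt0// exprn_gt0.
have q0 : 0 < nr + s by rewrite ltr_wpDl// divr_ge0.
have p40 : 0 < 4 * pi :> R by rewrite mulr_gt0// pi_gt0.
transitivity (\int[mu]_r (((4 * pi) `^ (- nr))%:E *
    (tpow (- (nr + s) - 1) r * expR (- (enorm y ^+ 2 / 4 / r)))%:E))%E.
  apply: eq_integral => r _; rewrite -EFinM; congr EFin.
  rewrite /tpow; case: ifPn => [r0|_]; last by rewrite !mul0r mulr0.
  rewrite /heat_kernel powRM ?(ltW p40) ?(ltW r0)//.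
  have -> : - (nr + s) - 1 = (- s - 1) + - nr by ring.
  rewrite (gt0_powRD (- s - 1) (- nr) r0).
  have -> : enorm y ^+ 2 / 4 / r = enorm y ^+ 2 / (4 * r) by rewrite invfM mulrA.
  by ring.
rewrite ge0_integralZl//; last 3 first.
- apply/measurable_EFinP; apply: measurable_funM; first exact: measurable_tpow.
  apply: measurableT_comp; first exact: measurable_expR.
  apply: measurableT_comp => //; apply: measurable_funM => //; exact: measurable_inv.
- by move=> r _; rewrite lee_fin mulr_ge0 ?tpow_ge0 ?expR_ge0.
- by rewrite lee_fin powR_ge0.
rewrite integral_inverse_gamma// -EFinM; congr EFin.
have -> : (enorm y ^+ 2 / 4) `^ (- (nr + s)) = (enorm y `^ (n%:R + 2 * s))^-1 * 4 `^ (nr + s).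
  rewrite -powR_mulrn ?(ltW e0)// powRM ?powR_ge0 ?invr_ge0// -[4^-1]powR_inv1//.
  by rewrite -!powRrM -powRN; congr (_ `^ _ * _ `^ _); field.
rewrite powRM ?pi_ge0//.
rewrite (gt0_powRD _ _ (_ : 0 < 4 :> R))// !powRN /jump_cst.
have h4 : (4 `^ nr : R) != 0 by rewrite gt_eqF// powR_gt0.
have hp : (pi `^ nr : R) != 0 by rewrite gt_eqF// powR_gt0// pi_gt0.
have hE : enorm y `^ (n%:R + 2 * s) != 0 by rewrite gt_eqF// powR_gt0.
by field; rewrite hE hp h4.
Qed.

Lemma integrable_tpow_heat_kernel (s : R) y : 0 < s -> y != 0 ->
  mu.-integrable setT (EFin \o (fun r => tpow (- s - 1) r * G r y)).
Proof.
move=> s0 y0.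
apply: (@integrable_ltyP R _ _ mu _ (jump_cst s / enorm y `^ (n%:R + 2 * s))).
  apply: measurable_funM; first exact: measurable_tpow.
  rewrite -(vtupK y).
  exact: (measurable_heat_kernel (tau := id) (xi := fun=> vtup y)).
rewrite -integral_tpow_heat_kernel// le_eqVlt; apply/orP; left; apply/eqP/eq_integral => r _.
by rewrite ger0_norm// mulr_ge0 ?tpow_ge0 ?heat_kernel_ge0.
Qed.

(** * Jump integrals of a bounded function of order b > 2s at the origin *)

Variables (s b B D : R) (q : 'rV[R]_n -> R).
Hypotheses (s0 : 0 < s) (sb : 2 * s < b) (D0 : 0 <= D) (bq : mbounded B q).
Hypothesis Dq : forall y, `|q y| <= D * enorm y `^ b.

Let b0 : 0 < b. Proof. by apply: lt_trans sb; rewrite mulr_gt0. Qed.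

Let q0 : q 0 = 0.
Proof.
apply/eqP; rewrite -normr_le0; apply: le_trans (Dq 0) _.
by rewrite enorm0 powR0 ?mulr0// gt_eqF.
Qed.

Let F (p : RR * n.-tuple RR) : R := tpow (- s - 1) p.1 * (G p.1 (rvec p.2) * q (rvec p.2)).

Let mF : measurable_fun setT F.
Proof.
apply: measurable_funM; first by apply: measurableT_comp; [exact: measurable_tpow|exact: measurable_fst].
apply: measurable_funM; first by apply: measurable_heat_kernel; [exact: measurable_fst|exact: measurable_snd].
by apply: (measurableT_comp bq.1); exact: measurable_snd.
Qed.

Let Fsec (z : n.-tuple RR) : mu.-integrable setT (fun r => (F (r, z))%:E).
Proof.
have [z0|z0] := eqVneq (rvec z) 0.
  rewrite (_ : (fun r => _) = cst 0%E); first exact: integrable0.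
  by apply/funext => r; rewrite /F/= z0 q0 !mulr0.
have -> : (fun r => (F (r, z))%:E) = (EFin \o (fun r => q (rvec z) * (tpow (- s - 1) r * G r (rvec z)))).
  by apply/funext => r /=; congr EFin; rewrite /F/= [RHS]mulrC mulrA.
by apply: integrable_cstM; exact: integrable_tpow_heat_kernel.
Qed.

(** For small r the moment bound gives r^(b/2); for large r the bound of q and the mass of the
    kernel are used. Since b > 2s and s > 0, r^(-s-1) times the minimum is integrable. *)
Let dominating : exists2 g : R -> R, mu.-integrable setT (EFin \o g) &
  forall r, (\int[leb]_z `|F (r, z)|%:E <= (g r)%:E)%E.
Proof.
have [C C0 hC] := @heat_kernel_moment R n b b0.
have B0 := mbounded_ge0 bq.
pose w (r : R) := Num.min B (D * C * r `^ (b / 2)).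
have w0 t : 0 <= w t by rewrite /w le_min B0/= mulr_ge0 ?powR_ge0// mulr_ge0// ltW.
exists (fun r => tpow (- s - 1) r * w r).
  apply: (@integrable_mellin R w (- s) (b / 2) 0 (D * C) B) => //.
  - apply: measurable_minr => //; apply: measurable_funM => //; exact: measurable_powR.
  - by rewrite mulr_ge0// ltW.
  - by rewrite subr_gt0 ltr_pdivlMr// mulrC.
  - by rewrite add0r oppr_lt0.
  - by move=> t t0; rewrite (ger0_norm (w0 _)) ge_min lexx orbT.
  - move=> t t0; rewrite (ger0_norm (w0 _)).
    by rewrite powRr0 mulr1 ge_min lexx.
move=> r; rewrite /F /tpow/=; case: ifPn => [r0|_]; last first.
  by under eq_integral do rewrite mul0r normr0; rewrite integral0 mul0r.
have mGq : measurable_fun setT (fun z : n.-tuple RR => `|G r (rvec z) * q (rvec z)|).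
  apply: measurableT_comp => //; apply: measurable_funM; first exact: measurable_kernel.
  exact: bq.1.
have mono (c k : R) (H : n.-tuple RR -> R) : measurable_fun setT H -> (forall z, 0 <= H z) ->
    0 <= c -> (\int[leb]_z (H z)%:E = 1%:E)%E ->
    (forall z, `|G r (rvec z) * q (rvec z)| <= c * H z) ->
    (\int[leb]_z `|G r (rvec z) * q (rvec z)|%:E <= c%:E)%E.
  move=> mH H0 c0 H1 le.
  apply: (@le_trans _ _ (\int[leb]_z (c%:E * (H z)%:E))%E).
    apply: ge0_le_integral => //.
    - by apply/measurable_EFinP.
    - by apply: measurable_funeM; apply/measurable_EFinP.
    - by move=> z _; rewrite -EFinM lee_fin.
  rewrite ge0_integralZl ?H1 ?mule1//.
  - by apply/measurable_EFinP.
  - by move=> z _; rewrite lee_fin.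
have le : (\int[leb]_z `|G r (rvec z) * q (rvec z)|%:E <= (w r)%:E)%E.
  rewrite /w /Num.min; case: ifP => _.
    apply: (mono _ 0 (fun z => G r (rvec z))) => //.
    - exact: measurable_kernel.
    - by move=> z; exact: heat_kernel_ge0.
    - exact: integral_heat_kernel.
    - move=> z; rewrite normrM (ger0_norm (heat_kernel_ge0 _ _)) mulrC.
      by rewrite ler_wpM2r ?heat_kernel_ge0// bq.2.
  apply: (mono _ 0 (fun z => G (2 * r) (rvec z))) => //.
  - exact: measurable_kernel.
  - by move=> z; exact: heat_kernel_ge0.
  - by rewrite !mulr_ge0 ?powR_ge0// ltW.
  - by apply: integral_heat_kernel; rewrite mulr_gt0.
  - move=> z; rewrite normrM (ger0_norm (heat_kernel_ge0 _ _)) mulrC.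
    apply: (@le_trans _ _ (D * (enorm (rvec z) `^ b * G r (rvec z)))).
      by rewrite [leRHS]mulrA ler_wpM2r ?heat_kernel_ge0.
    have -> : D * C * r `^ (b / 2) * G (2 * r) (rvec z) = D * (C * r `^ (b / 2) * G (2 * r) (rvec z)).
      by move: (G _ _) (r `^ _) => u v; ring.
    by apply: ler_wpM2l => //; exact: hC.
under eq_integral do rewrite normrM (ger0_norm (powR_ge0 _ _)) EFinM.
rewrite ge0_integralZl//; last 2 first.
- by apply/measurable_EFinP.
- by rewrite lee_fin powR_ge0.
by rewrite EFinM lee_wpmul2l// lee_fin powR_ge0.
Qed.

Let Fint (z : n.-tuple RR) :
  \int[mu]_r F (r, z) = jump_cst s * (q (rvec z) / enorm (rvec z) `^ (n%:R + 2 * s)).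
Proof.
(* The subordination formula excludes the origin; there both sides vanish because q does. *)
have [z0|z0] := eqVneq (rvec z) 0.
  rewrite /F/= z0 q0 mul0r mulr0; under eq_Rintegral do rewrite !mulr0.
  by rewrite /Rintegral integral0.
transitivity (\int[mu]_r (q (rvec z) * (tpow (- s - 1) r * G r (rvec z)))).
  by apply: eq_Rintegral => r _; rewrite /F/= [RHS]mulrC mulrA.
have h := integral_tpow_heat_kernel s0 z0.
rewrite RintegralZl//; last exact: integrable_tpow_heat_kernel.
rewrite /Rintegral h/= [LHS]mulrC -[LHS]mulrA; congr (_ * _).
by rewrite mulrC.
Qed.

Lemma integrable_jump :
  leb.-integrable setT (EFin \o (fun z => q (rvec z) / enorm (rvec z) `^ (n%:R + 2 * s))).
Proof.
have [g ig Fg] := dominating.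
have h := integrable_Rfubini2 mF ig Fg Fsec.
have c0 := jump_cst_gt0 s0.
have -> : (EFin \o (fun z => q (rvec z) / enorm (rvec z) `^ (n%:R + 2 * s))) =
    (EFin \o (fun z => (jump_cst s)^-1 * \int[mu]_r F (r, z))).
  apply/funext => z /=; rewrite Fint mulKf// gt_eqF//.
exact: integrable_cstM.
Qed.

Let Frow r : \int[leb]_z F (r, z) =
  tpow (- s - 1) r * \int[leb]_z (G r (rvec z) * q (rvec z)).
Proof.
rewrite /F/= /tpow; case: ifPn => r0; last first.
  by rewrite mul0r; under eq_Rintegral do rewrite mul0r; rewrite /Rintegral integral0.
rewrite RintegralZl//.
apply: (@integrable_le _ _ _ leb setT _ (fun z => B * G r (rvec z))) => //.
- by apply: measurable_funM; [exact: measurable_kernel|exact: bq.1].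
- move=> z _; rewrite normrM (ger0_norm (heat_kernel_ge0 _ _)) mulrC.
  by rewrite ler_wpM2r ?heat_kernel_ge0// bq.2.
- by apply: integrable_cstM; exact: integrable_kernel.
Qed.

(** Fubini on r^(-s-1) G_r(z) q(z): integrating first in r gives the jump kernel, first in z the
    heat averages of q. *)
Lemma Rintegral_jump :
  jump_cst s * \int[leb]_z (q (rvec z) / enorm (rvec z) `^ (n%:R + 2 * s)) =
  \int[mu]_r (tpow (- s - 1) r * \int[leb]_z (G r (rvec z) * q (rvec z))).
Proof.
have [g ig Fg] := dominating.
rewrite -RintegralZl//; last exact: integrable_jump.
under eq_Rintegral do rewrite -Fint.
rewrite -(Rfubini mF ig Fg Fsec); apply: eq_Rintegral => r _; exact: Frow.
Qed.

Lemma integrable_tpow_kernel : mu.-integrable setT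
  (EFin \o (fun r => tpow (- s - 1) r * \int[leb]_z (G r (rvec z) * q (rvec z)))).
Proof.
have [g ig Fg] := dominating.
have := integrable_Rfubini1 mF ig Fg.
by congr (integrable _ _ _); apply/funext => r /=; rewrite Frow.
Qed.

End JumpKernel.

(** * Inversion of the fractional integral *)

Section OneDimensionalInversion.
Context {R : realType}.
Local Notation RR := (measurableTypeR R).
Local Notation mu := (@lebesgue_measure R).

Lemma integral_affine1 (v : R) (e : bool) (F : RR -> \bar R) :
  measurable_fun setT F ->
  (\int[mu]_a F (raffine v e a) = \int[mu]_a F a)%E.
Proof.
move=> mF; rewrite [LHS]integralE [RHS]integralE.
have mFp : measurable_fun setT (F^\+)%E by exact: measurable_funepos.
have mFn : measurable_fun setT (F^\-)%E by exact: measurable_funeneg.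
congr (_ - _)%E.
  rewrite -(ge0_integral_affine1 v e mFp (fun x => funepos_ge0 F x)).
  by apply: eq_integral => t _; rewrite !funeposE.
rewrite -(ge0_integral_affine1 v e mFn (fun x => funeneg_ge0 F x)).
  by apply: eq_integral => t _; rewrite !funenegE.
Qed.

Lemma Rintegral_shift (r : R) (F : R -> R) : measurable_fun setT F ->
  \int[mu]_t F (r + t) = \int[mu]_t F t.
Proof.
move=> mF; rewrite /Rintegral; congr fine.
have mE : measurable_fun setT (EFin \o F) by exact/measurable_EFinP.
rewrite -(integral_affine1 r false mE).
by apply: eq_integral => t _; rewrite /raffine expr0 mul1r.
Qed.

Lemma integrable_shift (r : R) (F : R -> R) : measurable_fun setT F ->
  mu.-integrable setT (EFin \o (fun t => F (r + t))) -> mu.-integrable setT (EFin \o F).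
Proof.
move=> mF /integrableP[_ h]; apply/integrableP; split; first exact/measurable_EFinP.
have mE : measurable_fun setT (fun t => `|F t|%:E) by apply/measurable_EFinP; exact: measurableT_comp.
rewrite -(ge0_integral_affine1 r false mE)//; apply: le_lt_trans h.
rewrite le_eqVlt; apply/orP; left; apply/eqP/eq_integral => t _.
by rewrite /raffine expr0 mul1r.
Qed.

(* Indicator functions of half-lines are written as [tpow 0 (r - x)] (for x < r) and
   [1 - tpow 0 (x - r)] (for x <= r). *)
Lemma tpow0E (t : R) : tpow 0 t = (0 < t)%R%:R.
Proof. by rewrite /tpow; case: ifP => // _; rewrite powRr0. Qed.

Lemma integral_tpow_tail (p x : R) : p < 0 -> 0 < x ->
  (\int[mu]_r (tpow (p - 1) r * (1 - tpow 0 (x - r)))%:E = (x `^ p / - p)%:E)%E.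
Proof.
move=> p0 x0; rewrite -(integral_powR_y p0 x0) [RHS]integral_mkcond.
apply: eq_integral => r _; rewrite tpow0E subr_gt0 patchE.
rewrite (_ : (r \in _) = (x <= r)); last first.
  by apply/idP/idP; rewrite inE/= in_itv/= andbT.
rewrite [x <= r]leNgt; case: ltP => [_|xr]; first by rewrite subrr mulr0.
by rewrite /tpow (lt_le_trans x0 xr) subr0 mulr1.
Qed.

Lemma integral_expRN_head (r : R) : 0 < r ->
  (\int[mu]_x (tpow 0 x * expR (- x) * (1 - tpow 0 (x - r)))%:E = (1 - expR (- r))%:E)%E.
Proof.
move=> r0; transitivity (\int[mu]_(x in `]0%R, r]) (expR (- x))%:E)%E.
  rewrite [RHS]integral_mkcond; apply: eq_integral => x _; rewrite !tpow0E subr_gt0 patchE.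
  rewrite (_ : (x \in _) = (0 < x) && (x <= r)); last first.
    by apply/idP/idP; rewrite inE/= in_itv/=.
  by case: ltP => _; case: leP => _; rewrite /= ?subrr ?subr0 ?mulr0 ?mul0r ?mulr1 ?mul1r.
rewrite (@ge0_FTC_exhaustion R _ (fun x => - expR (- x)) _
  (fun k => r / k.+2%:R) (fun=> r) (- 1) (- expR (- r))) ?opprK 1?addrC//.
- by move=> k; rewrite ltr_pdivrMr// ltr_pMr// ltr1n.
- by move=> k; rewrite ler_pM2l// lef_pV2 ?posrE// ler_nat.
- move=> k x /=; rewrite in_itv/= => /andP[h ->]; rewrite andbT.
  by apply: lt_le_trans h; rewrite divr_gt0.
- move=> x /=; rewrite in_itv/= => /andP[x0 ->]; have [k h] := divS_exhaustion r0 x0.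
  by exists k; rewrite h.
- move=> x _; apply: (@continuous_comp _ _ _ (fun t : R => - t) expR); last exact: continuous_expR.
  by apply: continuousN => //.
- move=> x _; have h : is_derive x (1 : R) (fun x : R => - expR (- x)) (expR (- x)).
    by apply: is_derive_eq; rewrite /GRing.scale/=; ring.
  by case: h.
- apply: (@cvg_at_right0_divS _ r (- 1) (fun x => - expR (- x)) r0).
  rewrite -expR0 -[X in expR X]oppr0; apply: cvg_at_right_filter.
  apply: cvgN; apply: (@continuous_comp _ _ _ (fun t : R => - t) expR); last exact: continuous_expR.
  by apply: continuousN => //.
- exact: cvg_cst.
Qed.

(** Tonelli, with 1 - e^(-r) written as the integral of e^(-x) over 0 < x <= r, replaces an
    integration by parts: r^(-s-1) integrated over r >= x leaves x^(-s)/s. *)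
Lemma integral_tpow_expRN (s : R) : 0 < s < 1 ->
  (\int[mu]_r (tpow (- s - 1) r * (1 - expR (- r)))%:E = (Gamma (1 - s) / s)%:E)%E.
Proof.
move=> /andP[s0 s1].
pose F (p : RR * RR) : R := tpow (- s - 1) p.1 * (tpow 0 p.2 * expR (- p.2) * (1 - tpow 0 (p.2 - p.1))).
have mF : measurable_fun setT F.
  have m1 : measurable_fun setT (fun p : RR * RR => p.1) by exact: measurable_fst.
  have m2 : measurable_fun setT (fun p : RR * RR => p.2) by exact: measurable_snd.
  apply: measurable_funM; first exact: (measurableT_comp (measurable_tpow _) m1).
  apply: measurable_funM; last first.
    apply: measurable_funB => //; apply: (measurableT_comp (measurable_tpow _)).
    exact: measurable_funB.
  apply: measurable_funM; first exact: (measurableT_comp (measurable_tpow _) m2).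
  exact: (measurableT_comp measurable_expRN m2).
have ind0 (t : R) : 0 <= 1 - tpow 0 t by rewrite tpow0E; case: (0 < t); rewrite ?subrr ?subr0.
have F0 p : (0 <= (F p)%:E)%E.
  by rewrite lee_fin !mulr_ge0 ?tpow_ge0 ?expR_ge0.
have mE : measurable_fun setT (EFin \o F) by exact/measurable_EFinP.
transitivity (\int[mu]_r \int[mu]_x (EFin \o F) (r, x))%E.
  apply: eq_integral => r _; rewrite /F/=; have [r0|r0] := ltP 0 r; last first.
    rewrite [tpow _ r](_ : _ = 0) ?mul0r; last by rewrite /tpow ltNge r0.
    by under eq_integral do rewrite mul0r; rewrite integral0.
  transitivity (\int[mu]_x ((tpow (- s - 1) r)%:E *
      (tpow 0 x * expR (- x) * (1 - tpow 0 (x - r)))%:E))%E;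
    last by apply: eq_integral => x _; rewrite -EFinM.
  rewrite ge0_integralZl.
  - by rewrite integral_expRN_head// -EFinM.
  - exact: measurableT.
  - apply/measurable_EFinP; apply: measurable_funM; last first.
      apply: measurable_funB => //; apply: (measurableT_comp (measurable_tpow _)).
      exact: measurable_funB.
    by apply: measurable_funM; [exact: measurable_tpow|exact: measurable_expRN].
  - by move=> x _; rewrite lee_fin !mulr_ge0 ?tpow_ge0 ?expR_ge0.
  - by rewrite lee_fin tpow_ge0.
rewrite (@fubini_tonelli _ _ RR RR R mu mu (EFin \o F) mE F0); transitivity (\int[mu]_x ((s^-1)%:E * (tpow (1 - s - 1) x * expR (- x))%:E))%E.
  apply: eq_integral => x _.
  have [x0|x0] := ltP 0 x; last first.
    rewrite /tpow ltNge x0/= mul0r mule0; under eq_integral.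
      by move=> r _; rewrite /F/= [tpow 0 x]tpow0E ltNge x0/= !mul0r mulr0; over.
    by rewrite integral0.
  transitivity (\int[mu]_r ((expR (- x))%:E * (tpow (- s - 1) r * (1 - tpow 0 (x - r)))%:E))%E.
    apply: eq_integral => r _; rewrite /F/= -EFinM; congr EFin.
    by rewrite [tpow 0 x]tpow0E x0/=; ring.
  rewrite ge0_integralZl//; last 2 first.
  - apply/measurable_EFinP; apply: measurable_funM; first exact: measurable_tpow.
    apply: measurable_funB => //; apply: (measurableT_comp (measurable_tpow _)).
    exact: measurable_funB.
  - by move=> r _; rewrite lee_fin mulr_ge0 ?tpow_ge0.
  rewrite integral_tpow_tail ?oppr_lt0// -!EFinM; congr EFin; rewrite /tpow x0.
  rewrite opprK (_ : 1 - s - 1 = - s); last by ring.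
  by rewrite mulrC [LHS]mulrAC mulrC mulrA.
have e1 : 0 < 1 - s by rewrite subr_gt0.
rewrite ge0_integralZl//; last 3 first.
- by apply/measurable_EFinP; apply: measurable_funM; [exact: measurable_tpow|exact: measurable_expRN].
- by move=> r _; rewrite lee_fin mulr_ge0 ?tpow_ge0 ?expR_ge0.
- by rewrite lee_fin invr_ge0 ltW.
rewrite -EFin_Rintegral//; last exact: integrable_euler.
by rewrite -euler_integralE -Gamma_gt0E// -EFinM mulrC.
Qed.

(** From (1 - y)^s >= 1 - y with y = r/t. It makes the primitive in [integral_abel_neg] tend to 0 at
    r = 0. *)
Lemma powR_deficit (s t r : R) : 0 < s <= 1 -> 0 <= r <= t -> 0 < t ->
  0 <= t `^ (s - 1) - (t - r) `^ s / t <= t `^ (s - 2) * r.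
Proof.
move=> /andP[s0 s1] /andP[r0 rt] t0.
have tr0 : 0 <= t - r by rewrite subr_ge0.
have e1 : t `^ (s - 1) = t `^ s / t by rewrite (gt0_powRD _ _ t0) powRN powRr1// ltW.
have e2 : t `^ (s - 2) = t `^ s / t / t.
  by rewrite (_ : s - 2 = s - 1 + - 1)// ?(gt0_powRD _ _ t0) ?powRN ?powRr1 ?ltW//; ring.
have h1 : (t - r) `^ s <= t `^ s by rewrite ge0_ler_powR ?nnegrE ?(ltW s0) ?(ltW t0)// gerBl.
have h2 : t `^ s * ((t - r) / t) <= (t - r) `^ s.
  have -> : (t - r) `^ s = t `^ s * ((t - r) / t) `^ s.
    rewrite -powRM ?divr_ge0 ?(ltW t0)//; congr (_ `^ _); field; exact: lt0r_neq0.
  apply: ler_wpM2l; first exact: powR_ge0.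
  have [->|x0] := eqVneq ((t - r) / t) 0; first exact: powR_ge0.
  rewrite -[leLHS]powRr1 ?divr_ge0 ?(ltW t0)//; apply: ger_powR => //.
  by rewrite lt0r x0 divr_ge0 ?(ltW t0)//= ler_pdivrMr// mul1r gerBl.
apply/andP; split.
  by rewrite e1 -mulrBl divr_ge0 ?(ltW t0)// subr_ge0.
rewrite e1 e2 -mulrBl; have -> : t `^ s / t / t * r = t `^ s * (r / t) / t by ring.
rewrite ler_pM2r ?invr_gt0// lerBlDl.
apply: le_trans (lerD h2 (lexx _)); rewrite -mulrDr -mulrDl subrK divff ?mulr1//.
exact: lt0r_neq0.
Qed.

(** The primitive [Phi] is explicit: its derivative simplifies through (t - r) + r = t. It tends to
    0 at r = 0 and to 1/(s t) at r = t. *)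
Lemma integral_abel_neg (s t : R) : 0 < s < 1 -> 0 < t ->
  (\int[mu]_(r in `]0%R, t[) (r `^ (- s - 1) * ((t - r) `^ (s - 1) - t `^ (s - 1)))%:E =
   ((s * t)^-1)%:E)%E.
Proof.
move=> /andP[s0 s1] t0.
pose Phi (r : R) := r `^ (- s) * (t `^ (s - 1) - (t - r) `^ s / t) / s.
have t20 : 0 < t / 2 by rewrite divr_gt0.
have xk (k : nat) : 0 < t / 2 / k.+2%:R <= t / 4.
  rewrite divr_gt0//= ler_pdivrMr//; have : 2 <= k.+2%:R :> R by rewrite ler_nat.
  by nra.
have xd (k : nat) : t / 2 / k.+3%:R <= t / 2 / k.+2%:R.
  by rewrite ler_pM2l// lef_pV2 ?posrE// ler_nat.
(* Both ends are approached at distance t/(2(k+2)) <= t/4, so the intervals are nonempty and stay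
   inside ]0, t[. *)
rewrite (@ge0_FTC_exhaustion R _ Phi _ (fun k => t / 2 / k.+2%:R)
  (fun k => t - t / 2 / k.+2%:R) 0 (s * t)^-1) ?subr0//.
- by move=> k; have := xk k; move: (t / 2 / _) => u; lra.
- by move=> k; rewrite lerD2l lerN2.
- move=> k x /=; rewrite in_itv/=; have := xk k; move: (t / 2 / _) => u.
  by move=> /andP[h1 h2] /andP[h3 h4]; apply/andP; split; lra.
- move=> x /=; rewrite in_itv/= => /andP[x0 xt].
  have tx0 : 0 < t - x by rewrite subr_gt0.
  have [k1 h1] := divS_exhaustion t20 x0; have [k2 h2] := divS_exhaustion t20 tx0.
  have le (k l : nat) : (k <= l)%N -> t / 2 / l.+2%:R <= t / 2 / k.+2%:R.
    by move=> kl; rewrite ler_pM2l// lef_pV2 ?posrE// ler_nat.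
  exists (maxn k1 k2); apply/andP; split; first exact: le_trans (le _ _ (leq_maxl _ _)) h1.
  have := le_trans (le _ _ (leq_maxr k1 k2)) h2; move: (t / 2 / _) => u; lra.
- move=> x /=; rewrite in_itv/= => /andP[x0 xt]; rewrite mulr_ge0 ?powR_ge0// subr_ge0.
  have -> : s - 1 = - (1 - s) by ring.
  by apply: ler_powRN; rewrite ?subr_ge0 ?subr_gt0 ?gerBl// ltW.
- move=> x /=; rewrite in_itv/= => /andP[x0 xt].
  apply: (@continuousM _ _ (fun r => r `^ (- s - 1)) (fun r => (t - r) `^ (s - 1) - t `^ (s - 1))).
    exact: continuous_powR.
  apply: (@continuousB _ _ _ (fun r => (t - r) `^ (s - 1)) (fun=> t `^ (s - 1))); last exact: cst_continuous.
  apply: (@continuous_comp _ _ _ (fun r : R => t - r) (fun r => r `^ (s - 1))).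
    by apply: continuousB => //; exact: cst_continuous.
  by apply: continuous_powR; rewrite subr_gt0.
- move=> x /=; rewrite in_itv/= => /andP[x0 xt].
  have tx0 : 0 < t - x by rewrite subr_gt0.
  have h1 := is_derive1_powR (- s) x0.
  have h2 := is_derive1_powR s tx0.
  have h3 : is_derive x (1 : R) (fun r : R => t - r) (- 1).
    by have h := @is_deriveB R _ _ (fun=> t) id x 1 0 1 _ _; rewrite sub0r in h; exact: h.
  have h4 := @is_derive1_comp R (fun r => r `^ s) (fun r => t - r) x _ _ h2 h3.
  have h : is_derive x (1 : R) Phi (x `^ (- s - 1) * ((t - x) `^ (s - 1) - t `^ (s - 1))).
    have ex : x `^ (- s) = x * x `^ (- s - 1).
      by rewrite -{2}(powRr1 (ltW x0)) -gt0_powRD//; congr (_ `^ _); ring.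
    have et : (t - x) `^ s = (t - x) * (t - x) `^ (s - 1) by rewrite mulr_powRB1// ltW.
    apply: is_derive_eq; rewrite /GRing.scale/= ex et.
    by field; rewrite !gt_eqF.
  by case: h.
- apply: (cvg_at_right0_divS t20 (F := Phi)).
  apply: (@squeeze_cvgr _ _ _ _ (fun=> 0) (fun x => t `^ (s - 2) / s * x `^ (1 - s))).
  + near=> x.
    have x0 : 0 < x by near: x; exact: nbhs_right_gt.
    have xt : x <= t by near: x; exact: nbhs_right_le.
    have /andP[h1 h2] : 0 <= t `^ (s - 1) - (t - x) `^ s / t <= t `^ (s - 2) * x.
      by apply: powR_deficit; rewrite ?s0 ?(ltW s1) ?(ltW x0).
    rewrite /Phi divr_ge0 ?mulr_ge0 ?powR_ge0 ?(ltW s0)//=.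
    have -> : 1 - s = - s + 1 by ring.
    rewrite (gt0_powRD _ _ x0) (powRr1 (ltW x0)).
    rewrite ler_pdivrMr//; apply: le_trans (ler_wpM2l (powR_ge0 _ _) h2) _.
    by rewrite le_eqVlt; apply/orP; left; apply/eqP; field; rewrite gt_eqF.
  + exact: cvg_cst.
  + rewrite -[X in _ --> X](mulr0 (t `^ (s - 2) / s)); apply: cvgM; first exact: cvg_cst.
    by apply: powR_cvg0; rewrite subr_gt0.
- apply: (cvg_at_right0_divS t20 (F := fun x => Phi (t - x))).
  rewrite /Phi; under eq_fun do rewrite subKr.
  have -> : (s * t)^-1 = t `^ (- s) * (t `^ (s - 1) - 0 / t) / s.
    rewrite mul0r subr0 -gt0_powRD// (_ : - s + (s - 1) = - 1); last by ring.
    by rewrite powRN (powRr1 (ltW t0)) invfM mulrC.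
  apply: cvgM; last exact: cvg_cst.
  apply: cvgM.
    apply: cvg_at_right_filter.
    rewrite -[X in _ --> X `^ _](subr0 t).
    apply: (@continuous_comp _ _ _ (fun r : R => t - r) (fun r => r `^ (- s))).
      by apply: continuousB => //; exact: cst_continuous.
    by apply: continuous_powR; rewrite subr0.
  apply: cvgB; first exact: cvg_cst.
  apply: cvgM; last exact: cvg_cst.
  exact: powR_cvg0.
Unshelve. all: by end_near. Qed.

(** The part r >= t contributes 1/(s t) and the part r < t exactly the opposite; this cancellation
    is the core of the inversion. The bound is written with [tpow (0 - 1) t] to fit a Mellin
    integral with parameter 0. *)
Lemma abel_difference (s t : R) : 0 < s < 1 -> 0 < t ->
  let J r := tpow (- s - 1) r * (tpow (s - 1) t - tpow (s - 1) (t - r)) in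
  (\int[mu]_r `|J r|%:E <= (2 / s * tpow (0 - 1) t)%:E)%E /\ \int[mu]_r J r = 0.
Proof.
move=> /andP[s0 s1] t0 J; have s01 : 0 < s < 1 by rewrite s0.
have st0 : 0 < s * t by rewrite mulr_gt0.
have mt (p : R) : measurable_fun setT (fun r : RR => tpow p (t - r)).
  by apply: (measurableT_comp (measurable_tpow _)); exact: measurable_funB.
pose Jp r := t `^ (s - 1) * (tpow (- s - 1) r * (1 - tpow 0 (t - r))).
pose Jm r := tpow (- s - 1) r * ((tpow (s - 1) (t - r) - t `^ (s - 1)) * tpow 0 (t - r)).
have JE r : J r = Jp r - Jm r.
  rewrite /J /Jp /Jm tpow0E subr_gt0 [tpow _ t]/tpow t0.
  case: ltP => [_|tr] /=; first by ring.
  by rewrite [tpow _ (t - r)](_ : _ = 0) ?/tpow ?subr_gt0 ?ltNge ?tr//; ring.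
have Jp0 r : 0 <= Jp r.
  rewrite !mulr_ge0 ?powR_ge0 ?tpow_ge0// tpow0E.
  by case: (0 < t - r); rewrite ?subrr ?subr0.
have Jm0 r : 0 <= Jm r.
  rewrite /Jm tpow0E subr_gt0; case: ltP => [rt|_]; last by rewrite !mulr0.
  rewrite /tpow subr_gt0 rt mulr1; case: ltP => [r0|_]; last by rewrite mul0r.
  rewrite mulr_ge0 ?powR_ge0// subr_ge0 (_ : s - 1 = - (1 - s)); last by ring.
  by apply: ler_powRN; rewrite ?subr_ge0 ?subr_gt0 ?gerBl// ltW.
have mJp : measurable_fun setT Jp.
  apply: measurable_funM => //; apply: measurable_funM; first exact: measurable_tpow.
  by apply: measurable_funB; [exact: measurable_cst|exact: mt].
have mJm : measurable_fun setT Jm.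
  apply: measurable_funM; first exact: measurable_tpow.
  by apply: measurable_funM; [apply: measurable_funB; [exact: mt|exact: measurable_cst]|exact: mt].
have Ip : (\int[mu]_r (Jp r)%:E = ((s * t)^-1)%:E)%E.
  rewrite /Jp; under eq_integral do rewrite EFinM.
  rewrite ge0_integralZl; first last.
  - by rewrite lee_fin powR_ge0.
  - move=> r _; rewrite lee_fin mulr_ge0 ?tpow_ge0// tpow0E.
    by case: (0 < t - r); rewrite ?subrr ?subr0.
  - apply/measurable_EFinP; apply: measurable_funM; first exact: measurable_tpow.
    by apply: measurable_funB; [exact: measurable_cst|exact: mt].
  - exact: measurableT.
  rewrite integral_tpow_tail ?oppr_lt0// -EFinM; congr EFin.
  rewrite opprK mulrA -gt0_powRD// (_ : s - 1 + - s = - 1); last by ring.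
  by rewrite powRN (powRr1 (ltW t0)) invfM mulrC.
have Im : (\int[mu]_r (Jm r)%:E = ((s * t)^-1)%:E)%E.
  rewrite -(integral_abel_neg s01 t0) [RHS]integral_mkcond; apply: eq_integral => r _.
  rewrite patchE (_ : (r \in _) = (0 < r) && (r < t)); last first.
    by apply/idP/idP; rewrite inE/= in_itv/=.
  rewrite /Jm tpow0E subr_gt0 /tpow subr_gt0; case: (0 < r); last by rewrite mul0r.
  by case: (r < t); rewrite /= ?mulr1 ?mulr0.
have ip : mu.-integrable setT (EFin \o Jp).
  apply: (@integrable_ltyP R _ _ mu _ (s * t)^-1) => //; rewrite -Ip le_eqVlt; apply/orP; left.
  by apply/eqP/eq_integral => r _; rewrite ger0_norm.
have im : mu.-integrable setT (EFin \o Jm).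
  apply: (@integrable_ltyP R _ _ mu _ (s * t)^-1) => //; rewrite -Im le_eqVlt; apply/orP; left.
  by apply/eqP/eq_integral => r _; rewrite ger0_norm.
split.
  apply: (@le_trans _ _ (\int[mu]_r ((Jp r)%:E + (Jm r)%:E))%E).
    apply: ge0_le_integral => //.
    - apply/measurable_EFinP; apply: measurableT_comp => //.
      by rewrite (_ : J = (fun r => Jp r - Jm r)); [exact: measurable_funB|exact/funext].
    - by apply: emeasurable_funD; apply/measurable_EFinP.
    - move=> r _; rewrite -EFinD lee_fin JE.
      by rewrite (le_trans (ler_normB _ _))// !ger0_norm.
  rewrite ge0_integralD//; last 4 first.
  - by move=> r _; rewrite lee_fin.
  - by apply/measurable_EFinP.
  - by move=> r _; rewrite lee_fin.
  - by apply/measurable_EFinP.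
  rewrite Ip Im -EFinD lee_fin /tpow t0 sub0r powRN (powRr1 (ltW t0)) invfM.
  by rewrite le_eqVlt; apply/orP; left; apply/eqP; ring.
under eq_Rintegral do rewrite JE.
by rewrite RintegralB// /Rintegral Ip Im subrr.
Qed.

End OneDimensionalInversion.

(** * Inversion for a function with a Hoelder modulus at 0 and decay at infinity *)

Section AbelInversion.
Context {R : realType}.
Local Notation RR := (measurableTypeR R).
Local Notation mu := (@lebesgue_measure R).
Variables (s d p A C M v0 : R) (v : R -> R).
Hypotheses (s01 : 0 < s < 1) (d01 : 0 < d <= 1) (sp : s < p).
Hypotheses (A0 : 0 <= A) (C0 : 0 <= C) (mv : measurable_fun setT v).
Hypothesis vA : forall t, 0 < t -> `|v t - v0| <= A * t `^ d.
Hypothesis vC : forall t, 0 < t -> `|v t| <= C * t `^ (- p).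
Hypothesis vM : forall t, 0 < t -> `|v t| <= M.

Let s0 : 0 < s. Proof. by case/andP: s01. Qed.
Let p0 : 0 < p. Proof. exact: lt_trans sp. Qed.
Let M0 : 0 <= M. Proof. exact: le_trans (vM ltr01). Qed.

(** Absolute integrability of [F] requires |vt t| / t to be integrable, so the value v0 at t = 0 is
    removed. The exponential is chosen for its explicit fractional integral, Gamma(s) e^(-r). *)
Let vt t : R := tpow 0 t * (v t - v0 * expR (- t)).

Let vtE t : 0 < t -> vt t = v t - v0 * expR (- t).
Proof. by move=> t0; rewrite /vt tpow0E t0 mul1r. Qed.

Let mvt : measurable_fun setT vt.
Proof.
apply: measurable_funM; first exact: measurable_tpow.
by apply: measurable_funB => //; apply: measurable_funM => //; exact: measurable_expRN.
Qed.

Let vtA t : 0 < t -> `|vt t| <= (A + `|v0|) * t `^ d.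
Proof.
move=> t0; rewrite vtE//; have /andP[d0 d1] := d01.
have e0 : 0 <= 1 - expR (- t) by rewrite subr_ge0 expR_le1 oppr_le0 ltW.
have h : 1 - expR (- t) <= t `^ d.
  have [t1|t1] := leP t 1.
    have h1 := expR_ge1Dx (- t).
    apply: (@le_trans _ _ t); first by lra.
    by rewrite -{1}(powRr1 (ltW t0)); apply: ger_powR => //; rewrite t0.
  apply: (@le_trans _ _ 1); first by rewrite gerBl expR_ge0.
  by rewrite -[leLHS](powRr0 t); apply: ler_powR => //; exact: ltW.
have -> : v t - v0 * expR (- t) = (v t - v0) + v0 * (1 - expR (- t)) by ring.
rewrite mulrDl; apply: le_trans (ler_normD _ _) (lerD (vA t0) _).
by rewrite normrM (ger0_norm e0) ler_wpM2l.
Qed.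

Let vtC t : 0 < t -> `|vt t| <= (C + `|v0| * p `^ p) * t `^ (- p).
Proof.
move=> t0; rewrite vtE// mulrDl; apply: le_trans (ler_normB _ _) (lerD (vC t0) _).
rewrite normrM (ger0_norm (expR_ge0 _)) -[leRHS]mulrA ler_wpM2l//.
exact: expR_le_powR.
Qed.

Let vtM t : `|vt t| <= M + `|v0|.
Proof.
have [t0|t0] := ltP 0 t; last first.
  by rewrite /vt tpow0E ltNge t0/= mul0r normr0 addr_ge0.
rewrite vtE//; apply: le_trans (ler_normB _ _) (lerD (vM t0) _).
by rewrite normrM (ger0_norm (expR_ge0 _)) ler_piMr// expR_le1 oppr_le0 ltW.
Qed.

Let integrable_shifted (w : R -> R) (B N r : R) : measurable_fun setT w -> 0 <= r ->
  0 <= B -> 0 <= N -> (forall t, 0 < t -> `|w t| <= N) -> (forall t, 0 < t -> `|w t| <= B * t `^ (- p)) ->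
  mu.-integrable setT (fun t => (tpow (s - 1) t * w (r + t))%:E).
Proof.
move=> mw r0 B0 N0 wN wB.
apply: (@integrable_mellin R (fun t => w (r + t)) s 0 (- p) N B) => //.
- by apply: measurableT_comp => //; exact: measurable_funD.
- by rewrite add0r.
- by rewrite addrC subr_lt0.
- by move=> t t0; rewrite powRr0 mulr1 wN// ltr_wpDl.
- move=> t t0; apply: le_trans (wB _ _) _; first by rewrite ltr_wpDl.
  by rewrite ler_wpM2l// ler_powRN ?(ltW p0)// lerDr.
Qed.

(** Integrated in r, it vanishes by [abel_difference]; integrated in t, a translation by r gives
    r^(-s-1) times an increment of the unnormalized fractional integral of [vt]. *)
Let F (x : RR * RR) : R :=
  tpow (- s - 1) x.2 * (tpow (s - 1) x.1 - tpow (s - 1) (x.1 - x.2)) * vt x.1.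

Let mF : measurable_fun setT F.
Proof.
have m1 : measurable_fun setT (fun x : RR * RR => x.1) by exact: measurable_fst.
have m2 : measurable_fun setT (fun x : RR * RR => x.2) by exact: measurable_snd.
apply: measurable_funM; last exact: (measurableT_comp mvt m1).
apply: measurable_funM; first exact: (measurableT_comp (measurable_tpow _) m2).
apply: measurable_funB; first exact: (measurableT_comp (measurable_tpow _) m1).
by apply: (measurableT_comp (measurable_tpow _)); exact: measurable_funB.
Qed.

Let g t : R := 2 / s * (tpow (0 - 1) t * `|vt t|).

Let ig : mu.-integrable setT (EFin \o g).
Proof.
apply: integrable_cstM.
apply: (@integrable_mellin R (fun t => `|vt t|) 0 d (- p) (A + `|v0|) (C + `|v0| * p `^ p)).
- exact: measurableT_comp.
- by rewrite addr_ge0.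
- by rewrite addr_ge0// mulr_ge0// powR_ge0.
- by rewrite addr0; case/andP: d01.
- by rewrite addr0 oppr_lt0.
- by move=> t t0; rewrite normr_id vtA.
- by move=> t t0; rewrite normr_id vtC.
Qed.

Let vt_le0 t : t <= 0 -> vt t = 0.
Proof. by move=> t0; rewrite /vt tpow0E ltNge t0/= mul0r. Qed.

Let mJ t : measurable_fun setT (fun r : RR => tpow (- s - 1) r * (tpow (s - 1) t - tpow (s - 1) (t - r))).
Proof.
apply: measurable_funM; first exact: measurable_tpow.
apply: measurable_funB; first exact: measurable_cst.
by apply: (measurableT_comp (measurable_tpow _)); exact: measurable_funB.
Qed.

Let Fg t : (\int[mu]_r `|F (t, r)|%:E <= (g t)%:E)%E.
Proof.
have [t0|t0] := ltP 0 t; last first.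
  by rewrite /F/g/= vt_le0//; under eq_integral do rewrite mulr0 normr0; rewrite integral0 normr0 !mulr0.
have [h _] := abel_difference s01 t0.
under eq_integral do rewrite /F/= normrM mulrC EFinM.
rewrite ge0_integralZl//; last first.
  by apply/measurable_EFinP; apply: measurableT_comp => //; exact: mJ.
rewrite /g; have -> : 2 / s * (tpow (0 - 1) t * `|vt t|) = `|vt t| * (2 / s * tpow (0 - 1) t) by ring.
by rewrite EFinM lee_wpmul2l// lee_fin.
Qed.

Let Fcol r : mu.-integrable setT (fun t => (F (t, r))%:E) /\
  \int[mu]_t F (t, r) = tpow (- s - 1) r *
    (\int[mu]_t (tpow (s - 1) t * vt t) - \int[mu]_t (tpow (s - 1) t * vt (r + t))).
Proof.
have [r0|r0] := ltP 0 r; last first.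
  have z : tpow (- s - 1) r = 0 by rewrite /tpow ltNge r0.
  rewrite z mul0r /F/= z; split.
    by rewrite (_ : (fun r => _) = cst 0%E); [exact: integrable0|apply/funext => t; rewrite !mul0r].
  by under eq_Rintegral do rewrite !mul0r; rewrite /Rintegral integral0.
have C' : 0 <= C + `|v0| * p `^ p by rewrite addr_ge0// mulr_ge0// powR_ge0.
have M' : 0 <= M + `|v0| by rewrite addr_ge0.
have i0 : mu.-integrable setT (EFin \o (fun t => tpow (s - 1) t * vt t)).
  have := @integrable_shifted vt _ _ 0 mvt (lexx _) C' M' (fun t _ => vtM t) vtC.
  by congr (integrable _ _ _); apply/funext => t /=; rewrite add0r.
have mr : measurable_fun setT (fun t : RR => tpow (s - 1) (t - r) * vt t).
  apply: measurable_funM => //; apply: (measurableT_comp (measurable_tpow _)).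
  exact: measurable_funB.
have ir : mu.-integrable setT (EFin \o (fun t => tpow (s - 1) (t - r) * vt t)).
  apply: (integrable_shift (r := r)) => //.
  have := @integrable_shifted vt _ _ r mvt (ltW r0) C' M' (fun t _ => vtM t) vtC.
  by congr (integrable _ _ _); apply/funext => t /=; rewrite [r + t]addrC addrK.
have FE t : F (t, r) = tpow (- s - 1) r * (tpow (s - 1) t * vt t - tpow (s - 1) (t - r) * vt t).
  by rewrite /F/=; ring.
have id : mu.-integrable setT (EFin \o (fun t => tpow (s - 1) t * vt t - tpow (s - 1) (t - r) * vt t)).
  have := integrableB measurableT i0 ir.
  by congr (integrable _ _ _); apply/funext => t /=; rewrite EFinB.
split.
  have := integrable_cstM (tpow (- s - 1) r) id.
  by congr (integrable _ _ _); apply/funext => t /=; rewrite FE.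
under eq_Rintegral do rewrite FE.
rewrite (RintegralZl _ measurableT id) (RintegralB measurableT i0 ir); congr (_ * (_ - _)).
rewrite -(Rintegral_shift r mr); apply: eq_Rintegral => t _.
by rewrite [r + t]addrC addrK.
Qed.

Let w r := \int[mu]_t (tpow (s - 1) t * v (r + t)).

Let wE r : 0 <= r ->
  \int[mu]_t (tpow (s - 1) t * vt (r + t)) = w r - v0 * Gamma s * expR (- r).
Proof.
move=> r0; have iv := integrable_shifted mv r0 C0 M0 vM vC.
have ie := integrable_cstM (v0 * expR (- r)) (integrable_euler s0).
have -> : v0 * Gamma s * expR (- r) = \int[mu]_t (v0 * expR (- r) * (tpow (s - 1) t * expR (- t))).
  rewrite RintegralZl//; last exact: integrable_euler.
  by rewrite -euler_integralE -Gamma_gt0E// mulrAC.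
rewrite -RintegralB//; apply: eq_Rintegral => t _.
rewrite /tpow; case: ifPn => [t0|_]; last by rewrite !mul0r mulr0 subr0.
rewrite vtE; last by rewrite ltr_wpDl.
by rewrite opprD expRD; ring.
Qed.

(* Up to the factor [Gamma s], [w] is the fractional integral of [v], and this inverts it.
   By [abel_difference] only the part [v0 * expR (- t)] of [v] contributes. *)
Lemma abel_inversion :
  mu.-integrable setT (EFin \o (fun r => tpow (- s - 1) r * (w 0 - w r))) /\
  \int[mu]_r (tpow (- s - 1) r * (w 0 - w r)) = Gamma s * `|Gamma (- s)| * v0.
Proof.
have h2 r : mu.-integrable setT (fun t => (F (t, r))%:E) by case: (Fcol r).
have L0 : \int[mu]_t \int[mu]_r F (t, r) = 0.
  under eq_Rintegral => t _.
    rewrite (_ : \int[mu]_r F (t, r) = 0); first by over.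
    have [t0|t0] := ltP 0 t; last first.
      by rewrite /F/= vt_le0//; under eq_Rintegral do rewrite mulr0; rewrite /Rintegral integral0.
    have [h hJ] := abel_difference s01 t0.
    rewrite /F/= RintegralZr ?hJ ?mul0r//.
    by apply: (integrable_ltyP _ h); exact: mJ.
  by rewrite /Rintegral integral0.
pose H r := tpow (- s - 1) r * (w 0 - w r).
have HE r : H r = \int[mu]_t F (t, r) + v0 * Gamma s * (tpow (- s - 1) r * (1 - expR (- r))).
  rewrite (Fcol r).2 /H; have [r0|r0] := ltP 0 r; last first.
    by rewrite /tpow ltNge r0/= !mul0r mulr0 addr0.
  rewrite (wE (ltW r0)); have := wE (lexx 0).
  by under eq_Rintegral do rewrite add0r; move=> ->; rewrite oppr0 expR0; ring.
have ie : mu.-integrable setT (EFin \o (fun r => tpow (- s - 1) r * (1 - expR (- r)))).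
  apply: (@integrable_ltyP R _ _ mu _ (Gamma (1 - s) / s)).
    apply: measurable_funM; first exact: measurable_tpow.
    by apply: measurable_funB => //; exact: measurable_expRN.
  rewrite -integral_tpow_expRN// le_eqVlt; apply/orP; left; apply/eqP/eq_integral => r _.
  rewrite ger0_norm// /tpow; case: ifPn => [r0|_]; last by rewrite mul0r.
  by rewrite mulr_ge0 ?powR_ge0// subr_ge0 expR_le1 oppr_le0 ltW.
have i1 := integrable_Rfubini2 mF ig Fg h2.
have i2 := integrable_cstM (v0 * Gamma s) ie.
have iH : mu.-integrable setT (EFin \o H).
  have := integrableD measurableT i1 i2.
  by congr (integrable _ _ _); apply/funext => r /=; rewrite HE EFinD.
split=> //; rewrite -/H; under eq_Rintegral do rewrite -/(H _) HE.
rewrite (RintegralD measurableT i1 i2).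
rewrite -(Rfubini mF ig Fg h2) L0 add0r RintegralZl// {1}/Rintegral integral_tpow_expRN//= Gamma_NE//.
by ring.
Qed.

End AbelInversion.

Lemma norm_increment_le (R : realFieldType) (L p q r : R) :
  `|p| <= L -> `|q| <= L -> `|r| <= L -> `|2 * p - q - r| <= 4 * L.
Proof. by rewrite !ler_norml; lra. Qed.

(** * The equation for the Riesz potential *)

Section SecondIncrement.
Context {R : realType} {n : nat}.
Local Notation RR := (measurableTypeR R).
Implicit Types (x y : 'rV[R]_n) (u : 'rV[R]_n -> R).

(** The sign is that of u(x) - u(z) in the fractional Laplacian, opposite to the Zygmund
    seminorm. *)
Definition second_increment u x y : R := 2 * u x - u (x + y) - u (x - y).

Lemma measurable_affine L u x e : mbounded L u ->
  measurable_fun setT (fun z : n.-tuple RR => u (rvec (taffine x e z))).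
Proof. by move=> bu; exact: (measurableT_comp bu.1 (measurable_taffine x e)). Qed.

Lemma second_increment_bounded L u x : mbounded L u -> mbounded (4 * L) (second_increment u x).
Proof.
move=> bu; split; last by move=> y; apply: norm_increment_le; exact: bu.2.
apply: measurable_funB; last by under eq_fun do rewrite rvec_sub; exact: (measurable_affine x true bu).
by apply: measurable_funB => //; under eq_fun do rewrite rvec_add; exact: (measurable_affine x false bu).
Qed.

End SecondIncrement.

(** * The equation in symmetrized form *)

Section SemigroupOfRiesz.
Context {R : realType} {n : nat}.
Local Notation RR := (measurableTypeR R).
Local Notation mu := (@lebesgue_measure R).
Local Notation leb := (@lebRn R n).
Implicit Types (x y : 'rV[R]_n) (t r : R).
Local Notation G := (@heat_kernel R n).
Local Notation P := (@heat_semigroup R n).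
Local Opaque heat_kernel heat_semigroup riesz_deriv.

Variables (a s M A K : R) (f : 'rV[R]_n -> R).
Hypotheses (a0 : 0 < a) (s01 : 0 < s < 1) (sn : s < n%:R / 2).
Hypothesis domf : dominated a M A K f.

Local Notation u := (riesz_deriv s [::] f).

Let s0 : 0 < s. Proof. by case/andP: s01. Qed.
Let bf : mbounded M f. Proof. by case: domf. Qed.
Let A0 : 0 <= A. Proof. by case: domf. Qed.

Let size0 : (size (Nil 'I_n))%:R < a + 2 * s.
Proof. by rewrite /= addr_gt0// mulr_gt0. Qed.

Lemma riesz_bounded : exists L, mbounded L u.
Proof.
have [_ _ hf K0 fK] := domf.
have [L uL] := riesz_deriv_bounded a0 s0 sn bf A0 hf K0 fK size0.
exists L; apply: continuous_mbounded => //.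
exact: (continuous_riesz_deriv s0 sn a0 domf size0).
Qed.

Let semigroup_decay : exists2 C, 0 <= C & forall t x, 0 < t -> `|P t f x| <= C * t `^ (- (n%:R / 2)).
Proof.
have [_ _ hf K0 fK] := domf.
have [B [C [B0 C0 H]]] := heat_deriv_bounds [::] a0 bf A0 hf K0 fK.
exists C => // t x t0; have [_] := H t x t0.
by rewrite /heat_deriv t0 /= mul0r oppr0 add0r.
Qed.

Let semigroup_bound t x : 0 < t -> `|P t f x| <= M.
Proof. by move=> t0; exact: heat_semigroup_bound. Qed.

Let measurable_semigroup x : measurable_fun setT (fun t : RR => P t f x).
Proof.
rewrite -(vtupK x).
exact: (measurable_heat_semigroup bf.1 (tau := id) (xi := fun=> vtup x)).
Qed.

Lemma rieszE x : u x = (Gamma s)^-1 * \int[mu]_t (tpow (s - 1) t * P t f x).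
Proof.
Local Transparent riesz_deriv.
rewrite /riesz_deriv; congr (_ * _); apply: eq_Rintegral => t _.
by rewrite /heat_deriv /tpow; case: ifP => //; rewrite !mul0r.
Qed.
Local Opaque riesz_deriv.

Let M0 : 0 <= M. Proof. exact: mbounded_ge0 bf. Qed.

(** Uniform in x, so that N G_r(x - z) dominates when P_r is exchanged with the time integral. *)
Let mellin_semigroup : exists N : R, forall x,
  (\int[mu]_t `|tpow (s - 1) t * P t f x|%:E <= N%:E)%E.
Proof.
have [C C0 H] := semigroup_decay.
eexists; move=> x; apply: (mellin_bound (measurable_semigroup x) ltr01 M0 C0 (p := 0) (q := - (n%:R / 2))).
- by rewrite add0r.
- by rewrite addrC subr_lt0.
- by move=> t /andP[t0 _]; rewrite powRr0 mulr1 semigroup_bound.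
- by move=> t t1; apply: H; exact: lt_le_trans t1.
Qed.

(** Fubini moves P_r inside the time integral, where the semigroup law applies. *)
Lemma heat_semigroup_riesz r x : 0 < r ->
  P r u x = (Gamma s)^-1 * \int[mu]_t (tpow (s - 1) t * P (r + t) f x).
Proof.
move=> r0; have [N HN] := mellin_semigroup.
pose F (p : n.-tuple RR * RR) := G r (x - rvec p.1) * (tpow (s - 1) p.2 * P p.2 f (rvec p.1)).
have mF : measurable_fun setT F.
  apply: measurable_funM; first by apply: (measurableT_comp (measurable_kernel_sub r x)); exact: measurable_fst.
  apply: measurable_funM; first by apply: (measurableT_comp (measurable_tpow _)); exact: measurable_snd.
  by apply: (measurable_heat_semigroup bf.1); [exact: measurable_snd|exact: measurable_fst].
have ig : leb.-integrable setT (EFin \o (fun z => N * G r (x - rvec z))).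
  by apply: integrable_cstM; exact: integrable_kernel_sub.
have mw y : measurable_fun setT (fun t : RR => tpow (s - 1) t * P t f y).
  by apply: measurable_funM; [exact: measurable_tpow|exact: measurable_semigroup].
have Fg (z : n.-tuple RR) : (\int[mu]_t `|F (z, t)|%:E <= (N * G r (x - rvec z))%:E)%E.
  rewrite /F/=; under eq_integral do rewrite normrM (ger0_norm (heat_kernel_ge0 _ _)) EFinM.
  rewrite ge0_integralZl//; last 2 first.
  - by apply/measurable_EFinP; apply: measurableT_comp => //; exact: mw.
  - by rewrite lee_fin heat_kernel_ge0.
  rewrite [leRHS](_ : _ = ((G r (x - rvec z))%:E * N%:E)%E); last by rewrite -EFinM mulrC.
  by apply: lee_wpmul2l; [rewrite lee_fin heat_kernel_ge0|exact: HN].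
have FE (z : n.-tuple RR) t : F (z, t) = tpow (s - 1) t * (G r (x - rvec z) * P t f (rvec z)).
  by rewrite /F/= mulrCA.
have it t : 0 < t -> leb.-integrable setT (EFin \o (fun z => G r (x - rvec z) * P t f (rvec z))).
  by move=> t0; apply: integrable_kernelM r0 (mbounded_heat_semigroup t0 bf).
have h2 t : leb.-integrable setT (fun z => (F (z, t))%:E).
  have [t0|t0] := ltP 0 t; last first.
    rewrite (_ : (fun z => _) = cst 0%E); first exact: integrable0.
    by apply/funext => z; rewrite FE /tpow ltNge t0 mul0r.
  have := integrable_cstM (tpow (s - 1) t) (it t t0).
  by congr (integrable _ _ _); apply/funext => z /=; rewrite FE.
have L : P r u x = (Gamma s)^-1 * \int[leb]_z \int[mu]_t F (z, t).
  rewrite heat_semigroupE -RintegralZl//; last exact: (integrable_Rfubini1 mF ig Fg).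
  apply: eq_Rintegral => z _; rewrite rieszE /F/= RintegralZl//; first by rewrite mulrCA.
  exact: (integrable_ltyP (mw _) (HN _)).
rewrite {}L (Rfubini mF ig Fg h2); congr (_ * _); apply: eq_Rintegral => t _.
have [t0|t0] := ltP 0 t; last first.
  rewrite [tpow _ t](_ : _ = 0) ?mul0r; last by rewrite /tpow ltNge t0.
  by rewrite /Rintegral integral0_eq// => z _; rewrite FE /tpow ltNge t0 mul0r.
under eq_Rintegral do rewrite FE.
rewrite (RintegralZl _ measurableT (it t t0)); congr (_ * _).
by rewrite -heat_semigroupE (heat_semigroup_comp x r0 t0 bf).
Qed.

(** The inversion formula for v(t) = P_t f(x), with v0 = f(x), d = a/2 and p = n/2; its factor
    Gamma(s) cancels against the normalization of u. *)
Lemma Rintegral_tpow_riesz x : a <= 1 ->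
  \int[mu]_r (tpow (- s - 1) r * (u x - P r u x)) = `|Gamma (- s)| * f x.
Proof.
move=> a1; have [C C0 H] := semigroup_decay.
have [_ _ hf _ _] := domf.
have a20 : 0 < a / 2 <= 1 by rewrite divr_gt0//= ler_pdivrMr//; lra.
have [D D0 HD] := @heat_semigroup_approx R n a a0.
have DA : 0 <= D * A by rewrite mulr_ge0// ltW.
have hA t : 0 < t -> `|P t f x - f x| <= D * A * t `^ (a / 2).
  by move=> t0; rewrite mulrAC; exact: HD bf hf.
have G0 := Gamma_gt0 s0.
have w0 : \int[mu]_t (tpow (s - 1) t * P (0 + t) f x) = \int[mu]_t (tpow (s - 1) t * P t f x).
  by apply: eq_Rintegral => t _; rewrite add0r.
have [] := abel_inversion s01 a20 sn DA C0 (measurable_semigroup x) hA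
  (fun t => H t x) (fun t => @semigroup_bound t x).
rewrite {}w0.
set W := fun r => tpow _ r * _ => iw E.
have WE r : tpow (- s - 1) r * (u x - P r u x) = (Gamma s)^-1 * W r.
  rewrite /W; clear W iw E.
  have [r0|r0] := ltP 0 r; last by rewrite /tpow ltNge r0/= !mul0r mulr0.
  rewrite (heat_semigroup_riesz x r0) (rieszE x).
  move: (\int[mu]_t _) (\int[mu]_t _) (tpow _ r) => c2 c3 c4; clear -G0; ring.
transitivity (\int[mu]_r ((Gamma s)^-1 * W r)); first by apply: eq_Rintegral => r _; exact: WE.
clearbody W; clear WE.
rewrite (RintegralZl _ measurableT iw) E -mulrA mulKf//.
exact: lt0r_neq0.
Qed.

Variables (L : R) (x : 'rV[R]_n).
Hypotheses (a1 : a <= 1) (bu : mbounded L u).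

Local Notation q := (second_increment u x).

Let measurable_rvec_affine e :
  measurable_fun setT (fun z : n.-tuple RR => u (rvec (taffine x e z))).
Proof. exact: (measurable_affine x e bu). Qed.

(** The kernel is even, so u(x + z) and u(x - z) have the same average P_r u(x). *)
Lemma Rintegral_kernel_increment r : 0 < r ->
  \int[leb]_z (G r (rvec z) * q (rvec z)) = 2 * (u x - P r u x).
Proof.
move=> r0.
have i0 e : leb.-integrable setT (EFin \o (fun z => G r (rvec z) * u (rvec (taffine x e z)))).
  apply: (@integrable_le _ _ _ leb setT _ (fun z => L * G r (rvec z))) => //.
  - by apply: measurable_funM; [exact: measurable_kernel|exact: measurable_rvec_affine].
  - move=> z _; rewrite normrM (ger0_norm (heat_kernel_ge0 _ _)) mulrC.
    by rewrite ler_wpM2r ?heat_kernel_ge0// bu.2.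
  - by apply: integrable_cstM; exact: integrable_kernel.
have I1 : \int[leb]_z (G r (rvec z) * u (rvec (taffine x true z))) = P r u x.
  by rewrite (heat_semigroupE' _ _ bu); apply: eq_Rintegral => z _; rewrite rvec_sub.
have I2 : \int[leb]_z (G r (rvec z) * u (rvec (taffine x false z))) = P r u x.
  have mF : measurable_fun setT (fun z : n.-tuple RR => G r (rvec z) * u (x + rvec z)).
    apply: measurable_funM; first exact: measurable_kernel.
    by under eq_fun do rewrite rvec_add; exact: measurable_rvec_affine.
  have h := @Rintegral_sub R n 0 (fun y => G r y * u (x + y)) mF.
  transitivity (\int[leb]_z (G r (rvec z) * u (x + rvec z))).
    by apply: eq_Rintegral => z _; rewrite rvec_add.
  rewrite -{}h -I1; apply: eq_Rintegral => z _.
  by rewrite sub0r heat_kernelN -rvec_sub.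
have ik := integrable_cstM (2 * u x) (integrable_kernel (n := n) r0).
have iB := integrableB measurableT ik (i0 false).
transitivity (\int[leb]_z (2 * u x * G r (rvec z) - G r (rvec z) * u (rvec (taffine x false z))
    - G r (rvec z) * u (rvec (taffine x true z)))).
  apply: eq_Rintegral => z _; rewrite /second_increment -rvec_sub -rvec_add.
  move: (G _ _) (u _) (u _) (u _) => c1 c2 c3 c4; ring.
have E1 := RintegralB measurableT iB (i0 true).
have E2 := RintegralB measurableT ik (i0 false).
have E3 : \int[leb]_z (2 * u x * G r (rvec z)) = 2 * u x * 1.
  rewrite (RintegralZl _ measurableT (integrable_kernel r0)); congr (_ * _).
  by rewrite /Rintegral integral_heat_kernel.
apply: (eq_trans E1); apply: (eq_trans (f_equal2 (fun c d => c - d)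
  (eq_trans E2 (f_equal2 (fun c d => c - d) E3 I2)) I1)).
by move: (u x) (P r u x) => c1 c2; ring.
Qed.

(** Subordination and inversion meet: [jump_cst s] times half the jump integral of the increment
    equals |Gamma(-s)| f(x), and dividing by |Gamma(-s)| restores [c_ns]. *)
Lemma Rintegral_increment (b D : R) : 2 * s < b -> 0 <= D ->
  (forall y, `|q y| <= D * enorm y `^ b) ->
  @c_ns R n s * (2^-1 * \int[leb]_z (q (rvec z) / enorm (rvec z) `^ (n%:R + 2 * s))) = f x.
Proof.
move=> sb D0 Dq.
have iI := integrable_tpow_kernel s0 sb D0 (second_increment_bounded x bu) Dq.
have E := RintegralZl 2^-1 measurableT iI.
rewrite -(Rintegral_jump s0 sb D0 (second_increment_bounded x bu) Dq) in E.
have E' : `|Gamma (- s)| * f x = 2^-1 * (@jump_cst R n s *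
    \int[leb]_z (q (rvec z) / enorm (rvec z) `^ (n%:R + 2 * s))).
  apply: (eq_trans _ E); rewrite -(Rintegral_tpow_riesz x a1); apply: eq_Rintegral => r _.
  have [r0|r0] := ltP 0 r; last by rewrite /tpow ltNge r0/= !mul0r mulr0.
  by rewrite (Rintegral_kernel_increment r0) mulrCA mulKf.
have G0 : `|Gamma (- s)| != 0.
  by rewrite Gamma_NE// gt_eqF// divr_gt0// Gamma_gt0// subr_gt0; case/andP: s01.
have p0 : pi `^ (n%:R / 2) != 0 :> R by rewrite gt_eqF// powR_gt0// pi_gt0.
apply: (mulfI G0); rewrite {}E' /c_ns /jump_cst.
move: (Rintegral _ _ _) G0 p0 => I G0 p0.
by field; rewrite p0 G0.
Qed.

Lemma second_increment_le : exists b D : R,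
  [/\ 2 * s < b, 0 <= D & forall y, `|q y| <= D * enorm y `^ b].
Proof.
have s1 : s < 1 by case/andP: s01.
(* Keeps c + 2s <= 1 + s < 2, the range of second differences for u itself, while c > 0 leaves an
   order above 2s. *)
pose c := Num.min a (1 - s).
have c0 : 0 < c by rewrite lt_min a0 subr_gt0.
have ca : 0 < c <= a by rewrite c0 ge_min lexx.
have c1 : c + 2 * s < 2.
  have : c <= 1 - s by rewrite ge_min lexx orbT.
  move=> cs; apply: (@le_lt_trans _ _ (1 - s + 2 * s)); first by rewrite lerD2r.
  by rewrite (_ : 1 - s + 2 * s = 1 + s) ?ltrD2l//; ring.
have dc := dominated_lower ca domf.
have rng : (size (Nil 'I_n))%:R < c + 2 * s < (size (Nil 'I_n)).+2%:R.
  by rewrite /= c1 addr_gt0// mulr_gt0.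
have [C C0 HC] := riesz_second_difference c0 s0 sn rng.
exists (c + 2 * s), (C * (A + 2 * M)); split.
- by rewrite ltrDr.
- by rewrite mulr_ge0 ?(ltW C0)// addr_ge0// mulr_ge0.
move=> y; have [->|y0] := eqVneq y 0.
  rewrite /second_increment addr0 subr0 -addrA -opprD -mulr2n mulr_natl subrr normr0.
  by rewrite mulr_ge0 ?powR_ge0// mulr_ge0 ?(ltW C0)// addr_ge0// mulr_ge0.
have := HC _ _ _ _ dc x y y0; rewrite /= subr0 => h; apply: le_trans h.
rewrite /second_increment -normrN; move: (u _) (u _) (u _) => p1 p2 p3.
rewrite le_eqVlt; apply/orP; left; apply/eqP; congr `|_|; ring.
Qed.

End SemigroupOfRiesz.

(** * Truncation and the principal value *)

Section TruncatedIntegral.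
Context {R : realType} {n : nat}.
Local Notation RR := (measurableTypeR R).
Local Notation leb := (@lebRn R n).
Implicit Types (x y : 'rV[R]_n) (e : R) (u q : 'rV[R]_n -> R).
Variable s : R.
Hypothesis s0 : 0 < s.

Definition cut e y : R := tpow 0 (enorm y - e).

Lemma cutE e y : cut e y = (e < enorm y)%R%:R.
Proof. by rewrite /cut tpow0E subr_gt0. Qed.

Lemma cut_ge0 e y : 0 <= cut e y. Proof. exact: tpow_ge0. Qed.

Lemma cut_le1 e y : cut e y <= 1.
Proof. by rewrite cutE; case: (_ < _). Qed.

Lemma cut_le e e' y : e <= e' -> cut e' y <= cut e y.
Proof.
move=> ee; rewrite !cutE; case: (ltP e') => // h.
by rewrite (le_lt_trans ee h).
Qed.

Lemma measurable_cut e : measurable_fun setT (fun z : n.-tuple RR => cut e (rvec z)).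
Proof.
apply: (measurableT_comp (measurable_tpow _)); apply: measurable_funB => //.
exact: measurable_enorm.
Qed.

Lemma mbounded_cut L e q : mbounded L q -> mbounded L (fun y => cut e y * q y).
Proof.
move=> bq; split; first by apply: measurable_funM; [exact: measurable_cut|exact: bq.1].
move=> y; rewrite normrM (ger0_norm (cut_ge0 _ _)); apply: le_trans (bq.2 y).
by rewrite ler_piMl// cut_le1.
Qed.

Local Notation kint q :=
  (\int[leb]_z (q (rvec z) / enorm (rvec z) `^ (n%:R + 2 * s))).

(** Where |y| > e a bounded function is trivially O(|y|^(2s+1)), so the cut-off function falls under
    [integrable_jump]. *)
Lemma integrable_cut L e q : 0 < e -> mbounded L q -> leb.-integrable setT
  (EFin \o (fun z => cut e (rvec z) * q (rvec z) / enorm (rvec z) `^ (n%:R + 2 * s))).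
Proof.
move=> e0 bq; have L0 := mbounded_ge0 bq.
have b1 : 2 * s < 2 * s + 1 by rewrite ltrDl.
have D0 : 0 <= L / e `^ (2 * s + 1) by rewrite divr_ge0 ?powR_ge0.
apply: (integrable_jump s0 b1 D0 (mbounded_cut e bq)) => y.
rewrite normrM (ger0_norm (cut_ge0 _ _)) cutE; case: ltP => [ey|_]; last first.
  by rewrite mul0r mulr_ge0 ?powR_ge0.
rewrite mul1r; apply: le_trans (bq.2 y) _; rewrite -mulrA ler_peMr//.
rewrite mulrC ler_pdivlMr ?powR_gt0// mul1r ge0_ler_powR ?nnegrE ?addr_ge0 ?mulr_ge0 ?enorm_ge0 ?(ltW e0) ?(ltW s0)//.
exact: ltW.
Qed.

Lemma mbounded_sub L u x : mbounded L u -> mbounded L (fun y => u (x - y)).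
Proof.
move=> bu; split; last by move=> y; exact: bu.2.
by under eq_fun do rewrite rvec_sub; exact: (measurable_affine x true bu).
Qed.

Lemma mbounded_add L u x : mbounded L u -> mbounded L (fun y => u (x + y)).
Proof.
move=> bu; split; last by move=> y; exact: bu.2.
by under eq_fun do rewrite rvec_add; exact: (measurable_affine x false bu).
Qed.

Lemma measurable_invpow : measurable_fun setT
  (fun z : n.-tuple RR => (enorm (rvec z) `^ (n%:R + 2 * s))^-1).
Proof.
apply: (measurableT_comp measurable_inv); apply: (measurableT_comp (measurable_powR _)).
exact: measurable_enorm.
Qed.

Lemma truncated_integralE L u x e : mbounded L u ->
  truncated_integral s u x e = kint (fun y => cut e y * (u x - u (x - y))).
Proof.
move=> bu; pose Q y := cut e y * (u x - u (x - y)) / enorm y `^ (n%:R + 2 * s).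
have mQ : measurable_fun setT (fun z : n.-tuple RR => Q (rvec z)).
  apply: measurable_funM; last exact: measurable_invpow.
  apply: measurable_funM; first exact: measurable_cut.
  by apply: measurable_funB => //; exact: (mbounded_sub x bu).1.
rewrite -[RHS](Rintegral_sub x mQ) /truncated_integral /intRn Rintegral_mkcond.
apply: eq_Rintegral => z _; rewrite patchE /Q subKr cutE.
rewrite (_ : (z \in _) = (e < enorm (x - rvec z))); last first.
  by apply/idP/idP; rewrite inE.
by case: ifP; rewrite ?mul1r// !mul0r.
Qed.

(** The domain and the kernel are even, so y and -y may be averaged; this trades the first
    difference of u for a second one, whose order at 0 can exceed 2s. *)
Lemma truncated_integral_sym L u x e : 0 < e -> mbounded L u ->
  truncated_integral s u x e = 2^-1 * kint (fun y => cut e y * second_increment u x y).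
Proof.
move=> e0 bu; have bc := mbounded_cst (n := n) (u x).
have bm := mboundedB bc (mbounded_sub x bu); have bp := mboundedB bc (mbounded_add x bu).
have im := integrable_cut e0 bm; have ip := integrable_cut e0 bp.
have mp : measurable_fun setT (fun z : n.-tuple RR =>
    cut e (rvec z) * (u x - u (x + rvec z)) / enorm (rvec z) `^ (n%:R + 2 * s)).
  by case/integrableP: ip => /measurable_EFinP.
have E : kint (fun y => cut e y * (u x - u (x - y))) = kint (fun y => cut e y * (u x - u (x + y))).
  rewrite -[RHS](@Rintegral_sub R n 0 (fun y => cut e y * (u x - u (x + y)) / enorm y `^ (n%:R + 2 * s)) mp).
  by apply: eq_Rintegral => z _; rewrite sub0r /cut enormN.
have S : kint (fun y => cut e y * second_increment u x y) =
    kint (fun y => cut e y * (u x - u (x - y))) + kint (fun y => cut e y * (u x - u (x + y))).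
  rewrite -(RintegralD measurableT im ip); apply: eq_Rintegral => z _.
  by rewrite /second_increment; ring.
by rewrite (truncated_integralE x e bu) S -E; field.
Qed.

Lemma truncated_integral_error L u x (b D : R) : mbounded L u -> 2 * s < b -> 0 <= D ->
  (forall y, `|second_increment u x y| <= D * enorm y `^ b) ->
  exists c N : R, 0 < c /\ forall e, 0 < e <= 1 ->
    `|truncated_integral s u x e - 2^-1 * kint (second_increment u x)| <= N * e `^ c.
Proof.
move=> bu sb D0 Dq; set q := second_increment u x; have bq := second_increment_bounded x bu.
(* Strictly between 2s and b: for |y| <= e one has |y|^b <= e^(b-d) |y|^d, and |y|^d near 0 is still
   integrable against the jump kernel. The error is thus a power of e, without polar coordinates. *)
pose d := (b + 2 * s) / 2.
have [sd db] : 2 * s < d /\ d < b by rewrite /d; split; lra.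
have d0 : 0 < d by apply: lt_trans sd; rewrite mulr_gt0.
pose w y := (1 - cut 1 y) * enorm y `^ d.
have w0 y : 0 <= w y by rewrite mulr_ge0 ?powR_ge0// subr_ge0 cut_le1.
have bw : mbounded 1 w.
  split.
    apply: measurable_funM; first by apply: measurable_funB => //; exact: measurable_cut.
    by apply: (measurableT_comp (measurable_powR _)); exact: measurable_enorm.
  move=> y; rewrite ger0_norm// /w cutE; case: ltP => [_|y1]; first by rewrite subrr mul0r.
  rewrite subr0 mul1r; have -> : 1 = 1 `^ d :> R by rewrite powR1.
  by rewrite ge0_ler_powR ?nnegrE ?enorm_ge0// ltW.
have Dw y : `|w y| <= 1 * enorm y `^ d.
  by rewrite ger0_norm// /w ler_wpM2r ?powR_ge0// gerBl cut_ge0.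
have iw := integrable_jump s0 sd ler01 bw Dw.
have iq := integrable_jump s0 sb D0 bq Dq.
exists (b - d), (2^-1 * (D * kint w)); split; first by rewrite subr_gt0.
move=> e /andP[e0 e1].
have ic := integrable_cut e0 bq.
rewrite (truncated_integral_sym x e0 bu) -mulrBr normrM ger0_norm// -!mulrA ler_wpM2l//.
rewrite -(RintegralB measurableT ic iq).
have iB := integrableB measurableT ic iq.
apply: (le_trans (le_normr_Rintegral measurableT iB)).
have -> : D * (kint w * e `^ (b - d)) = (D * e `^ (b - d)) * kint w by ring.
rewrite -(RintegralZl _ measurableT iw).
apply: le_Rintegral => //.
- exact: (integrable_norm iB).
- exact: integrable_cstM.
move=> z _; move: (rvec z) => y; rewrite -mulrBl normrM (ger0_norm (_ : 0 <= _^-1)); last first.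
  by rewrite invr_ge0 powR_ge0.
rewrite [leRHS]mulrA ler_wpM2r ?invr_ge0 ?powR_ge0//.
rewrite -[X in _ - X]mul1r -mulrBl cutE /w; case: ltP => [_|ye].
  by rewrite subrr mul0r normr0 !mulr_ge0 ?powR_ge0// subr_ge0 cut_le1.
rewrite sub0r mulN1r normrN cutE ltNge (le_trans ye e1)/= subr0 mul1r.
apply: le_trans (Dq y) _; rewrite -mulrA ler_wpM2l//.
have [->|y0] := eqVneq y 0.
  by rewrite enorm0 powR0 ?mulr_ge0 ?powR_ge0// gt_eqF// (lt_trans d0).
rewrite -{1}(subrK d b) (gt0_powRD _ _ (enorm_gt0 y0)) ler_wpM2r ?powR_ge0//.
by rewrite ge0_ler_powR ?nnegrE ?enorm_ge0 ?subr_ge0 ?(ltW db) ?(ltW e0).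
Qed.

Lemma cvg_truncated_integral L u x (b D : R) : mbounded L u -> 2 * s < b -> 0 <= D ->
  (forall y, `|second_increment u x y| <= D * enorm y `^ b) ->
  truncated_integral s u x e @[e --> 0^'+] --> 2^-1 * kint (second_increment u x).
Proof.
move=> bu sb D0 Dq; have [c [N [c0 H]]] := truncated_integral_error bu sb D0 Dq.
set l := 2^-1 * _.
have h : (truncated_integral s u x e - l) @[e --> 0^'+] --> 0.
  apply: norm_cvg0; apply: (@squeeze_cvgr _ _ _ _ (fun=> 0) (fun e => N * e `^ c)).
  - near=> e; rewrite normr_ge0/=; apply: H; apply/andP; split.
      by near: e; exact: nbhs_right_gt.
    by near: e; exact: nbhs_right_le.
  - exact: cvg_cst.
  - by rewrite -[X in _ --> X](mulr0 N); apply: cvgM; [exact: cvg_cst|exact: powR_cvg0].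
exact/subr_cvg0.
Unshelve. all: by end_near. Qed.

End TruncatedIntegral.

(** * The potential is a classical solution vanishing at infinity *)

Section Existence.
Context {R : realType} {n : nat}.
Local Notation RR := (measurableTypeR R).
Local Notation leb := (@lebRn R n).
Implicit Types (x y : 'rV[R]_n).
Local Notation G := (@heat_kernel R n).
Local Opaque heat_kernel heat_semigroup riesz_deriv truncated_integral.

Variables (a s M A K : R) (f : 'rV[R]_n -> R).
Hypotheses (a0 : 0 < a) (a1 : a <= 1) (s01 : 0 < s < 1) (sn : s < n%:R / 2).
Hypothesis domf : dominated a M A K f.

Local Notation u := (riesz_deriv s [::] f).

Let s0 : 0 < s. Proof. by case/andP: s01. Qed.
Let s1 : s < 1. Proof. by case/andP: s01. Qed.

Lemma frac_laplacian_riesz x :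
  cvg (truncated_integral s u x e @[e --> 0^'+]) /\ frac_laplacian s u x = f x.
Proof.
have [L bu] := riesz_bounded a0 s01 sn domf.
have [b [D [sb D0 Dq]]] := second_increment_le a0 s01 sn domf x.
have h := cvg_truncated_integral s0 bu sb D0 Dq.
split; first by apply/cvg_ex; eexists; exact: h.
rewrite /frac_laplacian (cvg_lim (@Rhausdorff R) h).
exact: (Rintegral_increment a0 s01 sn domf a1 bu sb D0 Dq).
Qed.

Lemma riesz_classical_solution : classical_solution s u f.
Proof.
split; last exact: frac_laplacian_riesz.
(* The exponent alpha is lowered to some e with 2s + e strictly below 1 (if s < 1/2) or below 2,
   since the Hoelder estimate excludes integers. *)
have aux (c e : R) : 0 < c -> e = Num.min a c -> 0 < e <= a /\ e <= c.
  by move=> c0 ->; rewrite lt_min a0 c0 !ge_min !lexx orbT.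
have [sh|sh] := ltP s (1 / 2).
  have c0 : 0 < (1 - 2 * s) / 2 by lra.
  have [ea ec] := aux _ _ c0 erefl; set e := Num.min _ _ in ea ec.
  have e0 : 0 < e by case/andP: ea.
  have e1 : 2 * s + e < 1 by lra.
  exists e; split=> //; split; first exact: ltW.
  have rng : 0%:R < e + 2 * s < 1%:R by rewrite [e + _]addrC e1 addr_gt0// mulr_gt0.
  have := in_Ch_riesz s0 sn e0 (dominated_lower ea domf) rng.
  by rewrite subr0 addrC.
have c0 : 0 < (2 - 2 * s) / 2 by move: (s1); lra.
have [ea ec] := aux _ _ c0 erefl; set e := Num.min _ _ in ea ec.
have e0 : 0 < e by case/andP: ea.
have e1 : 2 * s + e < 2 by move: (s1); lra.
exists e; split=> //; split; first by rewrite lerBlDr; exact: ltW.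
have rng : 1%:R < e + 2 * s < 2%:R by rewrite [e + _]addrC e1 andbT; lra.
have := in_Ch_riesz s0 sn e0 (dominated_lower ea domf) rng.
by rewrite [e + _]addrC.
Qed.

Lemma bounded_fun_riesz : bounded_fun u.
Proof.
have [L bu] := riesz_bounded a0 s01 sn domf.
exists L; split; first exact: num_real.
by move=> r Nr x _ /=; apply: le_trans (bu.2 x) (ltW Nr).
Qed.

Lemma riesz_decay : exists c b : R, [/\ 0 < c, 0 < b &
  forall x, x != 0 -> `|u x| <= c * enorm x `^ (- b)].
Proof.
have [bf A0 hf K0 fK] := domf.
(* Half of the natural rate n - 2s. The power of t that is left, q = b/2 - n/2, then satisfies q + s
   = (s - n/2)/2 < 0, so the time integral converges. *)
pose b := n%:R / 2 - s; have b0 : 0 < b by rewrite subr_gt0.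
have [C C0 HC] := @heat_kernel_decay R n b b0.
pose q := b / 2 - n%:R / 2.
have qs : q + s < 0 by rewrite /q /b; move: (n%:R / 2) (sn) => m ?; lra.
have q0 : q < 0 by move: s0; lra.
pose c := (Gamma s)^-1 * (K * C * (1 / s + 1 / - (q + s))).
have Gi : 0 <= (Gamma s)^-1 by rewrite invr_ge0 ltW// Gamma_gt0.
have Z : 0 <= 1 / s + 1 / - (q + s).
  rewrite addr_ge0 ?divr_ge0//; first exact: ltW.
  by rewrite oppr_ge0 ltW.
have KC : 0 <= K * C by rewrite mulr_ge0// ltW.
have c0 : 0 <= c by rewrite mulr_ge0// mulr_ge0.
exists (c + 1), b; split => //.
  by rewrite ltr_wpDl.
move=> x x0; apply: (@le_trans _ _ (c * enorm x `^ (- b))); last first.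
  by rewrite ler_wpM2r ?powR_ge0// lerDl.
rewrite (rieszE s f x) normrM (ger0_norm Gi).
rewrite /c -!mulrA ler_wpM2l//.
pose B := K * C * enorm x `^ (- b).
have B0 : 0 <= B by rewrite !mulr_ge0 ?powR_ge0 ?(ltW C0).
(* The shift by 1 serves both ends: (t + 1)^q is at most 1 and at most t^q. *)
have bd t : 0 < t -> `|heat_semigroup t f x| <= B * (t + 1) `^ q.
  move=> t0; apply: (le_trans (heat_semigroup_le_kernel x t0 bf K0 fK)).
  have t1 : 0 < t + 1 by rewrite addr_gt0.
  rewrite /B -!mulrA ler_wpM2l// mulrA; exact: HC.
have mw : measurable_fun setT (fun t : RR => heat_semigroup t f x).
  rewrite -(vtupK x).
  exact: (measurable_heat_semigroup bf.1 (tau := id) (xi := fun=> vtup x)).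
have qmono (v w : R) : 0 < v -> v <= w -> w `^ q <= v `^ q.
  by move=> v0 vw; rewrite -[q]opprK; apply: ler_powRN => //; rewrite oppr_ge0 ltW.
have s00 : 0 < 0 + s by rewrite add0r.
apply: (le_trans (mellin_le mw B0 B0 s00 qs _ _ ltr01)).
- move=> t t0; apply: (le_trans (bd t t0)); rewrite ler_wpM2l// powRr0.
  apply: (@le_trans _ _ (1 `^ q)); last by rewrite powR1.
  by apply: qmono => //; rewrite lerDr ltW.
- move=> t t0; apply: (le_trans (bd t t0)); rewrite ler_wpM2l//.
  by apply: qmono => //; rewrite lerDl.
- rewrite !powR1 add0r /B le_eqVlt; apply/orP; left; apply/eqP; ring.
Qed.

Lemma vanishes_riesz : vanishes_at_infinity u.
Proof.
have [c [b [c0 b0 H]]] := riesz_decay.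
move=> e e0; exists ((c / e) `^ b^-1) => x xM.
have ce : 0 < c / e by rewrite divr_gt0.
have x0 : 0 < enorm x by apply: le_lt_trans xM; exact: powR_ge0.
have nx : x != 0 by apply: contraTneq x0 => ->; rewrite enorm0 ltxx.
apply: (le_lt_trans (H x nx)); rewrite powRN ltr_pdivrMr ?powR_gt0//.
rewrite mulrC -ltr_pdivrMr//.
have -> : c / e = ((c / e) `^ b^-1) `^ b by rewrite -powRrM mulVf ?gt_eqF// powRr1// ltW.
by rewrite gt0_ltr_powR ?nnegrE ?powR_ge0 ?enorm_ge0.
Qed.

End Existence.

(** * Uniqueness *)

Section Uniqueness.
Context {R : realType} {n : nat}.
Local Notation RR := (measurableTypeR R).
Local Notation leb := (@lebRn R n).
Implicit Types (x y : 'rV[R]_n) (u v w f : 'rV[R]_n -> R).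

Lemma rbox_nbhs x (P : 'rV[R]_n -> Prop) : (\forall y \near x, P y) ->
  exists2 e : R, 0 < e & forall t, rbox x e t -> P (rvec t).
Proof.
move=> /nbhs_ballP[e /= e0 he]; exists e => // t ht.
apply: he; split => // i j; rewrite (ord1 i) mxE.
have := ht j; rewrite /= in_itv/= /ball/= /ball_ => ?.
by rewrite ltr_norml; lra.
Qed.

(** Boxes have positive measure, so the null set outside which F vanishes contains no
    neighbourhood. *)
Lemma ae_eq_nbhs (F : n.-tuple RR -> \bar R) x : ae_eq leb setT F (cst 0%E) ->
  ~ (\forall y \near x, forall t, rvec t = y -> F t != 0%E).
Proof.
move=> [N [mN N0 FN]] /rbox_nbhs[e e0 he].
have : (leb (rbox x e) <= leb N)%E.
  apply: le_measure; rewrite ?inE//; first exact: measurable_rbox.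
  move=> t /he ht; apply: FN => /= H.
  by have := ht t erefl; rewrite H// eqxx.
by rewrite N0 leNgt lebRn_rbox_gt0.
Qed.

Lemma vanishing_attains_max w x0 : continuous w -> vanishes_at_infinity w -> 0 < w x0 ->
  exists2 x, w x0 <= w x & forall y, w y <= w x.
Proof.
move=> cw vw wx0; have [M HM] := vw _ wx0.
(* Outside this ball |w| < w x0, because the Euclidean norm dominates the max norm; the maximum over
   the ball is therefore global. *)
pose r := Num.max `|M| (`|x0|).
pose B := [set y : 'rV[R]_n | `|y| <= r].
have Bx0 : B x0 by rewrite /B/= le_max lexx orbT.
have cB : compact B.
  apply: bounded_closed_compact.
    exists r; split; first exact: num_real.
    by move=> t rt y /= yr; exact: le_trans yr (ltW rt).
  have -> : B = (fun y : 'rV[R]_n => `|y|) @^-1` [set t | t <= r] by [].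
  by apply: preimage_closed => [y _|]; [exact: norm_continuous|exact: closed_le].
have [||x Bx xmax] := @compact_EVT_max _ R w B _ cB.
- by exists x0.
- exact: continuous_subspaceT.
have x0x : w x0 <= w x by apply: xmax; rewrite inE.
exists x => // y; have [yB|yB] := leP `|y| r; first by apply: xmax; rewrite inE.
apply: le_trans x0x; apply: le_trans (ler_norm _) (ltW (HM y _)).
apply: lt_le_trans (norm_le_enorm y); apply: le_lt_trans (ler_norm _) _.
by apply: le_lt_trans yB; rewrite le_max lexx.
Qed.

Lemma classical_solution_continuous s v f : classical_solution s v f -> continuous v.
Proof.
move=> [[e [e0 h]] _]; move: h.
by case: ifP => _ [_ [/(_ [::] isT) []]].
Qed.

Lemma continuous_bounded_mbounded v : continuous v -> bounded_fun v -> exists L, mbounded L v.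
Proof.
move=> cv [L [Lr HL]]; exists (L + 1); apply: continuous_mbounded => // x.
by apply: HL => //; rewrite ltrDl.
Qed.

(** If w = v1 - v2 is positive somewhere, it has a positive maximum at some x. There every truncated
    integral is forced to be zero, so w = w(x) at almost every point, against the decay at
    infinity. *)
Lemma classical_solution_le s v1 v2 f : (0 < n)%N -> 0 < s < 1 ->
  (bounded_fun v1 /\ classical_solution s v1 f /\ vanishes_at_infinity v1) ->
  (bounded_fun v2 /\ classical_solution s v2 f /\ vanishes_at_infinity v2) ->
  forall x, v1 x <= v2 x.
Proof.
move=> n0 s01 [bd1 [cs1 va1]] [bd2 [cs2 va2]] x0; have /andP[s0 s1] := s01.
rewrite leNgt; apply/negP => lt12.
have c1 := classical_solution_continuous cs1; have c2 := classical_solution_continuous cs2.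
have [L1 b1] := continuous_bounded_mbounded c1 bd1.
have [L2 b2] := continuous_bounded_mbounded c2 bd2.
pose w x := v1 x - v2 x.
have cw : continuous w by move=> x; apply: continuousB; [exact: c1|exact: c2].
have vw : vanishes_at_infinity w.
  move=> e e0; have e20 : 0 < e / 2 by rewrite divr_gt0.
  have [M1 H1] := va1 _ e20; have [M2 H2] := va2 _ e20.
  exists (Num.max M1 M2) => x; rewrite gt_max => /andP[/H1 h1 /H2 h2].
  by rewrite [e]splitr; apply: le_lt_trans (ler_normB _ _) _; exact: ltrD.
have wx0 : 0 < w x0 by rewrite subr_gt0.
have [x wx xmax] := vanishing_attains_max cw vw wx0.
have bw := mboundedB b1 b2.
have Tw e : 0 < e -> truncated_integral s w x e =
    truncated_integral s v1 x e - truncated_integral s v2 x e.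
  move=> e0; rewrite (truncated_integralE s x e bw) (truncated_integralE s x e b1) (truncated_integralE s x e b2).
  have bm1 := mboundedB (mbounded_cst (n := n) (v1 x)) (mbounded_sub x b1).
  have bm2 := mboundedB (mbounded_cst (n := n) (v2 x)) (mbounded_sub x b2).
  rewrite -(RintegralB measurableT (integrable_cut s0 e0 bm1) (integrable_cut s0 e0 bm2)).
  by apply: eq_Rintegral => z _; rewrite /w; ring.
have [cv1 e1] := cs1.2 x; have [cv2 e2] := cs2.2 x.
have cns : @c_ns R n s != 0.
  rewrite /c_ns gt_eqF// divr_gt0//.
    rewrite mulr_gt0 ?powR_gt0// Gamma_gt0// ltr_wpDl// divr_ge0//.
  rewrite mulr_gt0 ?powR_gt0 ?pi_gt0// Gamma_NE// divr_gt0// Gamma_gt0//.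
  by rewrite subr_gt0.
have T0 : truncated_integral s w x e @[e --> 0^'+] --> 0.
  have E : lim (truncated_integral s v1 x e @[e --> 0^'+]) = lim (truncated_integral s v2 x e @[e --> 0^'+]).
    by apply: (mulfI cns); move: e1 e2; rewrite /frac_laplacian => -> ->.
  have h := cvgB cv1 cv2; rewrite E subrr in h.
  apply: (@cvg_trans _ ((fun e => truncated_integral s v1 x e - truncated_integral s v2 x e) @ 0^'+)); last exact: h.
  by apply: near_eq_cvg; near=> e; rewrite Tw.
pose q y := w x - w (x - y).
have q0 y : 0 <= q y by rewrite subr_ge0 xmax.
have bq := mboundedB (mbounded_cst (n := n) (w x)) (mbounded_sub x bw).
pose F e (z : n.-tuple RR) := cut e (rvec z) * q (rvec z) / enorm (rvec z) `^ (n%:R + 2 * s).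
have F0 e z : 0 <= F e z by rewrite divr_ge0 ?powR_ge0// mulr_ge0// cut_ge0.
have iF e : 0 < e -> leb.-integrable setT (EFin \o F e).
  by move=> e0; exact: (integrable_cut s0 e0 bq).
have TF e : truncated_integral s w x e = \int[leb]_z F e z by rewrite (truncated_integralE s x e bw).
(* Shrinking the truncation increases the integral of the nonnegative integrand, so its value at e
   is at most the limit 0. *)
have F_eq0 e : 0 < e -> \int[leb]_z F e z = 0.
  move=> e0; apply/eqP; rewrite eq_le Rintegral_ge0// andbT -TF.
  apply: (cvgr_to_ge T0); near=> d.
  have d0 : 0 < d by near: d; exact: nbhs_right_gt.
  have de : d <= e by near: d; exact: nbhs_right_le.
  rewrite !TF; apply: (le_Rintegral measurableT (iF _ e0) (iF _ d0)) => z _.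
  by rewrite /F ler_wpM2r ?invr_ge0 ?powR_ge0// ler_wpM2r// cut_le.
have wxp : 0 < w x by exact: lt_le_trans wx0 wx.
have [M HM] := vw _ wxp; pose i0 := Ordinal n0.
(* A point far out on a coordinate axis, which exists since n >= 1; there w is below its positive
   maximum. *)
pose z : 'rV[R]_n := (`|M| + 1) *: delta_mx ord0 i0.
have wz : w z < w x.
  apply: le_lt_trans (ler_norm _) (HM _ _).
  rewrite enormZ enorm_delta mulr1 ger0_norm ?addr_ge0//.
  by apply: le_lt_trans (ler_norm _) _; rewrite ltrDl.
pose y0 := x - z; have qy0 : 0 < q y0 by rewrite /q /y0 subKr subr_gt0.
have ny0 : 0 < `|y0|.
  by rewrite normr_gt0; apply: contraTneq qy0 => ->; rewrite /q subr0 subrr ltxx.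
(* With this radius the cut-off equals 1 near y0, so the integrand is positive on a neighbourhood of
   y0. *)
have e0 : 0 < `|y0| / 2 by rewrite divr_gt0.
have cq : {for y0, continuous q}.
  apply: (@continuousB _ _ _ (fun=> w x) (fun y => w (x - y))); first exact: cst_continuous.
  apply: (@continuous_comp _ _ _ (fun y => x - y) w); last exact: cw.
  by apply: (@continuousB _ _ _ (fun=> x) id) => //; exact: cst_continuous.
have aeF : ae_eq leb setT (EFin \o F (`|y0| / 2)) (cst 0%E).
  have /integrableP[mF _] := iF _ e0.
  apply/(ae_eq_integral_abs leb measurableT mF).
  transitivity (\int[leb]_t (F (`|y0| / 2) t)%:E)%E.
    by apply: eq_integral => t _; rewrite /= ger0_norm.
  by rewrite -(EFin_Rintegral measurableT (iF _ e0)) F_eq0.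
apply: (ae_eq_nbhs aeF (x := y0)); near=> y => t ty.
have qy : 0 < q y by near: y; exact: (cvgr_gt _ cq).
have yn : `|y0| / 2 < `|y|.
  near: y; apply: (cvgr_gt `|y0|); last by rewrite ltr_pdivrMr// ltr_pMr// ltr1n.
  exact: norm_continuous.
have ey : `|y0| / 2 < enorm y by exact: lt_le_trans yn (norm_le_enorm y).
rewrite /= /F ty cutE ey mul1r eqe gt_eqF// divr_gt0// powR_gt0//.
exact: lt_trans ey.
Unshelve. all: by end_near. Qed.

End Uniqueness.

Theorem theorem13 (R : realType) (n : nat) (s alpha : R) (hn : (1 <= n)%N)
    (hs : 0 < s < Num.min 1 (n%:R / 2)) (halpha : 0 < alpha <= 1) :
  (exists C : R, 0 < C /\
    forall f : 'rV[R]_n -> R, in_Ch 0 alpha f -> compactly_supported f ->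
    let u := inv_frac_laplacian s f in
    let bound := (C%:E * (Linfty_norm u + Ch_norm 0 alpha f))%E in
    [/\ alpha + 2 * s < 1 ->
          in_Ch 0 (alpha + 2 * s) u /\
          (Ch_norm 0 (alpha + 2 * s) u <= bound)%E,
        1 < alpha + 2 * s < 2 ->
          in_Ch 1 (alpha + 2 * s - 1) u /\
          (Ch_norm 1 (alpha + 2 * s - 1) u <= bound)%E,
        2 < alpha + 2 * s < 3 ->
          in_Ch 2 (alpha + 2 * s - 2) u /\
          (Ch_norm 2 (alpha + 2 * s - 2) u <= bound)%E &
        forall k : nat, k = 1%N \/ k = 2%N -> alpha + 2 * s = k%:R ->
          in_zygmund k u /\ (zygmund_norm k u <= bound)%E]) /\
  (forall f : 'rV[R]_n -> R, in_Ch 0 alpha f -> compactly_supported f ->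
    let u := inv_frac_laplacian s f in
    let P := fun v : 'rV[R]_n -> R =>
      [/\ bounded_fun v, classical_solution s v f & vanishes_at_infinity v] in
    P u /\ forall v, P v -> v = u).
Proof.
move: hs; rewrite lt_min => /and3P[s0 s1 sn]; have /andP[a0 a1] := halpha.
have s01 : 0 < s < 1 by rewrite s0.
split; first exact: schauder_estimates.
move=> f hf cf u P; rewrite {}/u inv_frac_laplacianE.
have [M [A [K [df _]]]] := dominated_of_in_Ch a0 hf cf.
have Pu : P (riesz_deriv s [::] f).
  split; first exact: (bounded_fun_riesz a0 s01 sn df).
    exact: (riesz_classical_solution a0 a1 s01 sn df).
  exact: (vanishes_riesz s01 sn df).
split=> // v Pv; apply/funext => x; apply/eqP; rewrite eq_le.
have PE w : P w -> bounded_fun w /\ classical_solution s w f /\ vanishes_at_infinity w by case.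
by rewrite !(classical_solution_le hn s01 (PE _ _) (PE _ _)).
Qed.
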